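(* Let $\theta\in\mathbb{R}$ and $Y_i=\theta+X_i$, $i\ge1$, where $(X_i)_{i\ge 1}$ is a stationary mean-zero Gaussian process with covariances $\rho(k)=\mathbb{E}(X_1X_{k+1})$ satisfying $\rho(0)=1$ and $\rho(k)=k^{-D}L(k)$ for $k\ge1$, where $0<D<1$ and $L$ is slowly varying at infinity and positive for large $k$. Then, as $n\to\infty$, the Hodges–Lehmann estimator $\hat\theta_{HL}$ satisfies $$n^{D/2}L(n)^{-1/2}(\hat\theta_{HL}-\theta)\stackrel{d}{\longrightarrow}k(D)^{-1/2}Z_{1,D}(1),$$ where $k(D)^{-1/2}Z_{1,D}(1)$ is a zero-mean Gaussian random variable with variance $2(-D+1)^{-1}(-D+2)^{-1}$. Thus $\hat\theta_{HL}$ converges to $\theta$ at the same rate and with the same limiting distribution as the sample mean $\bar Y_n=n^{-1}\sum_{i=1}^nY_i$, i.e. also $$n^{D/2}L(n)^{-1/2}(\bar Y_n-\theta)\stackrel{d}{\longrightarrow}k(D)^{-1/2}Z_{1,D}(1).$$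
   Context: The Hodges–Lehmann estimator based on $Y_1,\dots,Y_n$ is $\hat\theta_{HL}=\mathrm{median}\{(Y_i+Y_j)/2;\ 1\le i<j\le n\}$, understood as $\hat\theta_{HL}=\theta+U_n^{-1}(1/2)$, where $U_n(r)=\frac{1}{n(n-1)}\sum_{1\le i\ne j\le n}\mathbf{1}_{\{(X_i+X_j)/2\le r\}}$ and $U_n^{-1}(p)=\inf\{r:\ U_n(r)\ge p\}$. With $B$ a standard Brownian motion on $\mathbb{R}$, $Z_{1,D}(t)=\int_{\mathbb{R}}[\int_0^t(u-x)_+^{-(D+1)/2}du]\,dB(x)$, $0<D<1$. The constant is $k(D)=\mathrm{B}((1-D)/2,D)$ where $\mathrm{B}(\alpha,\beta)=\Gamma(\alpha)\Gamma(\beta)/\Gamma(\alpha+\beta)$ is the Beta function. $\stackrel{d}{\longrightarrow}$ is convergence in distribution. *)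

(* Defs.v *)
From HB Require Import structures.
From mathcomp Require Import all_boot all_order all_algebra.
From mathcomp Require Import all_classical all_reals all_analysis.
From mathcomp Require Import measurable_realfun lra.
Set Implicit Arguments.
Unset Strict Implicit.
Unset Printing Implicit Defensive.
Import Order.TTheory GRing.Theory Num.Theory.
Import numFieldNormedType.Exports.
Local Open Scope classical_set_scope.
Local Open Scope ring_scope.

Section gaussian.
Context d (T : measurableType d) (R : realType) (P : probability T R).

(* [normal_prob m 0] is not a point mass in the library, hence the case split. *)
Definition gaussian_law (m v : R) : set R -> \bar R :=
  if v == 0 then \d_m else normal_prob m (Num.sqrt v).

Definition gaussian_rv (X : {RV P >-> R}) (m v : R) :=
  forall A : set R, measurable A -> distribution P X A = gaussian_law m v A.

(* Processes are indexed from 0: [X i] stands for X_{i+1}. *)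
Definition gaussian_process (X : nat -> {RV P >-> R}) :=
  forall n (c : 'I_n -> R), exists m v : R,
    0 <= v /\ gaussian_rv (\sum_(i < n) scale_mfun (c i) (X i)) m v.

Definition stationary (X : nat -> {RV P >-> R}) :=
  forall (n h : nat) (A : set (n.-tuple R)), measurable A ->
    P [set w | A [tuple X (h + i)%N w | i < n]] =
    P [set w | A [tuple X i w | i < n]].

(* Each [A i] may be [setT], so this covers all subfamilies. *)
Definition independent_rvs n (X : 'I_n -> {RV P >-> R}) :=
  forall A : 'I_n -> set R, (forall i, measurable (A i)) ->
    P (\bigcap_i (X i @^-1` A i)) = (\prod_(i < n) P (X i @^-1` A i))%E.

(* Two-sided: the index t ranges over the whole real line. *)
Definition brownian_motion (B : R -> {RV P >-> R}) :=
  [/\ {ae P, forall w, B 0 w = 0},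
      forall s t, s <= t -> gaussian_rv (B t - B s) 0 (t - s),
      forall n (t : nat -> R), {homo t : i j / (i <= j)%N >-> i <= j} ->
        independent_rvs (fun i : 'I_n => B (t i.+1) - B (t i)) &
      {ae P, forall w, continuous (fun t => B t w)}].

(* The list s of triples ((a, b), c) encodes the step function
   sum of the c 1_{]a, b]}. *)
Definition step_fun (s : seq (R * R * R)) (x : R) : R :=
  \sum_(p <- s) p.2 * \1_`]p.1.1, p.1.2] x.

Definition step_int (B : R -> {RV P >-> R}) (s : seq (R * R * R)) (w : T) : R :=
  \sum_(p <- s) p.2 * (B p.1.2 w - B p.1.1 w).

(* Z is a version of the Wiener integral of f with respect to B: the
   L^2(P)-limit of the elementary integrals of step functions converging to f
   in L^2(R). *)
Definition wiener_integral (B : R -> {RV P >-> R}) (f : R -> R)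
    (Z : {RV P >-> R}) :=
  measurable_fun setT f /\
  exists s : nat -> seq (R * R * R),
    [/\ forall n p, p \in s n -> p.1.1 <= p.1.2,
        ('N[lebesgue_measure]_2%:E[EFin \o (f \- step_fun (s n))%R]
           @[n --> \oo] --> 0)%E &
        ('N[P]_2%:E[EFin \o (Z \- step_int B (s n))%R]
           @[n --> \oo] --> 0)%E].

End gaussian.

Section special.
Context (R : realType).
Local Notation mu := (@lebesgue_measure R).

Definition Gamma (a : R) : R :=
  \int[mu]_(x in `]0, +oo[) (x `^ (a - 1) * expR (- x)).

Definition Beta (a b : R) : R := Gamma a * Gamma b / Gamma (a + b).

Definition kconst (D : R) : R := Beta ((1 - D) / 2) D.

(* [powR] sends negative numbers to 1, hence the explicit truncation. *)
Definition pos_powR (y a : R) : R := if 0 < y then y `^ a else 0.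

(* Integrand of Z_{1,D}(t). *)
Definition Z1_kernel (D t x : R) : R :=
  \int[mu]_(u in `[0, t]) pos_powR (u - x) (- ((D + 1) / 2)).

Definition slowly_varying (L : R -> R) :=
  (exists A : R, measurable_fun `[A, +oo[ L) /\
  forall a, 0 < a -> L (a * x) / L x @[x --> +oo] --> (1 : R).

End special.

Definition cvg_in_distribution d (T : measurableType d) d' (T' : measurableType d')
    (R : realType) (P : probability T R) (Q : probability T' R)
    (X : nat -> {RV P >-> R}) (Z : {RV Q >-> R}) :=
  forall x : R, {for x, continuous (cdf Z)} ->
    cdf (X n) x @[n --> \oo] --> cdf Z x.

Section hodges_lehmann.
Context (R : realType).

Definition U_process (x : nat -> R) (n : nat) (r : R) : R :=
  (n%:R * (n%:R - 1))^-1 *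
  \sum_(i < n) \sum_(j < n | i != j) ((x i + x j) / 2 <= r)%R%:R.

Definition generalized_inverse (F : R -> R) (p : R) : R :=
  inf [set r | p <= F r].

Definition hodges_lehmann (theta : R) T (X : nat -> T -> R) (n : nat) (w : T) : R :=
  theta + generalized_inverse (U_process (X ^~ w) n) 2^-1.

Definition sample_mean T (Y : nat -> T -> R) (n : nat) (w : T) : R :=
  n%:R^-1 * \sum_(i < n) Y i w.


Lemma U_process_le (x : nat -> R) n : {homo U_process x n : r s / r <= s}.
Proof.
move=> r s rs; rewrite /U_process ler_wpM2l//.
  rewrite invr_ge0; case: n => [|n]; first by rewrite mul0r.
  by rewrite mulr_ge0// -natr1 addrK.
apply: ler_sum => i _; apply: ler_sum => j _; rewrite ler_nat.
by case: leP => // xr; rewrite (le_trans xr rs).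
Qed.

Lemma U_process_lt2 (x : nat -> R) n r : (n < 2)%N -> U_process x n r = 0.
Proof.
rewrite /U_process; case: n => [|[|]]//= _; first by rewrite mul0r invr0 mul0r.
by rewrite subrr mulr0 invr0 mul0r.
Qed.

Let bound (x : nat -> R) n := \sum_(i < n) `|x i|.

Let bound_le (x : nat -> R) n (i : 'I_n) : `|x i| <= bound x n.
Proof. by rewrite /bound (bigD1 i)//= lerDl sumr_ge0. Qed.

Lemma has_inf_U_process (x : nat -> R) n : (2 <= n)%N ->
  has_inf [set r | 2^-1 <= U_process x n r].
Proof.
move=> n2; split.
  exists (bound x n); rewrite /= /U_process.
  under eq_bigr => i _.
    rewrite (eq_bigr (fun=> 1)); last first.
      move=> j _; have := bound_le x i; have := bound_le x j.
      by rewrite !ler_norml => /andP[_ ?] /andP[_ ?]; case: leP => // ?; exfalso; lra.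
    rewrite sumr_const (_ : #|_| = n.-1); last first.
      have := cardC1 i; rewrite card_ord => <-; apply: eq_card => j.
      by rewrite !inE eq_sym.
    over.
  rewrite sumr_const card_ord -[X in _ <= _ * X]mulr_natl.
  case: n n2 => [|[|n]]// _.
  by rewrite -[in n.+2%:R - 1]natr1 addrK mulVf ?invf_le1 ?ler1n//.
exists (- bound x n) => r /=; rewrite leNgt => h.
rewrite leNgt; apply/negP => rb; move/negP: h; apply.
rewrite /U_process big1 ?mulr0 ?invr_gt0// => i _; rewrite big1// => j _.
have := bound_le x i; have := bound_le x j.
rewrite !ler_norml => /andP[? _] /andP[? _].
by case: leP => // ?; exfalso; lra.
Qed.

(* The estimator is a function of the observations Y_i = theta + X_i alone. *)
Lemma hodges_lehmannE (theta : R) T (X : nat -> T -> R) n w : (2 <= n)%N ->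
  hodges_lehmann theta X n w =
  generalized_inverse (U_process (fun i => theta + X i w) n) 2^-1.
Proof.
move=> n2; rewrite /hodges_lehmann /generalized_inverse.
rewrite -[in LHS](inf1 theta) -inf_sumE; last 2 first.
- by split; [exists theta | exists theta => _ ->].
- exact: has_inf_U_process.
have Ushift r : U_process (fun i => theta + X i w) n (theta + r) =
    U_process (X ^~ w) n r.
  rewrite /U_process; congr (_ * _); apply: eq_bigr => i _.
  apply: eq_bigr => j _; congr (nat_of_bool _)%:R.
  by apply/idP/idP => ?; lra.
congr inf; apply/seteqP; split => r /=.
  by move=> [_ ->] [s /= Us <-]; rewrite Ushift.
move=> Ur; exists theta => //; exists (r - theta); last by rewrite addrC subrK.
by rewrite /= -Ushift addrC subrK.
Qed.

Context d (T : measurableType d).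

Lemma measurable_U_process (X : nat -> {mfun T >-> R}) n r :
  measurable_fun setT (fun w => U_process (fun i => X i w) n r).
Proof.
apply: measurable_funM => //; apply: measurable_sum => i.
rewrite (_ : (fun _ => _) = fun w => \sum_(j < n)
    if i != j then ((X i w + X j w) / 2 <= r)%R%:R else 0); last first.
  by apply/funext => w; rewrite big_mkcond.
apply: measurable_sum => j; case: (i != j) => //.
have mle : measurable_fun setT (fun w => (X i w + X j w) / 2 <= r).
  apply: measurable_fun_ler => //; apply: measurable_funM => //.
  exact: measurable_funD.
rewrite (_ : (fun _ => _) = (fun b : bool => b%:R : R) \o
  (fun w => (X i w + X j w) / 2 <= r))//.
exact: measurableT_comp.
Qed.

Lemma measurable_hodges_lehmann (theta : R) (X : nat -> {mfun T >-> R}) n :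
  measurable_fun setT (hodges_lehmann theta X n).
Proof.
apply: measurable_funD => //.
have [n2|n2] := ltnP n 2.
  rewrite (_ : (fun _ => _) = cst (inf set0))//.
  apply/funext => w; rewrite /generalized_inverse/=; congr inf.
  by apply/seteqP; split => r //=; rewrite U_process_lt2// leNgt invr_gt0 ltr0n.
apply: (measurability _ (RGenInftyO.measurableE R)) => _ [_ [y ->] <-].
rewrite setTI.
have -> : (fun w => generalized_inverse (U_process (X ^~ w) n) 2^-1) @^-1`
    `]-oo, y[ =
  \bigcup_(q in [set q : rat | ratr q < y])
    [set w | 2^-1 <= U_process (fun i => X i w) n (ratr q)].
  apply/seteqP; split => w /=.
    rewrite in_itv/= => infy.
    have hinf := has_inf_U_process (fun i => X i w) n2.
    have e0 : 0 < y - generalized_inverse (U_process (X ^~ w) n) 2^-1.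
      by rewrite subr_gt0.
    have [r /= Ur ry] := inf_adherent e0 hinf.
    rewrite /generalized_inverse addrC subrK in ry.
    have [q] := rat_in_itvoo ry; rewrite in_itv/= => /andP[rq qy].
    by exists q => //=; apply: (le_trans Ur); apply/U_process_le/ltW.
  move=> [q /= qy Uq]; rewrite in_itv/=; apply: le_lt_trans qy.
  by apply: ge_inf => //=; have [] := has_inf_U_process (fun i => X i w) n2.
rewrite bigcup_mkcond; apply: bigcupT_measurable_rat => q.
case: ifPn => // _.
rewrite -[X in measurable X]setTI.
have := measurable_fun_ler (measurable_cst (2^-1 : R))
  (measurable_U_process X n (ratr q)).
by move=> /(_ measurableT [set true] I); rewrite setTI.
Qed.

Lemma measurable_sample_mean (Y : nat -> {mfun T >-> R}) n :
  measurable_fun setT (sample_mean Y n).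
Proof. by apply: measurable_funM => //; exact: measurable_sum. Qed.

HB.instance Definition _ theta (X : nat -> {mfun T >-> R}) n :=
  isMeasurableFun.Build _ _ T R (hodges_lehmann theta X n)
    (measurable_hodges_lehmann theta X n).

HB.instance Definition _ (Y : nat -> {mfun T >-> R}) n :=
  isMeasurableFun.Build _ _ T R (sample_mean Y n) (measurable_sample_mean Y n).

End hodges_lehmann.

(* Main.v *)
(* Let a_n = rho(n)^(-1/2) = n^(D/2) L(n)^(-1/2) and v = 2 / ((1 - D) (2 - D)).
   The sample mean is exactly Gaussian, and by Karamata-type estimates its
   variance times 1 / rho(n) tends to v.  For the Hodges-Lehmann estimator, the
   event that a_n times its error is at most x is U_n(x / a_n) >= 1/2.  Each
   centered indicator 1{(X_i + X_j)/2 <= r} is split into a linear term and a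
   residual orthogonal to (X_i + X_j)/2.  Such residuals have Hermite rank at
   least 2, so the covariance of two of them is O(t^2), t being the correlation
   of the two averages, and the mean square of their average over i <> j is
   O(n^(-2) sum_(i,j) rho(|i - j|)^2) = o(rho(n)).  Hence, for r = x / a_n,
   a_n (U_n(r) - 1/2) = c (x - a_n mean) + o_P(1) with c > 0, and the two
   estimators have the same limit law.  The Wiener integral is Gaussian as an
   L^2 limit of Gaussian step integrals, and Tonelli together with the Beta
   integral gives k(D) v as its variance. *)

Require Import Defs.
From HB Require Import structures.
From mathcomp Require Import all_boot all_order all_algebra.
From mathcomp Require Import all_classical all_reals all_analysis.
From mathcomp Require Import measurable_realfun ring lra zify.
Set Implicit Arguments.
Unset Strict Implicit.
Unset Printing Implicit Defensive.
Import Order.TTheory GRing.Theory Num.Theory.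
Import numFieldNormedType.Exports.
Local Open Scope classical_set_scope.
Local Open Scope ring_scope.

(** Laws are identified through integrals of [cos] and [sin], never through joint densities:
    [gaussian_process] speaks only of linear combinations and [independent_rvs] only of products of
    probabilities, and both yield such integrals. Gaussian smoothing turns equality of these
    integrals into equality of laws.

    The average of a pair with correlation t has variance (1 + t)/2, so each pair has its own
    normalization and slope. A common slope c, that of an uncorrelated pair, is restored as follows:
    pairs with |t| > 1/2, whose normalization may blow up, are estimated crudely, being too few to
    matter; for the others the replacement costs |t| + r^2. Hence two error terms of different
    nature. The residuals are of order 1 each, small only on average, and need the L^2 bound; the
    replacement errors are summed in L^1, where they are O(rho(n)), which a_n = rho(n)^(-1/2) still
    sends to zero.

    Slow variation enters through a uniform comparison of rho(j) and rho(k) for j <= k <= U j;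
    Potter's bound follows from it by halving the index. *)

Section prelim.
Context {R : realType}.
Local Notation mu := (@lebesgue_measure R).

Lemma measurable_affine (a b : R) : measurable_fun setT (fun x : R => a * x + b).
Proof. by apply: measurable_funD => //; exact: measurable_funM. Qed.

(** The image of Lebesgue measure under the affine map, multiplied by [|a|], gives every interval
    its length, so it is Lebesgue measure by uniqueness. The sign of [a] decides which end of the
    preimage interval is closed, hence the two cases. *)
Lemma ge0_integral_affine (a b : R) (f : R -> \bar R) : a != 0 ->
  measurable_fun setT f -> (forall x, (0 <= f x)%E) ->
  (\int[mu]_x f (a * x + b)%R = (`|a|^-1)%:E * \int[mu]_x f x)%E.
Proof.
move=> a0 mf f0.
have na : 0 <= `|a| by [].
pose m2_ : {measure set (measurableTypeR R) -> \bar R} :=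
  mscale (NngNum na) (pushforward mu
    (fun x : measurableTypeR R => (a * x + b : measurableTypeR R))).
pose m2 := m2_ (measurable_affine a b).
have mum2 A : measurable A -> mu A = m2 A.
  apply: lebesgue_measure_unique => _ [[c d]]/= _ <-.
  rewrite /m2 /m2_ /mscale/= /pushforward.
  have [a_gt0|a_lt0|/eqP] := ltgtP 0 a; last by rewrite eq_sym (negbTE a0).
    have -> : (fun x : R => a * x + b) @^-1` `]c, d] =
        `](c - b) / a, (d - b) / a]%classic.
      apply/seteqP; split => x /=; rewrite !in_itv/= ltr_pdivrMr// ler_pdivlMr//.
        by move=> /andP[? ?]; apply/andP; split; lra.
      by move=> /andP[? ?]; apply/andP; split; lra.
    rewrite !lebesgue_measure_itv/= !lte_fin ltr_pM2r ?invr_gt0// ltrD2r.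
    rewrite gtr0_norm//; case: ifPn => cd; last by rewrite mule0.
    by rewrite -!EFinB -EFinM; congr EFin; field; exact/lt0r_neq0.
  have -> : (fun x : R => a * x + b) @^-1` `]c, d] =
      `[(d - b) / a, (c - b) / a[%classic.
    apply/seteqP; split => x /=; rewrite !in_itv/= ltr_ndivlMr// ler_ndivrMr//.
      by move=> /andP[? ?]; apply/andP; split; lra.
    by move=> /andP[? ?]; apply/andP; split; lra.
  rewrite !lebesgue_measure_itv/= !lte_fin ltr_nM2r ?invr_lt0// ltrD2r.
  rewrite ltr0_norm//; case: ifPn => cd; last by rewrite mule0.
  by rewrite -!EFinB -EFinM; congr EFin; field; exact/ltr0_neq0.
have -> : (\int[mu]_x f x = \int[m2]_x f x)%E.
  by apply: eq_measure_integral => A mA _; exact: mum2.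
rewrite /m2 /m2_ ge0_integral_mscale//= ge0_integral_pushforward//=; last first.
  exact: measurable_affine.
rewrite muleA -EFinM mulVf ?normr_eq0// mul1e.
by rewrite preimage_setT.
Qed.

(** The upper half-lines form a generating family closed under intersection. The common finite total
    mass serves to pass from lower half-lines to their complements. *)
Lemma halfline_measure_unique (m1 m2 : {measure set R -> \bar R}) :
  (m1 setT < +oo)%E -> m1 setT = m2 setT ->
  (forall q : R, m1 `]-oo, q]%classic = m2 `]-oo, q]%classic) ->
  forall A, measurable A -> m1 A = m2 A.
Proof.
move=> m1oo m12T m12.
have fin1 q : (m1 `]-oo, q]%classic < +oo)%E.
  by apply: le_lt_trans m1oo; rewrite le_measure ?inE.
have E q : m1 `]q, +oo[%classic = m2 `]q, +oo[%classic.
  rewrite -setCitvl -!setTD !measureD//; rewrite ?setTI.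
    congr (_ - _)%E; [exact: m12T|exact: m12].
  by rewrite [X in (X < _)%E](_ : _ = m1 [set: R])//; exact/esym/m12T.
apply: (@measure_unique _ R _ (@RGenOInfty.G R) (fun n => `](- n%:R), +oo[%classic)).
- exact: RGenOInfty.measurableE.
- move=> _ _ [x ->] [y ->]; exists (Num.max x y).
  by apply/seteqP; split => z; rewrite /= !in_itv/= !andbT gt_max => /andP.
- by move=> i; exists (- i%:R).
- apply/seteqP; split => // x _; exists (Num.truncn `|x|).+1 => //=.
  rewrite in_itv/= andbT ltrNl; apply: le_lt_trans (truncnS_gt _).
  by rewrite -normrN ler_norm.
- by move=> _ [x ->]; exact: E.
- by move=> k; apply: le_lt_trans m1oo; rewrite le_measure ?inE.
Qed.

(** The Radon-Nikodym derivative of the normal law and [normal_pdf] have the same integral over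
    every measurable set, hence agree almost everywhere; the change of variables for the derivative
    then applies to the density. *)
Lemma ge0_integral_normal_prob (s : R) (f : R -> \bar R) :
  measurable_fun setT f -> (forall x, (0 <= f x)%E) ->
  (\int[normal_prob 0 s]_x f x = \int[mu]_x (f x * (normal_pdf 0 s x)%:E))%E.
Proof.
move=> mf f0.
have mn : measurable_fun setT (fun x : R => (normal_pdf 0 s x)%:E).
  by apply/measurable_EFinP; exact: measurable_normal_pdf.
have n0 x : (0 <= (normal_pdf 0 s x)%:E)%E by rewrite lee_fin normal_pdf_ge0.
rewrite -(Radon_Nikodym_SigmaFinite.change_of_variables (@normal_prob_dominates R 0 s))//.
apply: ae_eq_integral => //.
- apply: emeasurable_funM => //; apply: (measurable_int mu).
  apply: Radon_Nikodym_SigmaFinite.f_integrable; exact: normal_prob_dominates.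
- exact: emeasurable_funM.
- apply: ae_eqe_mul2l => /=.
  apply: integral_ae_eq => //=.
  + apply: Radon_Nikodym_SigmaFinite.f_integrable; exact: normal_prob_dominates.
  + move=> E _ mE; rewrite -Radon_Nikodym_SigmaFinite.f_integral//.
    exact: normal_prob_dominates.
Qed.

End prelim.

Lemma Rintegral_prob_cst d (T : measurableType d) (R : realType)
  (P : probability T R) (r : R) : \int[P]_x r = r.
Proof.
rewrite Rintegral_cst// -[RHS]mulr1; congr (_ * _).
by rewrite [X in fine X](_ : _ = 1%E)//; exact: probability_setT.
Qed.

Lemma measurable_cosT d (T : measurableType d) (R : realType) (D : set T) (f : T -> R) :
  measurable_fun D f -> measurable_fun D (fun x => cos (f x)).
Proof.
move=> mf; apply: (measurableT_comp _ mf).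
exact: continuous_measurable_fun (@continuous_cos R).
Qed.

Lemma measurable_sinT d (T : measurableType d) (R : realType) (D : set T) (f : T -> R) :
  measurable_fun D f -> measurable_fun D (fun x => sin (f x)).
Proof.
move=> mf; apply: (measurableT_comp _ mf).
exact: continuous_measurable_fun (@continuous_sin R).
Qed.

(** * The standard Gaussian law *)

Section gauss.
Context {R : realType}.
Local Notation mu := (@lebesgue_measure R).
Local Notation gam := (@normal_prob R 0 1).

Definition gpdf (x : R) : R := (Num.sqrt (pi *+ 2))^-1 * expR (- (x ^+ 2 / 2)).

Lemma gpdfE : normal_pdf 0 1 = gpdf.
Proof.
apply/funext => x; rewrite normal_pdfE ?oner_neq0// /gpdf /normal_peak /normal_fun.
by rewrite !expr1n mul1r subr0 mulNr mulr2n.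
Qed.

Lemma peak_le1 : (Num.sqrt (pi *+ 2))^-1 <= 1 :> R.
Proof.
rewrite invf_le1.
  rewrite -[leLHS]sqrtr1 ler_sqrt; last by rewrite mulrn_wge0// pi_ge0.
  by have := pi_ge2 R; rewrite -mulr_natr; lra.
by rewrite sqrtr_gt0 mulrn_wgt0// pi_gt0.
Qed.

Lemma gpdf_gt0 x : 0 < gpdf x.
Proof.
by rewrite mulr_gt0 ?expR_gt0// invr_gt0 sqrtr_gt0 mulrn_wgt0// pi_gt0.
Qed.

Lemma gpdf_le1 x : gpdf x <= 1.
Proof.
rewrite -[leRHS]mulr1 ler_pM ?expR_ge0 ?peak_le1//; last first.
  by rewrite -expR0 ler_expR oppr_le0 mulr_ge0// sqr_ge0.
Qed.

Lemma gpdfN x : gpdf (- x) = gpdf x.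
Proof. by rewrite /gpdf sqrrN. Qed.

Lemma measurable_gpdf : measurable_fun setT gpdf.
Proof. by rewrite -gpdfE; exact: measurable_normal_pdf. Qed.

Lemma is_derive_gpdf x : is_derive x (1 : R) gpdf (- x * gpdf x).
Proof.
have h : is_derive x (1 : R) (fun y : R => - (y ^+ 2 / 2)) (- x).
  by apply: is_derive_eq; rewrite /GRing.scale/=; field.
have := @is_derive1_comp R expR (fun y : R => - (y ^+ 2 / 2)) x _ _
  (is_derive_expR _) h.
move=> /(@is_deriveZ _ _ _ _ (Num.sqrt (pi *+ 2))^-1)/is_derive_eq; apply.
by rewrite /gpdf /GRing.scale/= mulrCA [RHS]mulrC mulrA mulrC; ring.
Qed.

Lemma continuous_gpdf : continuous gpdf.
Proof. by rewrite -gpdfE; apply: continuous_normal_pdf; exact: oner_neq0. Qed.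

(** Widening the standard deviation from 1 to 2 absorbs the polynomial factor, so one majorant with
    known integral handles every integrand of growth [(1 + x ^+ 2) ^+ 2]. *)
Lemma gpdf_poly_bound : exists2 K : R, 0 <= K &
  forall x, (1 + x ^+ 2) ^+ 2 * gpdf x <= K * normal_pdf 0 2 x.
Proof.
have two : (2 : R) != 0 by [].
pose K : R := (16 / 3) ^+ 2 / normal_peak 2.
have p0 : 0 < normal_peak (2 : R) by rewrite normal_peak_gt0.
exists K; first by rewrite mulr_ge0 ?invr_ge0 ?exprn_ge0 ?mulr_ge0// ltW.
move=> x; rewrite normal_pdfE// /K [leRHS]mulrA divfK ?gt_eqF//.
rewrite /gpdf mulrCA.
(* The exponents match since 1/2 = 2 (3/16) + 1/8. The first part dominates [(1 + x ^+ 2) ^+ 2],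
   because 1 + x^2 <= (16/3) (1 + 3 x^2 / 16) <= (16/3) exp(3 x^2 / 16). *)
have -> : expR (- (x ^+ 2 / 2)) = expR (x ^+ 2 * (3 / 16)) ^- 2 * normal_fun 0 2 x.
  rewrite /normal_fun -expRM_natl -expRN -expRD subr0; congr expR.
  by rewrite -mulr_natr; field.
have e0 : 0 < expR (x ^+ 2 * (3 / 16)) by exact: expR_gt0.
have h : (1 + x ^+ 2) ^+ 2 <= (16 / 3) ^+ 2 * expR (x ^+ 2 * (3 / 16)) ^+ 2.
  rewrite -exprMn ler_pXn2r ?nnegrE ?addr_ge0 ?sqr_ge0 ?mulr_ge0 ?expR_ge0//.
  have := expR_ge1Dx (x ^+ 2 * (3 / 16)); have := sqr_ge0 x.
  by lra.
have aux (A e B n p : R) : A <= B * e -> 0 <= A -> 0 <= n -> 0 < e -> 0 <= p ->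
    p <= 1 -> p * (A * (e^-1 * n)) <= B * n.
  move=> Ae A0 n0 e1 p1 p2; rewrite (_ : _ * _ = p * (A / e) * n); last by ring.
  apply: ler_wpM2r => //; rewrite -[leRHS]mul1r; apply: ler_pM => //.
    by rewrite divr_ge0// ltW.
  by rewrite ler_pdivrMr.
apply: aux => //; rewrite ?exprn_ge0 ?addr_ge0 ?sqr_ge0 ?exprn_gt0 ?peak_le1 ?normal_fun_ge0//.
Qed.

Lemma gauss_integrable (f : R -> R) c : measurable_fun setT f ->
  (forall x, `|f x| <= c * (1 + x ^+ 2) ^+ 2) -> gam.-integrable setT (EFin \o f).
Proof.
move=> mf fc; have [K K0 Kb] := gpdf_poly_bound.
apply/integrableP; split; first exact/measurable_EFinP.
have c0 : 0 <= c by have := fc 0; rewrite expr0n/= addr0 expr1n mulr1; exact: le_trans.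
rewrite ge0_integral_normal_prob//; last first.
  by apply/measurable_EFinP; exact: measurableT_comp.
apply: (@le_lt_trans _ _ (\int[mu]_x ((c * K)%:E * (normal_pdf 0 2 x)%:E))%E).
  apply: ge0_le_integral => //=.
  - by move=> x _; rewrite mule_ge0// lee_fin// normal_pdf_ge0.
  - apply/measurable_EFinP/measurable_funM; last exact: measurable_normal_pdf.
    exact: measurableT_comp.
  - apply/measurable_EFinP; apply: measurable_funM => //; exact: measurable_normal_pdf.
  - move=> x _; rewrite gpdfE lee_fin -mulrA.
    apply: le_trans (ler_wpM2l c0 (Kb x)); rewrite [leRHS]mulrA ler_wpM2r ?fc//.
    by rewrite ltW// gpdf_gt0.
rewrite integralZl//; last exact: integrable_normal_pdf.
by rewrite integral_normal_pdf mule1 ltry.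
Qed.

Lemma integral_gam (f : R -> R) : gam.-integrable setT (EFin \o f) ->
  mu.-integrable setT (EFin \o (fun x => f x * gpdf x)) /\
  \int[gam]_x f x = \int[mu]_x (f x * gpdf x).
Proof.
move=> /integrableP[mf fi]; split.
  apply/integrableP; split.
    apply/measurable_EFinP/measurable_funM; [exact/measurable_EFinP|exact: measurable_gpdf].
  move: fi; rewrite ge0_integral_normal_prob//; last first.
    by apply: measurableT_comp.
  apply: le_lt_trans; rewrite le_eqVlt; apply/orP; left; apply/eqP.
  apply: eq_integral => x _ /=; rewrite gpdfE normrM EFinM; congr (_ * (_)%:E)%E.
  by rewrite ger0_norm// ltW// gpdf_gt0.
rewrite /Rintegral; congr fine; rewrite [LHS]integralE [RHS]integralE.
have p0 x := ltW (gpdf_gt0 x).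
congr (_ - _)%E; (rewrite ge0_integral_normal_prob; last first).
- exact: funepos_ge0.
- exact: measurable_funepos.
- by apply: eq_integral => x _; rewrite gpdfE !funeposE/= -!EFin_max -EFinM maxr_pMl// mul0r.
- exact: funeneg_ge0.
- exact: measurable_funeneg.
- apply: eq_integral => x _.
  by rewrite gpdfE !funenegE/= -!EFin_max -EFinM maxr_pMl// mul0r mulNr.
Qed.

(** The integrand times [gpdf] is the derivative of [g] times [gpdf], so integrals over growing
    intervals reduce to boundary values that vanish. The choices 1, x and sin(s x) for [g] yield the
    mean, the variance and the differential equation of the cosine transform. *)
Lemma gauss_stein (g dg : R -> R) c :
  (forall x, is_derive x (1 : R) g (dg x)) -> continuous dg ->
  (forall x, `|g x| <= c * (1 + x ^+ 2)) ->
  (forall x, `|dg x - x * g x| <= c * (1 + x ^+ 2) ^+ 2) ->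
  \int[gam]_x (dg x - x * g x) = 0.
Proof.
move=> dgP cdg gc dgc.
have cg : continuous g.
  by move=> x; apply: differentiable_continuous; apply/derivable1_diffP; case: (dgP x).
have cdf : continuous (fun x => dg x - x * g x).
  by move=> x; apply: cvgB; [exact: cdg|apply: cvgM; [exact: cvg_id|exact: cg]].
have cf : continuous (fun x => (dg x - x * g x) * gpdf x).
  by move=> x; apply: cvgM; [exact: cdf|exact: continuous_gpdf].
have mdf : measurable_fun setT (fun x => dg x - x * g x).
  exact: continuous_measurable_fun.
have gint := gauss_integrable mdf dgc.
have [fint ->] := integral_gam gint.
pose f x := (dg x - x * g x) * gpdf x.
pose F x := g x * gpdf x.
have dF x : is_derive x (1 : R) F (f x).
  have := @is_deriveM _ _ _ _ x 1 _ _ (dgP x) (is_derive_gpdf x).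
  by move=> /is_derive_eq; apply; rewrite /f /GRing.scale/=; ring.
have cF : continuous F by move=> x; apply: cvgM; [exact: cg|exact: continuous_gpdf].
have Fn (n : nat) : (\int[mu]_(x in `[(- n.+1%:R)%R, n.+1%:R%R]) (f x)%:E = (F n.+1%:R - F (- n.+1%:R))%:E)%E.
  rewrite (continuous_FTC2 (F := F)) ?EFinB//.
  - by rewrite -subr_gt0 opprK addr_gt0// ltr0n.
  - exact: continuous_subspaceT.
  - split; first by move=> x _; case: (dF x).
    + by apply: cvg_at_right_filter; exact: cF.
    + by apply: cvg_at_left_filter; exact: cF.
  - by move=> x _; rewrite derive1E; apply: derive_val.
have [K K0 Kb] := gpdf_poly_bound.
have c0 : 0 <= c by have := dgc 0; rewrite mul0r subr0 expr0n/= addr0 expr1n mulr1; exact: le_trans.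
pose M := c * (K * normal_peak 2).
(* One factor [1 + x ^+ 2] of the polynomial bound is spent on [g]; the other remains as decay. *)
have Fb x : `|F x| <= M / (1 + x ^+ 2).
  have x1 : 0 < 1 + x ^+ 2 by rewrite ltr_pwDl// sqr_ge0.
  rewrite ler_pdivlMr// /F normrM (ger0_norm (ltW (gpdf_gt0 _))).
  have := gc x; have := Kb x; have := @normal_pdf_ub R 0 2 x (lt0r_neq0 (ltr0Sn _ _)); rewrite expr2.
  have := gpdf_gt0 x => p0 h1 h2 h3.
  apply: (@le_trans _ _ (c * (1 + x ^+ 2) * gpdf x * (1 + x ^+ 2))).
    by apply: ler_wpM2r; [exact: ltW|apply: ler_wpM2r => //; exact: ltW].
  rewrite /M (_ : _ * _ = c * ((1 + x ^+ 2) * (1 + x ^+ 2) * gpdf x)); last by ring.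
  apply: ler_wpM2l => //; apply: le_trans h2 _; exact: ler_wpM2l.
have lim0 : (fun n : nat => F n.+1%:R - F (- n.+1%:R)) @ \oo --> (0 : R).
  apply: norm_cvg0; apply: (@squeeze_cvgr _ _ _ _ (cst 0) (fun n : nat => (M *+ 2) * n.+1%:R^-1)).
  - near=> n; rewrite normr_ge0/=.
    have n1 : (1 : R) <= n.+1%:R by rewrite ler1n.
    have h : forall y : R, y ^+ 2 = n.+1%:R ^+ 2 -> `|F y| <= M * n.+1%:R^-1.
      move=> y yE; apply: le_trans (Fb y) _; rewrite yE.
      rewrite ler_wpM2l ?mulr_ge0 ?normal_peak_ge0// lef_pV2 ?posrE ?ltr_pwDl ?sqr_ge0 ?ltr0n//.
      by rewrite expr2; nra.
    rewrite (le_trans (ler_normB _ _))// mulr2n mulrDl lerD// h// sqrrN//.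
  - exact: cvg_cst.
  - rewrite -[X in _ --> X](mulr0 (M *+ 2)); apply: cvgMr.
    exact: cvg_harmonic.
pose f_ (n : nat) := (EFin \o f) \_ `[- n.+1%:R, n.+1%:R].
have [] := @dominated_convergence _ _ R mu setT measurableT f_ (EFin \o f) (abse \o (EFin \o f)).
- move=> n; apply/(measurable_restrictT _ _).1 => //.
  by apply: measurable_funTS; exact: (measurable_int _ fint).
- exact: (measurable_int _ fint).
- apply: aeW => x _; apply: cvg_near_cst; near=> n.
  rewrite /f_ patchE ifT// inE/= in_itv/= -ler_norml.
  by near: n; exists (Num.truncn `|x|) => // n /= xn; rewrite (le_trans (ltW (truncnS_gt _)))// ler_nat ltnS.
- exact: integrable_abse.
- apply: aeW => x n _; rewrite /f_ patchE; case: ifPn => // _; by rewrite /= normr0 lee_fin.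
move=> _ _; rewrite -/f.
have -> : [sequence (\int[mu]_x f_ n x)%E]_n = (fun n : nat => (F n.+1%:R - F (- n.+1%:R))%:E).
  by apply/funext => n; rewrite /= -Fn [RHS]integral_mkcond.
move=> fcv; have fE : (\int[mu]_x (EFin \o f) x = 0%:E)%E.
  by apply: (cvg_unique _ fcv) => //; apply: cvg_EFin => //; exact: nearW.
by rewrite /Rintegral [X in fine X]fE.
Unshelve. all: by end_near. Qed.

Lemma gauss_mean : \int[gam]_x x = 0.
Proof.
have := @gauss_stein (cst 1) (cst 0) 1.
have E : \int[gam]_x (cst 0 x - x * cst 1 x) = - \int[gam]_x x.
  rewrite -mulN1r -RintegralZl//; first by apply: eq_Rintegral => x _; rewrite /= mulr1 sub0r mulN1r.
  apply: (@gauss_integrable _ 1) => // x; rewrite mul1r ler_norml; apply/andP; split; nra.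
rewrite E => h; apply/eqP; rewrite -oppr_eq0; apply/eqP; apply: h.
- by move=> x; exact: cvg_cst.
- by move=> x; rewrite /= normr1 mul1r lerDl sqr_ge0.
- by move=> x; rewrite /= mulr1 sub0r normrN mul1r ler_norml; apply/andP; split; nra.
Qed.

Lemma gauss_var : \int[gam]_x (x ^+ 2) = 1.
Proof.
have := @gauss_stein id (cst 1) 1.
have i2 : gam.-integrable setT (EFin \o (fun x : R => x ^+ 2)).
  apply: (@gauss_integrable _ 1) => //.
  by move=> x; rewrite mul1r ger0_norm ?sqr_ge0//; nra.
have E : \int[gam]_x (cst 1 x - x * id x) = 1 - \int[gam]_x (x ^+ 2).
  rewrite RintegralB//.
    by congr (_ - _); exact: Rintegral_prob_cst.
  exact: finite_measure_integrable_cst.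
rewrite E => h; apply/esym/eqP; rewrite -subr_eq0; apply/eqP; apply: h.
- by move=> x; exact: cvg_cst.
- by move=> x; rewrite mul1r ler_norml; apply/andP; split; nra.
- move=> x; rewrite /= mul1r ler_norml; apply/andP; split; have := sqr_ge0 x; nra.
Qed.

Lemma integral_odd (f : R -> R) : mu.-integrable setT (EFin \o f) ->
  (forall x, f (- x) = - f x) -> \int[mu]_x f x = 0.
Proof.
move=> fi fN; rewrite /Rintegral integralE.
pose ef : R -> \bar R := EFin \o f.
have mf : measurable_fun setT ef := measurable_int _ fi.
have -> : (\int[mu]_x (ef^\+)%E x = \int[mu]_x (ef^\-)%E x)%E.
  have -> : (ef^\-)%E = (fun x : R => (ef^\+)%E ((-1) * x + 0)%R).
    apply/funext => x; rewrite funenegE funeposE/= addr0 mulN1r.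
    by rewrite /ef/= fN EFinN.
  rewrite (@ge0_integral_affine _ (-1) 0 (ef^\+)%E) ?oppr_eq0 ?oner_eq0//.
    by rewrite normrN1 invr1 mul1e.
  exact: measurable_funepos.
rewrite subee//.
apply: integrable_fin_num => //; exact: integrable_funeneg.
Qed.

Lemma gauss_sin t : \int[gam]_x sin (t * x) = 0.
Proof.
have is_ : gam.-integrable setT (EFin \o (fun x : R => sin (t * x))).
  apply: (@gauss_integrable _ 1); first by apply: measurable_sinT; exact: measurable_funM.
  move=> x; rewrite mul1r; apply: (@le_trans _ _ 1); first by rewrite ler_norml sin_geN1 sin_le1.
  by have := sqr_ge0 x; nra.
have [i2 ->] := integral_gam is_.
by apply: integral_odd => // x; rewrite gpdfN mulrN sinN mulNr.
Qed.

(** Differentiation under the integral gives C'(t) = - int x sin(t x), and Stein's identity for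
    sin(t x) turns the right side into - t C(t). Hence C(t) exp(t^2/2) has derivative 0. *)
Lemma gauss_cos t : \int[gam]_x cos (t * x) = expR (- (t ^+ 2 / 2)).
Proof.
pose C t := \int[gam]_x cos (t * x).
have mc s : measurable_fun setT (fun x : R => cos (s * x)).
  by apply: measurable_cosT; exact: measurable_funM.
have ms s : measurable_fun setT (fun x : R => sin (s * x)).
  by apply: measurable_sinT; exact: measurable_funM.
have ic s : gam.-integrable setT (EFin \o (fun x : R => cos (s * x))).
  apply: (@gauss_integrable _ 1) => // x; rewrite mul1r; apply: (@le_trans _ _ 1); first by rewrite ler_norml cos_geN1 cos_le1.
  by have := sqr_ge0 x; nra.
have dcos (s x : R) : is_derive s (1 : R) (fun s => cos (s * x)) (- (x * sin (s * x))).
  have h : is_derive s (1 : R) (fun s : R => s * x) x.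
    by apply: is_derive_eq; rewrite /GRing.scale/= mulr1 mulr0 ?add0r ?addr0.
  have := @is_derive1_comp R cos (fun s => s * x) s _ _ (is_derive_cos _) h.
  by move=> /is_derive_eq; apply; ring.
have p1 (s x : R) : partial1of2 (fun s x : R => cos (s * x)) s x = - (x * sin (s * x)).
  by rewrite partial1of2E; apply: derive_val.
have xb (x : R) : `|x| <= 1 * (1 + x ^+ 2) ^+ 2 by rewrite ler_norml; apply/andP; split; nra.
have ssb (s x : R) : `|x * sin (s * x)| <= `|x|.
  by rewrite normrM ler_piMr// ler_norml sin_geN1 sin_le1.
have dC s : is_derive s (1 : R) C (- \int[gam]_x (x * sin (s * x))).
  have hs : `]s - 1, s + 1[%classic s by rewrite /= in_itv/=; apply/andP; split; lra.
  have h1 : forall (x y : R), `]s - 1, s + 1[%classic x -> setT y -> derivable (fun s : R => cos (s * y)) x 1.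
    by move=> x y _ _; case: (dcos x y).
  have iG : gam.-integrable setT (EFin \o (fun x : R => `|x|)).
    by apply: (@gauss_integrable _ 1) => // x; rewrite normr_id.
  have h2 : forall (x y : R), `]s - 1, s + 1[%classic x -> setT y -> `|partial1of2 (fun s x : R => cos (s * x)) x y| <= `|y|.
    by move=> x y _ _; rewrite p1 normrN.
  have D := derivable_under_integral measurableT hs (fun x _ => ic x) h1 (fun y => normr_ge0 y) iG h2.
  have V := differentiation_under_integral measurableT hs (fun x _ => ic x) h1 (fun y => normr_ge0 y) iG h2.
  apply: DeriveDef => //; rewrite -derive1E [LHS]V.
  rewrite -mulN1r -RintegralZl//; last first.
    apply: (@gauss_integrable _ 1); first exact: measurable_funM.
    by move=> x; apply: le_trans (ssb _ _) (xb _).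
  by apply: eq_Rintegral => x _; rewrite p1 mulN1r.
have St s : \int[gam]_x (x * sin (s * x)) = s * C s.
  have dsin (x : R) : is_derive x (1 : R) (fun x => sin (s * x)) (s * cos (s * x)).
    have h : is_derive x (1 : R) (fun x : R => s * x) s.
      by apply: is_derive_eq; rewrite /GRing.scale/= mulr1 ?add0r ?addr0.
    have := @is_derive1_comp R sin (fun x => s * x) x _ _ (is_derive_sin _) h.
    by move=> /is_derive_eq; apply; ring.
  have cb (x : R) : `|s * cos (s * x)| <= `|s| by rewrite normrM ler_piMr// ler_norml cos_geN1 cos_le1.
  have := @gauss_stein (fun x => sin (s * x)) (fun x => s * cos (s * x)) (1 + `|s|) dsin.
  have E : \int[gam]_x (s * cos (s * x) - x * sin (s * x)) = s * C s - \int[gam]_x (x * sin (s * x)).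
    rewrite RintegralB//.
    - by rewrite RintegralZl.
    - apply: (@gauss_integrable _ `|s|); first exact: measurable_funM.
      move=> x; apply: le_trans (cb _) _; rewrite ler_peMr//; have := sqr_ge0 x; nra.
    - apply: (@gauss_integrable _ 1); first exact: measurable_funM.
      by move=> x; apply: le_trans (ssb _ _) (xb _).
  rewrite E => h; apply/esym/eqP; rewrite -subr_eq0; apply/eqP; apply: h.
  - move=> x; apply: cvgM; first exact: cvg_cst.
    by apply: continuous_comp; [apply: cvgM; [exact: cvg_cst|exact: cvg_id]|exact: continuous_cos].
  - move=> x; apply: (@le_trans _ _ 1); first by rewrite ler_norml sin_geN1 sin_le1.
    have := sqr_ge0 x; have := normr_ge0 s; nra.
  - move=> x; apply: le_trans (ler_normB _ _) _; apply: (@le_trans _ _ (`|s| + `|x|)); first exact: lerD.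
    have := xb x; rewrite mul1r => hx; have : 1 <= (1 + x ^+ 2) ^+ 2 by have := sqr_ge0 x; nra.
    move: hx (normr_ge0 s); move: (_ ^+ 2) `|x| `|s| => u v w; nra.
pose E t := C t * expR (t ^+ 2 / 2).
have dE s : is_derive s (1 : R) E 0.
  have h : is_derive s (1 : R) (fun y : R => y ^+ 2 / 2) s.
    by apply: is_derive_eq; rewrite /GRing.scale/=; field.
  have h2 := @is_derive1_comp R expR (fun y : R => y ^+ 2 / 2) s _ _ (is_derive_expR _) h.
  have := @is_deriveM _ _ _ _ s 1 _ _ (dC s) h2.
  by move=> /is_derive_eq; apply; rewrite St /GRing.scale/=; ring.
have := is_derive_0_is_cst t 0 dE; rewrite /E expr0n/= mul0r expR0 mulr1.
have -> : C 0 = 1.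
  rewrite /C; under eq_Rintegral do rewrite mul0r cos0.
  exact: Rintegral_prob_cst.
by move=> h; apply: (@mulIf _ (expR (t ^+ 2 / 2))); rewrite ?gt_eqF ?expR_gt0// -expRD addNr expR0.
Qed.

End gauss.

Section gcdf.
Context {R : realType}.
Local Notation mu := (@lebesgue_measure R).
Local Notation gam := (@normal_prob R 0 1).

Definition gcdf (q : R) : R := fine (gam `]-oo, q]%classic).

Lemma gamE q : gam `]-oo, q]%classic = (gcdf q)%:E.
Proof. by rewrite /gcdf fineK// fin_num_measure. Qed.

Lemma gcdf_ge0 q : 0 <= gcdf q.
Proof. by rewrite -lee_fin -gamE measure_ge0. Qed.

Lemma gcdf_le1 q : gcdf q <= 1.
Proof. by rewrite -lee_fin -gamE probability_le1. Qed.

Lemma integrable_gpdf : mu.-integrable setT (EFin \o @gpdf R).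
Proof. by rewrite -gpdfE; exact: integrable_normal_pdf. Qed.

Lemma gcdfE q : gcdf q = \int[mu]_(x in `]-oo, q]) gpdf x.
Proof. by rewrite /gcdf /normal_prob gpdfE. Qed.

Lemma is_derive_gcdf q : is_derive q (1 : R) gcdf (gpdf q).
Proof.
have qq1 : q < q + 1 by lra.
have i1 : mu.-integrable `]-oo, q + 1] (EFin \o @gpdf R).
  by apply: integrableS integrable_gpdf.
have [||] := @continuous_FTC1 R (@gpdf R) -oo%O q (q + 1) qq1 i1.
- by rewrite /= ltNyr.
- exact: continuous_gpdf.
have -> : (fun x0 : R => \int[mu]_(t in `]-oo, x0]) gpdf t) = gcdf.
  by apply/funext => x; rewrite gcdfE.
by move=> d1 d2; apply: (DeriveDef d1); rewrite -derive1E; exact: d2.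
Qed.

Lemma continuous_gcdf : continuous gcdf.
Proof.
move=> x; apply: differentiable_continuous; apply/derivable1_diffP.
by case: (is_derive_gcdf x).
Qed.

(** The mean value theorem gives a slope [gpdf c] with c between a and b, and [gpdf] is 1-Lipschitz:
    |c| <= 1 + c^2/2 <= exp(c^2/2) bounds its derivative by 1. *)
Lemma gcdf_taylor a b : `|gcdf b - gcdf a - gpdf a * (b - a)| <= (b - a) ^+ 2.
Proof.
have lip (x y : R) : `|gpdf y - gpdf x| <= `|y - x|.
  wlog xy : x y / x <= y.
    by move=> H; have [/H//|/ltW/H] := leP x y; rewrite distrC (distrC x).
  have [c _ ->] := MVT_segment xy (fun z _ => is_derive_gpdf z) (continuous_subspaceT (@continuous_gpdf R)).
  rewrite normrM ler_piMl// normrM normrN (ger0_norm (ltW (gpdf_gt0 _))).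
  have e := expR_ge1Dx (c ^+ 2 / 2).
  have h1 : `|c| <= expR (c ^+ 2 / 2).
    apply: le_trans e; rewrite ler_norml; apply/andP; split; nra.
  have h2 := expR_gt0 (c ^+ 2 / 2).
  rewrite /gpdf expRN mulrCA mulr_ile1 ?invr_ge0 ?sqrtr_ge0 ?peak_le1//.
  by rewrite ler_pdivrMr// mul1r.
have key x y : x <= y -> exists2 c, x <= c <= y & gcdf y - gcdf x = gpdf c * (y - x).
  move=> xy; have [c cxy ->] := MVT_segment xy (fun z _ => is_derive_gcdf z) (continuous_subspaceT continuous_gcdf).
  by exists c => //; move: cxy; rewrite in_itv.
have [ab|/ltW ba] := leP a b.
  have [c /andP[ac cb] ->] := key _ _ ab.
  rewrite -mulrBl normrM (ger0_norm (_ : 0 <= b - a)) ?subr_ge0// expr2.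
  by rewrite ler_wpM2r ?subr_ge0//; apply: le_trans (lip _ _) _; rewrite ger0_norm; lra.
have [c /andP[ac cb] E] := key _ _ ba.
rewrite (_ : gcdf b - gcdf a - _ = (gpdf c - gpdf a) * (b - a)); last first.
  by rewrite -(opprB (gcdf a)) E; ring.
rewrite normrM (ler0_norm (_ : b - a <= 0)) ?subr_le0// -[leRHS]sqrrN expr2.
by rewrite ler_wpM2r ?oppr_ge0 ?subr_le0//; apply: le_trans (lip _ _) _; rewrite ler0_norm; lra.
Qed.

(** Symmetry of [gpdf], together with the fact that a point has no mass. *)
Lemma gcdf0 : gcdf 0 = 2^-1.
Proof.
have mp : measurable_fun setT (fun x : R => (gpdf x)%:E).
  by apply/measurable_EFinP; exact: measurable_gpdf.
have E : gam `]-oo, (0 : R)]%classic = gam `[(0 : R), +oo[%classic.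
  rewrite /normal_prob gpdfE integral_mkcond [RHS]integral_mkcond.
  transitivity (\int[mu]_x ((EFin \o @gpdf R) \_ `[(0 : R)%R, +oo[) ((-1) * x + 0)%R)%E.
    apply: eq_integral => x _; rewrite !patchE/= mulN1r addr0 gpdfN; congr (if _ then _ else _).
    by apply/idP/idP; rewrite !inE/= !in_itv/= andbT oppr_ge0.
  rewrite ge0_integral_affine ?oppr_eq0 ?oner_eq0//.
  - by rewrite normrN1 invr1 mul1e.
  - by apply/(measurable_restrictT _ _).1 => //; exact: measurable_funTS.
  - by move=> x; rewrite patchE; case: ifP => // _; rewrite /= lee_fin ltW// gpdf_gt0.
have E2 : gam `[(0 : R), +oo[%classic = gam `](0 : R), +oo[%classic.
  rewrite /normal_prob -integral_itv_obnd_cbnd// gpdfE.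
  exact: measurable_funTS.
have : (gam `]-oo, (0 : R)%R]%classic + gam `](0 : R)%R, +oo[%classic = 1)%E.
  rewrite -measureU//; last first.
    by apply/seteqP; split => x //=; rewrite !in_itv/= andbT => -[]; lra.
  rewrite (_ : _ `|` _ = setT); first exact: probability_setT.
  by apply/seteqP; split => x //= _; rewrite !in_itv/= andbT; case: leP; [left|right].
by rewrite -E2 -E gamE -EFinD => -[]; lra.
Qed.

(** The identity as a random variable on the line under the normal law; its cdf is [gcdf], so the
    limits of cdfs at infinity transfer. *)
Let gid : measurableTypeR R -> R := idfun.

#[local] HB.instance Definition _ :=
  @isMeasurableFun.Build _ _ _ _ gid (@measurable_id _ _ setT).

Lemma cvg_gcdf_y (u : nat -> R) : u @ \oo --> +oo -> gcdf (u n) @[n --> \oo] --> (1 : R).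
Proof.
move=> uy; apply: (cvg_comp u gcdf uy).
have := @cvg_cdfy1 _ _ _ gam (gid : {RV gam >-> R}).
by move=> /fine_cvg.
Qed.

Lemma cvg_gcdf_Ny (u : nat -> R) : u @ \oo --> -oo -> gcdf (u n) @[n --> \oo] --> (0 : R).
Proof.
move=> uy; apply: (cvg_comp u gcdf uy).
have := @cvg_cdfNy0 _ _ _ gam (gid : {RV gam >-> R}).
by move=> /fine_cvg.
Qed.

End gcdf.

(** * Bounded functions on a probability space: integrability, limits, exchange of integrals *)

Section bounded.
Context d (T : measurableType d) (R : realType) (P : probability T R).

Lemma integrable_bounded (f : T -> R) (M : R) : measurable_fun setT f ->
  (forall x, `|f x| <= M) -> P.-integrable setT (EFin \o f).
Proof.
move=> mf fM; apply: measurable_bounded_integrable => //.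
  by apply: le_lt_trans (ltry 1); apply: probability_le1.
exists M; split; first exact: num_real.
by move=> x Mx y _ /=; apply: le_trans (fM y) (ltW Mx).
Qed.

Lemma bounded_cvg (f_ : nat -> T -> R) (f : T -> R) (M : R) :
  (forall n, measurable_fun setT (f_ n)) -> measurable_fun setT f ->
  (forall n x, `|f_ n x| <= M) -> (forall x, f_ n x @[n --> \oo] --> f x) ->
  \int[P]_x f_ n x @[n --> \oo] --> \int[P]_x f x.
Proof.
move=> mf_ mf fM ff.
have fMl x : `|f x| <= M.
  by apply: (ler_cvg_to (cvg_norm (ff x)) (cvg_cst M)); apply: nearW => n; exact: fM.
have [] := @dominated_convergence _ _ R P setT measurableT
  (fun n => EFin \o f_ n) (EFin \o f) (EFin \o cst M).
- by move=> n; exact/measurable_EFinP.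
- exact/measurable_EFinP.
- by apply: aeW => x _; apply: cvg_EFin; [exact: nearW|exact: ff].
- by apply: (@integrable_bounded _ `|M|) => // x; rewrite /cst.
- by apply: aeW => x n _; rewrite /= lee_fin.
move=> _ _ h; apply: fine_cvg; rewrite fineK; first exact: h.
by apply: integrable_fin_num => //; exact: (@integrable_bounded _ M).
Qed.

Lemma le_Rintegral_norm (f : T -> R) (M : R) : measurable_fun setT f ->
  (forall x, `|f x| <= M) -> `|\int[P]_x f x| <= M.
Proof.
move=> mf fM; have i := integrable_bounded mf fM.
apply: le_trans (le_normr_Rintegral _ i) _ => //.
rewrite -[leRHS](Rintegral_prob_cst P); apply: le_Rintegral => //.
- exact: integrable_norm i.
- by apply: (@integrable_bounded _ `|M|).
Qed.

End bounded.

Lemma bounded_fubini d1 (T1 : measurableType d1) d2 (T2 : measurableType d2)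
    (R : realType) (P1 : probability T1 R) (P2 : probability T2 R)
    (F : T1 -> T2 -> R) (M : R) :
  measurable_fun setT (fun z => F z.1 z.2) -> (forall x y, `|F x y| <= M) ->
  \int[P1]_x \int[P2]_y F x y = \int[P2]_y \int[P1]_x F x y.
Proof.
move=> mF FM.
have i : (P1 \x P2)%E.-integrable setT (EFin \o (fun z => F z.1 z.2)).
  apply/integrable12ltyP; first exact/measurable_EFinP.
  apply: (@le_lt_trans _ _ (\int[P1]_x \int[P2]_y `|M|%:E)%E).
    apply: ge0_le_integral => //.
    - by move=> x _; exact: integral_ge0.
    - apply: (@measurable_fun_fubini_tonelli_F _ _ _ _ _ P2 (fun z => (`|F z.1 z.2|)%:E)) => //.
      by apply/measurable_EFinP; exact: measurableT_comp.
    - move=> x _; apply: ge0_le_integral => //.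
      + have := measurableT_comp mF (measurable_pair1 x).
        by move=> h; apply/measurable_EFinP; exact: measurableT_comp.
      + by move=> y _; rewrite /= lee_fin (le_trans (FM _ _))// ler_norm.
  under eq_integral do rewrite integral_cst//.
  rewrite integral_cst//.
  by rewrite [X in (_ * X * _)%E](_ : _ = 1)%E ?[X in (_ * X)%E](_ : _ = 1)%E ?mule1 ?ltry//; exact: probability_setT.
have := Fubini i => /= FE.
have m1 x : measurable_fun setT (F x) := measurableT_comp mF (measurable_pair1 x).
have m2 y : measurable_fun setT (F ^~ y) := measurableT_comp mF (measurable_pair2 y).
rewrite /Rintegral.
have -> : (\int[P1]_x (fine (\int[P2]_y (F x y)%:E))%:E = \int[P1]_x \int[P2]_y (F x y)%:E)%E.
  apply: eq_integral => x _; rewrite fineK//; apply: integrable_fin_num => //.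
  exact: (@integrable_bounded _ _ _ P2 (F x) M).
have -> : (\int[P2]_y (fine (\int[P1]_x (F x y)%:E))%:E = \int[P2]_y \int[P1]_x (F x y)%:E)%E.
  apply: eq_integral => y _; rewrite fineK//; apply: integrable_fin_num => //.
  exact: (@integrable_bounded _ _ _ P1 (F ^~ y) M).
by rewrite FE.
Qed.

(** * Uniqueness for Fourier transforms *)

Section fourier.
Context {R : realType}.
Local Notation gam := (@normal_prob R 0 1).
Local Notation peak := ((Num.sqrt (pi *+ 2))^-1 : R).

Section one.
Context d (T : measurableType d) (P : probability T R) (h W : T -> R) (M : R).
Hypotheses (mh : measurable_fun setT h) (mW : measurable_fun setT W)
  (hM : forall x, `|h x| <= M).

(** By [gauss_cos], [gpdf] is its own cosine transform up to normalization. Expanding the cosine of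
    t k (y - W) and exchanging integrals shows that the Gaussian smoothing of the law of [W],
    weighted by [h], depends only on the cosine and sine transforms. *)
Lemma gauss_kernel (k y : R) : \int[P]_w (h w * gpdf (k * (y - W w))) =
  peak * \int[gam]_t (cos (t * k * y) * \int[P]_w (h w * cos (t * k * W w))
    + sin (t * k * y) * \int[P]_w (h w * sin (t * k * W w))).
Proof.
have M0 (x : T) : 0 <= M := le_trans (normr_ge0 _) (hM x).
have ile (x : T) (c : R) : `|c| <= 1 -> `|h x * c| <= M.
  by move=> c1; rewrite normrM -[leRHS]mulr1 ler_pM.
have n1c (x : R) : `|cos x| <= 1 by rewrite ler_norml cos_geN1 cos_le1.
have n1s (x : R) : `|sin x| <= 1 by rewrite ler_norml sin_geN1 sin_le1.
have mc (s : R) : measurable_fun setT (fun w => h w * cos (s * W w)).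
  by apply: measurable_funM => //; apply: measurable_cosT; exact: measurable_funM.
have ms (s : R) : measurable_fun setT (fun w => h w * sin (s * W w)).
  by apply: measurable_funM => //; apply: measurable_sinT; exact: measurable_funM.
have mF : measurable_fun setT (fun z : T * R => h z.1 * cos (z.2 * (k * (y - W z.1)))).
  apply: measurable_funM; first exact: measurableT_comp.
  apply: measurable_cosT; apply: measurable_funM => //; apply: measurable_funM => //.
  by apply: measurable_funB => //; exact: measurableT_comp.
transitivity (peak * \int[gam]_t \int[P]_w (h w * cos (t * (k * (y - W w))))); last first.
  congr (_ * _); apply: eq_Rintegral => t _.
  rewrite -!RintegralZl//; last 2 first.
  - by apply: (integrable_bounded _ (M := M)) => // x; exact: ile.
  - by apply: (integrable_bounded _ (M := M)) => // x; exact: ile.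
  rewrite -RintegralD//.
  - apply: eq_Rintegral => w _.
    by rewrite mulrA mulrBr cosB; ring.
  - apply: (integrable_bounded _ (M := M)); first exact: measurable_funM.
    by move=> x; rewrite mulrCA; apply: ile; rewrite normrM mulr_ile1.
  - apply: (integrable_bounded _ (M := M)); first exact: measurable_funM.
    by move=> x; rewrite mulrCA; apply: ile; rewrite normrM mulr_ile1.
rewrite -(@bounded_fubini _ _ _ _ _ P gam (fun w t => h w * cos (t * (k * (y - W w)))) M mF); last first.
  by move=> x t; exact: ile.
rewrite -RintegralZl//; last first.
  apply: (integrable_bounded _ (M := M)).
    have : measurable_fun setT (fun w => h w * expR (- ((k * (y - W w)) ^+ 2 / 2))).
      apply: measurable_funM => //; apply: measurableT_comp => //; apply: measurableT_comp => //.
      apply: measurable_funM => //; apply: measurable_funX; apply: measurable_funM => //.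
      exact: measurable_funB.
    apply: eq_measurable_fun => w _.
    rewrite RintegralZl//; last first.
      apply: (integrable_bounded _ (M := 1)); last by move=> x; exact: n1c.
      by apply: measurable_cosT; exact: measurable_funM.
    by under eq_Rintegral do rewrite mulrC; rewrite gauss_cos.
  move=> x; apply: (@le_Rintegral_norm _ _ _ gam) => [|t]; last exact: ile.
  by apply: measurable_funM => //; apply: measurable_cosT; exact: measurable_funM.
apply: eq_Rintegral => w _.
rewrite RintegralZl//; last first.
  apply: (integrable_bounded _ (M := 1)); last by move=> x; exact: n1c.
  by apply: measurable_cosT; exact: measurable_funM.
under eq_Rintegral do rewrite mulrC.
by rewrite gauss_cos /gpdf; ring.
Qed.

(** For k > 0, the [h]-weighted distribution function of [W] smoothed by a Gaussian of standard
    deviation 1/k. *)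
Let B (k q : R) := \int[P]_w (h w * gcdf (k * (q - W w))).

Lemma mgcdfW k q : measurable_fun setT (fun w => h w * gcdf (k * (q - W w))).
Proof.
apply: measurable_funM => //.
apply: (measurableT_comp (continuous_measurable_fun continuous_gcdf)).
by apply: measurable_funM => //; exact: measurable_funB.
Qed.

Lemma gcdfW_le k q w : `|h w * gcdf (k * (q - W w))| <= M.
Proof.
rewrite normrM -[leRHS]mulr1 ler_pM//.
by rewrite ger0_norm ?gcdf_ge0 ?gcdf_le1.
Qed.

Lemma is_derive_smooth_cdf (k q : R) : is_derive q (1 : R) (B k) (k * \int[P]_w (h w * gpdf (k * (q - W w)))).
Proof.
have dg (w : T) (x : R) : is_derive x (1 : R) (fun x => h w * gcdf (k * (x - W w))) (h w * (k * gpdf (k * (x - W w)))).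
  have h1 : is_derive x (1 : R) (fun x : R => k * (x - W w)) k.
    by apply: is_derive_eq; rewrite /GRing.scale/=; ring.
  have := @is_derive1_comp R gcdf (fun x => k * (x - W w)) x _ _ (is_derive_gcdf _) h1.
  move=> /(@is_deriveZ _ _ _ _ (h w))/is_derive_eq; apply.
  by rewrite /GRing.scale/=; ring.
have p1 (x : R) w : partial1of2 (fun x w => h w * gcdf (k * (x - W w))) x w = h w * (k * gpdf (k * (x - W w))).
  by rewrite partial1of2E; apply: derive_val.
have hs : `]q - 1, q + 1[%classic q by rewrite /= in_itv/=; apply/andP; split; lra.
have ic (x : R) : P.-integrable setT (EFin \o (fun w => h w * gcdf (k * (x - W w)))).
  by apply: (integrable_bounded _ (M := M)); [exact: mgcdfW|exact: gcdfW_le].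
have h1 : forall (x : R) (y : T), `]q - 1, q + 1[%classic x -> setT y -> derivable (fun x : R => h y * gcdf (k * (x - W y))) x 1.
  by move=> x y _ _; case: (dg y x).
have bd (x : R) w : `|h w * (k * gpdf (k * (x - W w)))| <= `|M| * `|k|.
  rewrite normrM [X in _ * X]normrM ler_pM ?mulr_ge0//; first by rewrite (le_trans (hM w))// ler_norm.
  by rewrite ler_piMr// (ger0_norm (ltW (gpdf_gt0 _))) gpdf_le1.
have iG : P.-integrable setT (EFin \o (fun _ : T => `|M| * `|k|)).
  by apply: (@integrable_bounded _ _ _ _ _ (`|M| * `|k|)) => // _; rewrite ger0_norm.
have h2 : forall (x : R) (y : T), `]q - 1, q + 1[%classic x -> setT y -> `|partial1of2 (fun x w => h w * gcdf (k * (x - W w))) x y| <= `|M| * `|k|.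
  by move=> x y _ _; rewrite p1.
have G0 (y : T) : 0 <= `|M| * `|k| by [].
have D := derivable_under_integral measurableT hs (fun x _ => ic x) h1 G0 iG h2.
have V := differentiation_under_integral measurableT hs (fun x _ => ic x) h1 G0 iG h2.
apply: DeriveDef => //; rewrite -derive1E [LHS]V -RintegralZl//; last first.
  apply: (@integrable_bounded _ _ _ _ _ `|M|).
    apply: measurable_funM => //; apply: (measurableT_comp measurable_gpdf).
    by apply: measurable_funM => //; exact: measurable_funB.
  move=> w; rewrite normrM -[leRHS]mulr1 ler_pM//.
    by rewrite (le_trans (hM w))// ler_norm.
  by rewrite ger0_norm ?gpdf_le1// ltW// gpdf_gt0.
by apply: eq_Rintegral => w _; rewrite p1 mulrCA.
Qed.

Lemma smooth_cdf_Ny (k : R) : 0 < k -> B k (- n%:R) @[n --> \oo] --> (0 : R).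
Proof.
move=> k0; rewrite -(Rintegral_prob_cst P 0).
apply: (bounded_cvg (M := M)) => //.
- by move=> n; exact: mgcdfW.
- by move=> n x; exact: gcdfW_le.
- move=> x; rewrite -[X in _ --> X](mulr0 (h x)); apply: cvgMr.
  apply: (cvg_gcdf_Ny (u := fun n => k * (- n%:R - W x))).
  apply/cvgrNyPle => A.
  have := nbhs_infty_ger (- A / k - W x); apply: filterS => n /=.
  by rewrite lerBlDr ler_pdivrMr//; lra.
Qed.

(** The smoothed function is evaluated slightly to the right of [q]: with precision (n+1)^2 and
    shift 1/(n+1) the argument of [gcdf] is (n+1)((n+1)(q - W) + 1), which tends to +oo also when W
    = q. This yields the indicator of W <= q without any continuity condition at [q]. *)
Lemma smooth_cdf_cvg q :
  B ((n.+1)%:R ^+ 2) (q + n.+1%:R^-1) @[n --> \oo] --> \int[P]_w (h w * (W w <= q)%R%:R).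
Proof.
apply: (bounded_cvg (M := M)).
- by move=> n; exact: mgcdfW.
- apply: measurable_funM => //.
  rewrite (_ : (fun _ => _) = (fun b : bool => b%:R : R) \o (fun w => W w <= q))//.
  apply: measurableT_comp => //; exact: measurable_fun_ler.
- by move=> n x; exact: gcdfW_le.
- move=> w; apply: cvgMr.
  have E n : n.+1%:R ^+ 2 * (q + n.+1%:R^-1 - W w) = n.+1%:R * (n.+1%:R * (q - W w) + 1) :> R.
    have : n.+1%:R != 0 :> R by [].
    by move: (n.+1%:R : R) => m m0; field.
  under eq_fun do rewrite E.
  have [Wq|qW] := leP (W w) q.
    apply: (cvg_gcdf_y (u := fun n => n.+1%:R * (n.+1%:R * (q - W w) + 1))).
    apply: (@ger_cvgy _ _ _ R (fun n => n%:R)); last exact: cvgr_idn.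
    apply: nearW => n; have h0 : 0 <= q - W w by rewrite subr_ge0.
    have : (0 : R) <= n%:R by []. rewrite -natr1 => n0; nra.
  apply: (cvg_gcdf_Ny (u := fun n => n.+1%:R * (n.+1%:R * (q - W w) + 1))).
  pose e := W w - q; have e0 : 0 < e by rewrite subr_gt0.
  apply/cvgrNyPle => A.
  have := nbhs_infty_ger (2 / e); have := nbhs_infty_ger (- A).
  apply: filterS2 => n /= nA; rewrite ler_pdivrMr// => h2; have : (0 : R) <= n%:R by [].
  rewrite -natr1 (_ : q - W w = - e); last by rewrite opprB.
  move=> n0; nra.
Qed.

End one.
Arguments smooth_cdf_cvg {d T} P {h W M}.
Arguments is_derive_smooth_cdf {d T} P {h W M}.
Arguments gauss_kernel {d T} P {h W M}.

(** Smoothed distribution functions with equal transforms have the same derivative and both vanish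
    at -oo, hence coincide; then the smoothing is removed. The weights make joint laws accessible: a
    function of one variable is carried as a weight while the law of another is identified. *)
Lemma fourier_cdf d1 (T1 : measurableType d1) (P1 : probability T1 R)
    d2 (T2 : measurableType d2) (P2 : probability T2 R)
    (h1 W1 : T1 -> R) (h2 W2 : T2 -> R) (M : R) :
  measurable_fun setT h1 -> measurable_fun setT W1 ->
  measurable_fun setT h2 -> measurable_fun setT W2 ->
  (forall x, `|h1 x| <= M) -> (forall x, `|h2 x| <= M) ->
  (forall s, \int[P1]_w (h1 w * cos (s * W1 w)) = \int[P2]_w (h2 w * cos (s * W2 w))) ->
  (forall s, \int[P1]_w (h1 w * sin (s * W1 w)) = \int[P2]_w (h2 w * sin (s * W2 w))) ->
  forall q : R, \int[P1]_w (h1 w * (W1 w <= q)%R%:R) = \int[P2]_w (h2 w * (W2 w <= q)%R%:R).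
Proof.
move=> mh1 mW1 mh2 mW2 hM1 hM2 Ec Es q.
pose B1 (k q : R) := \int[P1]_w (h1 w * gcdf (k * (q - W1 w))).
pose B2 (k q : R) := \int[P2]_w (h2 w * gcdf (k * (q - W2 w))).
have B12 k x : 0 < k -> B1 k x = B2 k x.
  move=> k0; apply/eqP; rewrite -subr_eq0; apply/eqP.
  have d0 (y : R) : is_derive y (1 : R) (B1 k \- B2 k) 0.
    have := is_deriveB (is_derive_smooth_cdf P1 mh1 mW1 hM1 k y)
      (is_derive_smooth_cdf P2 mh2 mW2 hM2 k y).
    move=> /is_derive_eq; apply; apply/eqP; rewrite subr_eq0; apply/eqP; congr (_ * _).
    rewrite (gauss_kernel P1 mh1 mW1 hM1) (gauss_kernel P2 mh2 mW2 hM2).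
    by congr (_ * _); apply: eq_Rintegral => t _; rewrite Ec Es.
  have lim0 : (B1 k \- B2 k) (- n%:R) @[n --> \oo] --> (0 : R).
    rewrite -[X in _ --> X](subr0 0).
    by apply: cvgB; apply: smooth_cdf_Ny; eassumption.
  apply: (cvg_unique _ _ lim0) => //=.
  rewrite (_ : (fun n : nat => _) = cst (B1 k x - B2 k x)); first exact: cvg_cst.
  by apply/funext => n; exact: (is_derive_0_is_cst (- n%:R) x d0).
have c1 := smooth_cdf_cvg P1 mh1 mW1 hM1 q.
have c2 := smooth_cdf_cvg P2 mh2 mW2 hM2 q.
apply: (cvg_unique _ c1) => //=.
rewrite (_ : (fun n : nat => _) = (fun n : nat => B2 (n.+1%:R ^+ 2) (q + n.+1%:R^-1)))//.
by apply/funext => n; rewrite -B12// exprn_gt0.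
Qed.

End fourier.

Section integrableR.
Context d (T : measurableType d) (R : realType) (mu : {measure set T -> \bar R}) (D : set T).
Hypothesis mD : measurable D.

Lemma integrable_addR (f g : T -> R) : mu.-integrable D (EFin \o f) ->
  mu.-integrable D (EFin \o g) -> mu.-integrable D (EFin \o (fun x => f x + g x)).
Proof.
move=> fi gi; rewrite (_ : EFin \o _ = (EFin \o f) \+ (EFin \o g))%E.
  exact: integrableD.
by apply/funext => x; rewrite /= EFinD.
Qed.

Lemma integrable_subR (f g : T -> R) : mu.-integrable D (EFin \o f) ->
  mu.-integrable D (EFin \o g) -> mu.-integrable D (EFin \o (fun x => f x - g x)).
Proof.
move=> fi gi; rewrite (_ : EFin \o _ = (EFin \o f) \- (EFin \o g))%E.
  exact: integrableB.
by apply/funext => x; rewrite /= EFinB.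
Qed.

Lemma integrable_scaleR (c : R) (f : T -> R) : mu.-integrable D (EFin \o f) ->
  mu.-integrable D (EFin \o (fun x => c * f x)).
Proof.
move=> fi; rewrite (_ : EFin \o _ = (fun x => c%:E * (EFin \o f) x)%E)//.
exact: integrableZl.
Qed.

Lemma integrable_sumR (I : Type) (r : seq I) (p : pred I) (f : I -> T -> R) :
  (forall i, p i -> mu.-integrable D (EFin \o f i)) ->
  mu.-integrable D (EFin \o (fun x => \sum_(i <- r | p i) f i x)).
Proof.
move=> fi; rewrite (_ : EFin \o _ = (fun x => \sum_(i <- r | p i) (EFin \o f i) x)%E).
  exact: integrable_sum.
by apply/funext => x; rewrite /= sumEFin.
Qed.

Lemma Rintegral_sum (I : Type) (r : seq I) (p : pred I) (f : I -> T -> R) :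
  (forall i, p i -> mu.-integrable D (EFin \o f i)) ->
  \int[mu]_(x in D) (\sum_(i <- r | p i) f i x) = \sum_(i <- r | p i) \int[mu]_(x in D) f i x.
Proof.
move=> fi; elim: r => [|i r IH].
  under eq_Rintegral do rewrite big_nil.
  by rewrite big_nil /Rintegral integral0.
rewrite big_cons -IH; case: ifPn => pi.
  under eq_Rintegral do rewrite big_cons pi.
  by rewrite RintegralD//; [exact: fi|exact: integrable_sumR].
by under eq_Rintegral do rewrite big_cons (negbTE pi).
Qed.

End integrableR.

(** * Gaussian laws and Gaussian pairs identified by their characteristic functions *)

Section gausslaw.
Context {R : realType}.
Local Notation mu := (@lebesgue_measure R).
Local Notation gam := (@normal_prob R 0 1).

Lemma normal_probE (m s : R) (A : set R) : s != 0 -> measurable A ->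
  normal_prob m s A = gam ((fun x => s * x + m) @^-1` A).
Proof.
move=> s0 mA.
have mpre : measurable ((fun x : R => s * x + m) @^-1` A).
  by rewrite -[X in measurable X]setTI; exact: measurable_affine.
have mn : measurable_fun setT (fun x : R => (normal_pdf m s x)%:E).
  by apply/measurable_EFinP; exact: measurable_normal_pdf.
rewrite /normal_prob integral_mkcond [RHS]integral_mkcond.
pose f : R -> \bar R := (fun x : R => (normal_pdf m s x)%:E) \_ A.
have f0 x : (0 <= f x)%E by rewrite /f patchE; case: ifP => // _; rewrite lee_fin normal_pdf_ge0.
have mf : measurable_fun setT f.
  by apply/(measurable_restrictT _ _).1 => //; exact: measurable_funTS.
have sn0 : `|s| != 0 by rewrite normr_eq0.
transitivity (`|s|%:E * \int[mu]_x f (s * x + m)%R)%E.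
  by rewrite ge0_integral_affine// muleA -EFinM divff// mul1e.
rewrite -ge0_integralZl//; last first.
  by apply: (measurableT_comp mf); exact: measurable_affine.
apply: eq_integral => x _; rewrite /f !patchE.
have -> : (s * x + m \in A) = (x \in (fun x : R => s * x + m) @^-1` A).
  by apply/idP/idP; rewrite !inE.
case: ifPn => _; last by rewrite mule0.
rewrite -EFinM gpdfE normal_pdfE// /normal_peak /normal_fun /gpdf; congr EFin.
have -> : Num.sqrt (s ^+ 2 * pi *+ 2) = `|s| * Num.sqrt (pi *+ 2) :> R.
  by rewrite -mulrnAr sqrtrM ?sqr_ge0// sqrtr_sqr.
rewrite addrK invfM -mulrA mulVKf//; congr (_ * expR _).
by rewrite -mulr_natr; field.
Qed.

(** Describing the law as the image of the standard one under x |-> sqrt(v) x + m covers the point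
    mass [v = 0] as well, since the map is then constant. *)
Lemma gaussian_rvP d (T : measurableType d) (P : probability T R) (X : {RV P >-> R}) (m v : R) :
  0 <= v -> gaussian_rv X m v <->
  (forall A : set R, measurable A -> P (X @^-1` A) = gam ((fun x => Num.sqrt v * x + m) @^-1` A)).
Proof.
move=> v0; rewrite /gaussian_rv /gaussian_law /distribution /pushforward.
case: eqP => [->|/eqP vn0].
  have E (A : set R) : \d_m A = gam ((fun x : R => Num.sqrt 0 * x + m) @^-1` A).
    have -> : (fun x : R => Num.sqrt 0 * x + m) = cst m by apply/funext => x; rewrite sqrtr0 mul0r add0r.
    rewrite preimage_cst diracE; case: ifPn => mA.
      exact/esym/probability_setT.
    by rewrite measure0.
  by split => H A mA; rewrite H// E.
have s0 : Num.sqrt v != 0 by rewrite gt_eqF// sqrtr_gt0 lt_neqAle eq_sym vn0.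
by split => H A mA; rewrite (H A mA); [|apply: esym]; exact: (normal_probE _ s0 mA).
Qed.

Lemma gaussian_integral d (T : measurableType d) (P : probability T R) (X : {RV P >-> R}) (m v : R) (f : R -> R) :
  0 <= v -> gaussian_rv X m v -> measurable_fun setT f ->
  gam.-integrable setT (EFin \o (fun x => f (Num.sqrt v * x + m))) ->
  P.-integrable setT (EFin \o (fun w => f (X w))) /\
  \int[P]_w f (X w) = \int[gam]_x f (Num.sqrt v * x + m).
Proof.
move=> v0 /(gaussian_rvP _ _ v0) XE mf fi.
have mef : measurable_fun setT (EFin \o f) by exact/measurable_EFinP.
pose aff (x : measurableTypeR R) : R := Num.sqrt v * x + m.
have maff : measurable_fun setT aff := measurable_affine _ _.
have E (g : R -> \bar R) : measurable_fun setT g -> (forall x, (0 <= g x)%E) ->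
    (\int[P]_w g (X w) = \int[gam]_x g (aff x))%E.
  move=> mg g0.
  have := @ge0_integral_pushforward _ _ _ _ R X (measurable_funPT X) P setT g measurableT mg (fun x _ => g0 x).
  have := @ge0_integral_pushforward _ _ _ _ R aff maff gam setT g measurableT mg (fun x _ => g0 x).
  rewrite !preimage_setT => <- <-.
  by apply: eq_measure_integral => A mA _; exact: XE.
have fi' : P.-integrable setT (EFin \o (fun w => f (X w))).
  apply/integrableP; split; first by apply: (measurableT_comp mef); exact: measurable_funPT.
  have /integrableP[_] := fi; rewrite -(E (fun y => `|(f y)%:E|)%E)//.
  exact: measurableT_comp.
split=> //; rewrite /Rintegral; congr fine.
rewrite [LHS]integralE [RHS]integralE; congr (_ - _)%E.
  transitivity (\int[P]_w ((EFin \o f)^\+)%E (X w))%E.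
    by apply: eq_integral => w _; rewrite !funeposE.
  rewrite E; last 2 first.
  - exact: measurable_funepos.
  - by move=> x; exact: funepos_ge0.
  by apply: eq_integral => w _; rewrite !funeposE.
transitivity (\int[P]_w ((EFin \o f)^\-)%E (X w))%E.
  by apply: eq_integral => w _; rewrite !funenegE.
rewrite E; last 2 first.
- exact: measurable_funeneg.
- by move=> x; exact: funeneg_ge0.
by apply: eq_integral => w _; rewrite !funenegE.
Qed.

Lemma gauss_char_law d (T : measurableType d) (P : probability T R) (X : {RV P >-> R}) (v : R) :
  0 <= v ->
  (forall s, \int[P]_w cos (s * X w) = expR (- (s ^+ 2 * v / 2))) ->
  (forall s, \int[P]_w sin (s * X w) = 0) ->
  gaussian_rv X 0 v.
Proof.
move=> v0 Ec Es; apply/gaussian_rvP => // A mA.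
have sv : (Num.sqrt v) ^+ 2 = v by rewrite sqr_sqrtr.
pose aff (x : measurableTypeR R) : R := Num.sqrt v * x + 0.
have maff : measurable_fun setT aff := measurable_affine _ _.
pose m1 : {measure set R -> \bar R} := distribution P X.
pose m2_ : {measure set R -> \bar R} := pushforward gam aff.
pose m2 := m2_ maff.
apply: (@halfline_measure_unique R m1 m2) => //.
- by rewrite /m1 /= /distribution /pushforward preimage_setT probability_setT ltry.
- rewrite /m1 /m2/= /distribution /pushforward !preimage_setT probability_setT.
  exact/esym/probability_setT.
move=> q.
have := @fourier_cdf R _ _ P _ _ gam (cst 1) X (cst 1) aff 1.
move=> /(_ _ _ _ _ _ _ _ _ q) H.
have : \int[P]_w (cst 1 w * (X w <= q)%R%:R) = \int[gam]_w (cst 1 w * (aff w <= q)%R%:R).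
  apply: H => //.
  - by move=> x; rewrite normr1.
  - by move=> x; rewrite normr1.
  - move=> s; under eq_Rintegral do rewrite mul1r; rewrite Ec.
    under [RHS]eq_Rintegral do rewrite mul1r /aff addr0 mulrA; rewrite gauss_cos exprMn sv.
    by [].
  - move=> s; under eq_Rintegral do rewrite mul1r; rewrite Es.
    by under [RHS]eq_Rintegral do rewrite mul1r /aff addr0 mulrA; rewrite gauss_sin.
have I d0 (T0 : measurableType d0) (P0 : probability T0 R) (Y : T0 -> R) : measurable_fun setT Y ->
    (\int[P0]_w (cst 1 w * (Y w <= q)%R%:R))%:E = P0 (Y @^-1` `]-oo, q]).
  move=> mY; have mA0 : measurable (Y @^-1` `]-oo, q]) by rewrite -[X in measurable X]setTI; exact: mY.
  rewrite -(setIT (Y @^-1` _)) -integral_indic// /Rintegral fineK.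
    apply: eq_integral => x _ /=; rewrite mul1r indicE; congr (_%:R%:E); congr nat_of_bool.
    by apply/idP/idP; rewrite inE/= in_itv.
  rewrite (_ : (fun _ => _) = EFin \o \1_(Y @^-1` `]-oo, q])); last first.
    apply/funext => x/=; rewrite mul1r indicE; congr (_%:R%:E); congr nat_of_bool.
    by apply/idP/idP; rewrite inE/= in_itv.
  by apply: integrable_fin_num => //; apply: integrable_indic.
move=> H2; have := congr1 EFin H2; rewrite (I _ _ P X)//= => H3.
by rewrite /m1/= [LHS]H3 (I _ _ gam aff).
Qed.

End gausslaw.

Section joint.
Context {R : realType}.
Local Notation gam := (@normal_prob R 0 1).
Local Notation gg := (gam \x gam)%E.

Lemma RintegralM_indic d (T : measurableType d) (P : probability T R) (A B : set T) :
  measurable A -> measurable B ->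
  P (A `&` B) = (\int[P]_w (\1_A w * \1_B w))%:E.
Proof.
move=> mA mB; have mAB : measurable (A `&` B) by exact: measurableI.
rewrite -(setIT (A `&` B)) -integral_indic// /Rintegral fineK.
  by apply: eq_integral => x _; rewrite indicI.
rewrite (_ : (fun _ => _) = EFin \o \1_(A `&` B)); last first.
  by apply/funext => x; rewrite indicI.
by apply: integrable_fin_num => //; apply: integrable_indic.
Qed.

(** One variable is identified at a time. With weights cos(a U) and sin(a U) the law of W is
    resolved into indicators of W <= q; these indicators then act as weights for the law of U.
    Half-lines are finally replaced by Borel sets, first for W, then for U. *)
Lemma joint_gauss_law d (T : measurableType d) (P : probability T R) (U W : {RV P >-> R}) :
  (forall a b, \int[P]_w cos (a * U w + b * W w) = expR (- ((a ^+ 2 + b ^+ 2) / 2))) ->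
  (forall a b, \int[P]_w sin (a * U w + b * W w) = 0) ->
  forall A B : set R, measurable A -> measurable B ->
    P (U @^-1` A `&` W @^-1` B) = (gam A * gam B)%E.
Proof.
move=> Ec Es.
have mU : measurable_fun setT U by exact: measurable_funPT.
have mW : measurable_fun setT W by exact: measurable_funPT.
have n1c (x : R) : `|cos x| <= 1 by rewrite ler_norml cos_geN1 cos_le1.
have n1s (x : R) : `|sin x| <= 1 by rewrite ler_norml sin_geN1 sin_le1.
have mc a b : measurable_fun setT (fun w => cos (a * U w + b * W w)).
  by apply: measurable_cosT; apply: measurable_funD; exact: measurable_funM.
have ms a b : measurable_fun setT (fun w => sin (a * U w + b * W w)).
  by apply: measurable_sinT; apply: measurable_funD; exact: measurable_funM.
have ic a b : P.-integrable setT (EFin \o (fun w => cos (a * U w + b * W w))).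
  by apply: (integrable_bounded _ (M := 1)).
have is_ a b : P.-integrable setT (EFin \o (fun w => sin (a * U w + b * W w))).
  by apply: (integrable_bounded _ (M := 1)).
(* Product-to-sum formulas separate the transforms in U and in W. *)
have Ecc a b : \int[P]_w (cos (a * U w) * cos (b * W w)) = expR (- (a ^+ 2 / 2)) * expR (- (b ^+ 2 / 2)).
  transitivity (\int[P]_w (2^-1 * (cos (a * U w + b * W w) + cos (a * U w + (- b) * W w)))).
    by apply: eq_Rintegral => w _; rewrite mulNr cosB cosD; field.
  rewrite RintegralZl//; last exact: integrable_addR.
  by rewrite RintegralD// !Ec sqrrN -expRD -opprD -mulrDl; field.
have Ess a b : \int[P]_w (sin (a * U w) * sin (b * W w)) = 0.
  transitivity (\int[P]_w (2^-1 * (cos (a * U w + (- b) * W w) - cos (a * U w + b * W w)))).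
    by apply: eq_Rintegral => w _; rewrite mulNr cosB cosD; field.
  rewrite RintegralZl//; last exact: integrable_subR.
  by rewrite RintegralB// !Ec sqrrN subrr mulr0.
have Esc a b : \int[P]_w (sin (a * U w) * cos (b * W w)) = 0.
  transitivity (\int[P]_w (2^-1 * (sin (a * U w + (- b) * W w) + sin (a * U w + b * W w)))).
    by apply: eq_Rintegral => w _; rewrite mulNr sinB sinD; field.
  rewrite RintegralZl//; last exact: integrable_addR.
  by rewrite RintegralD// !Es addr0 mulr0.
have Ecs a b : \int[P]_w (cos (a * U w) * sin (b * W w)) = 0.
  transitivity (\int[P]_w (2^-1 * (sin (a * U w + b * W w) - sin (a * U w + (- b) * W w)))).
    by apply: eq_Rintegral => w _; rewrite mulNr sinB sinD; field.
  rewrite RintegralZl//; last exact: integrable_subR.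
  by rewrite RintegralB// !Es subr0 mulr0.
have mle (Y : T -> R) q : measurable_fun setT Y -> measurable_fun setT (fun w => (Y w <= q)%R%:R : R).
  move=> mY; rewrite (_ : (fun _ => _) = (fun b : bool => b%:R : R) \o (fun w => Y w <= q))//.
  apply: measurableT_comp => //; exact: measurable_fun_ler.
have n1 (b : bool) : `|b%:R : R| <= 1 by case: b; rewrite ?normr1 ?normr0.
have mid : measurable_fun setT (fun x : measurableTypeR R => x : R) by exact: measurable_id.
have mgc (a : R) : measurable_fun setT (fun w : T => cos (a * U w)).
  by apply: measurable_cosT; exact: measurable_funM.
have mgs (a : R) : measurable_fun setT (fun w : T => sin (a * U w)).
  by apply: measurable_sinT; exact: measurable_funM.
have gcdfI q : \int[gam]_x (x <= q)%R%:R = gcdf q.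
  rewrite /gcdf -[in RHS](setIT `]-oo, q]%classic) -integral_indic//.
  rewrite /Rintegral; congr fine; apply: eq_integral => x _; rewrite indicE.
  by congr (_%:R%:E); congr nat_of_bool; apply/idP/idP; rewrite inE/= in_itv.
have igq q (c : R) : \int[gam]_x (c * (x <= q)%R%:R) = c * gcdf q.
  rewrite RintegralZl ?gcdfI//; apply: (integrable_bounded _ (M := 1)) => //.
  rewrite (_ : (fun _ => _) = (fun b : bool => b%:R : R) \o (fun w : R => w <= q))//.
  apply: measurableT_comp => //; exact: measurable_fun_ler.
have e1 (a : R) : `|expR (- (a ^+ 2 / 2))| <= 1.
  by rewrite ger0_norm ?expR_ge0// -expR0 ler_expR oppr_le0 divr_ge0// sqr_ge0.
have icst (c : R) (f : R -> R) : measurable_fun setT f -> (forall x, `|f x| <= 1) -> \int[gam]_x (c * f x) = c * \int[gam]_x f x.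
  by move=> mf f1; rewrite RintegralZl//; apply: (integrable_bounded _ (M := 1)).
have gc (c s : R) : \int[gam]_x (c * cos (s * x)) = c * expR (- (s ^+ 2 / 2)).
  by rewrite icst ?gauss_cos//; apply: measurable_cosT; exact: measurable_funM.
have gs (c s : R) : \int[gam]_x (c * sin (s * x)) = 0.
  by rewrite icst ?gauss_sin ?mulr0//; apply: measurable_sinT; exact: measurable_funM.
have S1 a q : \int[P]_w (cos (a * U w) * (W w <= q)%R%:R) = expR (- (a ^+ 2 / 2)) * gcdf q.
  rewrite -igq; apply: (@fourier_cdf R _ _ P _ _ gam (fun w => cos (a * U w)) W (cst (expR (- (a ^+ 2 / 2)))) (fun x : measurableTypeR R => x : R) 1) => //.
  - by move=> x; exact: e1.
  - by move=> s; rewrite Ecc gc.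
  - by move=> s; rewrite Ecs gs.
have S2 a q : \int[P]_w (sin (a * U w) * (W w <= q)%R%:R) = 0.
  rewrite -[RHS](mul0r (gcdf q)) -igq; apply: (@fourier_cdf R _ _ P _ _ gam (fun w => sin (a * U w)) W (cst 0) (fun x : measurableTypeR R => x : R) 1) => //.
  - by move=> x; rewrite normr0.
  - by move=> s; rewrite Esc gc mul0r.
  - by move=> s; rewrite Ess gs.
have S3 p q : \int[P]_w ((W w <= q)%R%:R * (U w <= p)%R%:R) = gcdf q * gcdf p.
  rewrite -igq; apply: (@fourier_cdf R _ _ P _ _ gam (fun w => (W w <= q)%R%:R) U (cst (gcdf q)) (fun x : measurableTypeR R => x : R) 1) => //.
  - exact: mle.
  - by move=> x; rewrite ger0_norm ?gcdf_ge0 ?gcdf_le1.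
  - by move=> s; rewrite gc; under eq_Rintegral do rewrite mulrC; rewrite S1 mulrC.
  - by move=> s; rewrite gs; under eq_Rintegral do rewrite mulrC; rewrite S2.
have mpre (Y : T -> R) (A : set R) : measurable_fun setT Y -> measurable A -> measurable (Y @^-1` A).
  by move=> mY mA; rewrite -[X in measurable X]setTI; exact: mY.
have S4 p q : P (U @^-1` `]-oo, p] `&` W @^-1` `]-oo, q]) = ((gcdf p)%:E * (gcdf q)%:E)%E.
  rewrite RintegralM_indic//; [|exact: mpre|exact: mpre].
  rewrite -EFinM (mulrC (gcdf p)) -S3; congr EFin; apply: eq_Rintegral => w _.
  rewrite !indicE mulrC; congr (_%:R * _%:R); congr nat_of_bool; by apply/idP/idP; rewrite inE/= in_itv.
have S5 p B : measurable B -> P (U @^-1` `]-oo, p] `&` W @^-1` B) = ((gcdf p)%:E * gam B)%E.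
  move=> mB; have mUp : measurable (U @^-1` `]-oo, p]) by exact: mpre.
  pose m1_ : {measure set R -> \bar R} := pushforward (mrestr P mUp) W.
  pose m1 := m1_ mW.
  pose m2_ : {measure set R -> \bar R} := pushforward (mscale (NngNum (gcdf_ge0 p)) gam) (fun x : measurableTypeR R => x : R).
  pose m2 := m2_ mid.
  have E1 (C : set R) : m1 C = P (U @^-1` `]-oo, p] `&` W @^-1` C).
    by rewrite /m1 /m1_/= /pushforward /mrestr setIC.
  have E2 (C : set R) : m2 C = ((gcdf p)%:E * gam C)%E by [].
  rewrite -E1 -E2; apply: halfline_measure_unique => //.
  - rewrite E1 preimage_setT setIT; apply: le_lt_trans (ltry 1); exact: probability_le1.
  - rewrite E1 E2 preimage_setT setIT [X in (_ * X)%E](_ : _ = 1)%E; last exact: probability_setT.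
    have := S4 p; rewrite mule1 => S4p.
    have mUI : measurable (U @^-1` `]-oo, p]) := mUp.
    rewrite -(setIT (U @^-1` _)) RintegralM_indic//.
    rewrite -(mul1r (gcdf p)) -igq; congr EFin.
    transitivity (\int[P]_w (cst 1 w * (U w <= p)%R%:R)).
      apply: eq_Rintegral => w _; rewrite indicT/= mulr1 mul1r indicE; congr (_%:R); congr nat_of_bool; by apply/idP/idP; rewrite inE/= in_itv.
    apply: (@fourier_cdf R _ _ P _ _ gam (cst 1) U (cst 1) (fun x : measurableTypeR R => x : R) 1) => //.
    + by move=> x; rewrite normr1.
    + by move=> x; rewrite normr1.
    + move=> s; rewrite gc; have := Ec s 0; rewrite expr0n/= addr0 mul1r => <-.
      by apply: eq_Rintegral => w _; rewrite mul1r mul0r addr0.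
    + move=> s; rewrite gs; have := Es s 0 => <-.
      by apply: eq_Rintegral => w _; rewrite mul1r mul0r addr0.
  - by move=> q; rewrite E1 E2 S4 gamE.
move=> A B mA mB.
have mWB : measurable (W @^-1` B) by exact: mpre.
pose m1_ : {measure set R -> \bar R} := pushforward (mrestr P mWB) U.
pose m1 := m1_ mU.
have gB : (fine (gam B))%:E = gam B by rewrite fineK// fin_num_measure.
have gB0 : 0 <= fine (gam B) by rewrite fine_ge0.
pose m2_ : {measure set R -> \bar R} := pushforward (mscale (NngNum gB0) gam) (fun x : measurableTypeR R => x : R).
pose m2 := m2_ mid.
have E1 (C : set R) : m1 C = P (U @^-1` C `&` W @^-1` B) by [].
have E2 (C : set R) : m2 C = (gam B * gam C)%E by rewrite -[in RHS]gB.
rewrite muleC -E1 -E2; apply: halfline_measure_unique => //.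
- rewrite E1 preimage_setT setTI; apply: le_lt_trans (ltry 1); exact: probability_le1.
- rewrite E1 E2 [X in (_ * X)%E](_ : _ = 1)%E; last exact: probability_setT.
  rewrite mule1 preimage_setT setTI.
  (* The equality of total masses, P(W in B) = gam(B), is the limit of [S5] along p = n. *)
  have H : ((fun n : nat => P (U @^-1` `]-oo, n%:R] `&` W @^-1` B)) @ \oo --> P (W @^-1` B))%E.
    rewrite [X in _ --> P X](_ : _ = \bigcup_n (U @^-1` `]-oo, n%:R] `&` W @^-1` B)); last first.
      apply/seteqP; split => w /=; last by move=> [n _ []].
      move=> Bw; exists (Num.truncn `|U w|).+1 => //; split => //=; rewrite in_itv/=.
      by rewrite (le_trans (ler_norm _))// ltW// truncnS_gt.
    apply: nondecreasing_cvg_mu.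
    + by move=> n; apply: measurableI => //; exact: mpre.
    + by apply: bigcup_measurable => n _; apply: measurableI => //; exact: mpre.
    + move=> n m nm; apply/subsetPset; apply: setSI => w /=; rewrite !in_itv/= => /le_trans; apply.
      by rewrite ler_nat.
  have H2 : (fun n : nat => P (U @^-1` `]-oo, n%:R] `&` W @^-1` B)) @ \oo --> gam B.
    rewrite (_ : (fun n : nat => _) = (fun n : nat => (gcdf n%:R * fine (gam B))%:E)); last first.
      by apply/funext => n; rewrite S5// EFinM gB.
    rewrite -gB -[X in _ --> X%:E]mul1r; apply: cvg_EFin; first exact: nearW.
    apply: cvgM; last exact: cvg_cst.
    by apply: (cvg_gcdf_y (u := fun n => n%:R)); exact: cvgr_idn.
  exact: (cvg_unique _ H H2).
- by move=> p; rewrite E1 E2 S5// gamE muleC.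
Qed.

End joint.

(** * Covariance of residuals of indicators *)

Lemma affine_le_sqr (R : realType) (a b : R) : 0 <= a -> 0 <= b ->
  1 + (a + b) <= (2 + a) * (1 + b ^+ 2) ^+ 2.
Proof.
move=> a0 b0.
have h1 : 1 + b <= 2 * (1 + b ^+ 2) ^+ 2 by have := sqr_ge0 b; have := sqr_ge0 (b - 1); nra.
have h2 : 1 <= (1 + b ^+ 2) ^+ 2 by have := sqr_ge0 b; nra.
by move: (_ ^+ 2) h1 h2 => B h1 h2; nra.
Qed.

Section bivariate.
Context {R : realType}.
Local Notation gam := (@normal_prob R 0 1).
Local Notation gg := (gam \x gam)%E.

(* The centered indicator [u <= p] minus its L2 projection on u. *)
Definition resid (p u : R) : R := (u <= p)%R%:R - gcdf p + gpdf p * u.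

Lemma measurable_resid p : measurable_fun setT (resid p).
Proof.
apply: measurable_funD; last exact: measurable_funM.
apply: measurable_funB => //.
rewrite (_ : (fun _ => _) = (fun b : bool => b%:R : R) \o (fun w : R => w <= p))//.
by apply: measurableT_comp => //; exact: measurable_fun_ler.
Qed.

Lemma resid_le p u : `|resid p u| <= 1 + `|u|.
Proof.
apply: le_trans (ler_normD _ _) _; apply: lerD.
  by have := gcdf_ge0 p; have := gcdf_le1 p; rewrite ler_norml; case: (u <= p) => /= *; apply/andP; split; lra.
by rewrite normrM ler_piMl// (ger0_norm (ltW (gpdf_gt0 _))) gpdf_le1.
Qed.

Definition gmom : R := \int[gam]_x (1 + x ^+ 2) ^+ 2.

Lemma integrable_gmom : gam.-integrable setT (EFin \o (fun x : R => (1 + x ^+ 2) ^+ 2)).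
Proof.
apply: (@gauss_integrable _ _ 1); first by apply: measurable_funX; exact: measurable_funD.
by move=> x; rewrite mul1r ger0_norm// exprn_ge0// addr_ge0// sqr_ge0.
Qed.

Lemma gauss_norm_le (f : R -> R) (c : R) : measurable_fun setT f ->
  (forall x, `|f x| <= c * (1 + x ^+ 2) ^+ 2) -> `|\int[gam]_x f x| <= c * gmom.
Proof.
move=> mf fc; have fi := gauss_integrable mf fc.
apply: le_trans (le_normr_Rintegral _ fi) _ => //.
rewrite /gmom -RintegralZl//; last exact: integrable_gmom.
apply: le_Rintegral => //.
- exact: integrable_norm fi.
- by apply: integrable_scaleR => //; exact: integrable_gmom.
Qed.

Lemma gmom_ge0 : 0 <= gmom.
Proof. by apply: Rintegral_ge0 => x _; rewrite exprn_ge0// addr_ge0// sqr_ge0. Qed.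

Lemma integral_indic_le q : \int[gam]_x (x <= q)%R%:R = gcdf q.
Proof.
rewrite /gcdf -[in RHS](setIT `]-oo, q]%classic) -integral_indic//.
rewrite /Rintegral; congr fine; apply: eq_integral => x _; rewrite indicE.
by congr (_%:R%:E); congr nat_of_bool; apply/idP/idP; rewrite inE/= in_itv.
Qed.

(** The conditional mean, given U = u, of the residual of V = t U + s W with W standard and
    independent of U. The part of the linear term that involves W disappears because W is
    centered. *)
Lemma resid_cond (t s q u : R) : 0 < s ->
  \int[gam]_w resid q (t * u + s * w) =
  gcdf ((q - t * u) / s) - gcdf q + gpdf q * (t * u).
Proof.
move=> s0; set r := (q - t * u) / s.
have iI : gam.-integrable setT (EFin \o (fun w : R => (w <= r)%R%:R : R)).
  apply: (integrable_bounded _ (M := 1)); last by move=> x; case: (x <= r)%R; rewrite ?normr1 ?normr0.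
  rewrite (_ : (fun _ => _) = (fun b : bool => b%:R : R) \o (fun w : R => w <= r))//.
  by apply: measurableT_comp => //; exact: measurable_fun_ler.
have ix : gam.-integrable setT (EFin \o (fun w : R => w)).
  by apply: (@gauss_integrable _ _ 1) => // x; rewrite mul1r ler_norml; apply/andP; split; nra.
pose k := - gcdf q + gpdf q * (t * u).
transitivity (\int[gam]_w ((w <= r)%R%:R + (k + gpdf q * s * w))).
  apply: eq_Rintegral => w _; rewrite /resid /k.
  have -> : (t * u + s * w <= q) = (w <= r) by rewrite /r ler_pdivlMr// lerBrDl (mulrC w).
  by ring.
have ic (c : R) : gam.-integrable setT (EFin \o (fun=> c)) by exact: finite_measure_integrable_cst.
rewrite RintegralD//; last by apply: integrable_addR => //; exact: integrable_scaleR.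
rewrite integral_indic_le RintegralD//; last exact: integrable_scaleR.
rewrite RintegralZl// gauss_mean mulr0 addr0.
by rewrite [X in _ + X](_ : _ = k); [rewrite /k; ring|exact: Rintegral_prob_cst].
Qed.

(** This is where Hermite rank 2 acts: the linear correction cancels the term - gpdf(q) t u in the
    expansion of gcdf((q - t u)/s), and what remains is quadratic in t. The bound on q makes the
    constant uniform. *)
Lemma resid_cond_le (t s q u : R) : 0 < s -> s ^+ 2 = 1 - t ^+ 2 -> `|t| <= 2^-1 -> `|q| <= 1 ->
  `|gcdf ((q - t * u) / s) - gcdf q + gpdf q * (t * u)| <= t ^+ 2 * (10 * (1 + u ^+ 2)).
Proof.
move=> s0 s2 t2 q1; set r := (q - t * u) / s.
have t4 : t ^+ 2 <= 4^-1.
  have -> : 4^-1 = 2^-1 ^+ 2 :> R by field.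
  by rewrite -real_normK ?num_real// ler_pXn2r ?nnegrE.
have t0 : 0 <= t ^+ 2 := sqr_ge0 _.
have s1 : s <= 1 by rewrite leNgt; apply/negP => s_gt1; nra.
have h1 : 1 <= s^-1 by rewrite invf_ge1.
(* Squaring reduces this to (1 + v)^2 (1 - v) >= 1 for v = t^2 <= 1/4. *)
have h2 : s^-1 <= 1 + t ^+ 2.
  rewrite -[leLHS]mul1r ler_pdivrMr// leNgt; apply/negP => h.
  have : ((1 + t ^+ 2) * s) ^+ 2 < 1.
    by apply: exprn_ilt1 => //; apply: mulr_ge0; [rewrite addr_ge0|exact: ltW].
  by rewrite exprMn s2; move: (t ^+ 2) t0 t4 => v v0 v4; nra.
set dl := r - q.
have hd : `|dl + t * u| <= t ^+ 2 * (1 + `|u|).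
  have -> : dl + t * u = (q - t * u) * (s^-1 - 1) by rewrite /dl /r; ring.
  rewrite normrM mulrC; apply: ler_pM => //.
    by rewrite ger0_norm ?subr_ge0//; lra.
  apply: le_trans (ler_normB _ _) _; apply: lerD => //.
  by rewrite normrM ler_piMl//; lra.
have hd2 : `|dl| <= `|t| * (1 + 2 * `|u|).
  have -> : dl = (dl + t * u) - t * u by ring.
  apply: le_trans (ler_normB _ _) _; rewrite normrM.
  apply: le_trans (lerD hd (lexx _)) _.
  rewrite -(real_normK (num_real t)) expr2.
  have := normr_ge0 u; have := normr_ge0 t; move: `|t| `|u| t2 => a b a2 a0 b0.
  rewrite (_ : _ + a * b = a * (a * (1 + b) + b)); last by ring.
  by apply: ler_wpM2l => //; nra.
have hT := gcdf_taylor q r.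
have E : gcdf r - gcdf q + gpdf q * (t * u) =
   (gcdf r - gcdf q - gpdf q * dl) + gpdf q * (dl + t * u) by rewrite /dl; ring.
rewrite E; apply: le_trans (ler_normD _ _) _.
apply: le_trans (lerD hT (_ : _ <= t ^+ 2 * (1 + `|u|))) _.
  rewrite normrM (ger0_norm (ltW (gpdf_gt0 _))); apply: le_trans hd.
  by rewrite ler_piMl// gpdf_le1.
have : dl ^+ 2 <= t ^+ 2 * (1 + 2 * `|u|) ^+ 2.
  rewrite -(real_normK (num_real dl)) -(real_normK (num_real t)) -exprMn.
  by rewrite ler_pXn2r ?nnegrE ?mulr_ge0 ?addr_ge0 ?mulr_ge0.
rewrite -/dl => h3; apply: le_trans (lerD h3 (lexx _)) _.
rewrite -mulrDr ler_wpM2l// -(real_normK (num_real u)).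
move: `|u| (normr_ge0 u) => b b0; have := sqr_ge0 (b - 1); nra.
Qed.

Lemma integrable_resid_prod p q (t s : R) : `|t| <= 1 -> `|s| <= 1 ->
  gg.-integrable setT (EFin \o (fun z : R * R => resid p z.1 * resid q (t * z.1 + s * z.2))).
Proof.
move=> t1 s1.
have m1 : measurable_fun setT (fun z : R * R => resid p z.1).
  by apply: (measurableT_comp (measurable_resid p)).
have m2 : measurable_fun setT (fun z : R * R => resid q (t * z.1 + s * z.2)).
  apply: (measurableT_comp (measurable_resid q)).
  by apply: measurable_funD; apply: measurable_funM.
have m12 := measurable_funM m1 m2.
apply/integrable12ltyP; first exact/measurable_EFinP.
have bnd (x y : R) : `|resid p x * resid q (t * x + s * y)| <= (4 * (1 + x ^+ 2) ^+ 2) * (1 + y ^+ 2) ^+ 2.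
  rewrite normrM.
  have h1 := resid_le p x; have h2 := resid_le q (t * x + s * y).
  have h3 : `|t * x + s * y| <= `|x| + `|y|.
    by apply: le_trans (ler_normD _ _) _; rewrite !normrM lerD// ler_piMl.
  apply: (@le_trans _ _ ((1 + `|x|) * (1 + (`|x| + `|y|)))).
    by apply: ler_pM => //; apply: le_trans h2 _; rewrite lerD2l.
  rewrite -(real_normK (num_real x)) -(real_normK (num_real y)).
  move: `|x| `|y| (normr_ge0 x) (normr_ge0 y) => a b a0 b0.
  apply: (@le_trans _ _ ((2 * (1 + a ^+ 2)) * (2 * (1 + b ^+ 2)))).
    apply: (@le_trans _ _ ((1 + a) ^+ 2 * (1 + b) ^+ 1)); first nra.
    apply: ler_pM; rewrite ?exprn_ge0 ?addr_ge0//; first by have := sqr_ge0 (a - 1); nra.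
    by have := sqr_ge0 (b - 1); nra.
  have a1 : 1 <= 1 + a ^+ 2 by rewrite lerDl sqr_ge0.
  have b1 : 1 <= 1 + b ^+ 2 by rewrite lerDl sqr_ge0.
  move: (1 + a ^+ 2) (1 + b ^+ 2) a1 b1 => A B A1 B1.
  rewrite (_ : 2 * A * (2 * B) = 4 * A * B); last by ring.
  by apply: ler_pM; rewrite ?mulr_ge0 ?(le_trans _ A1) ?(le_trans _ B1)//; nra.
apply: (@le_lt_trans _ _ (\int[gam]_x \int[gam]_y ((4 * (1 + x ^+ 2) ^+ 2) * (1 + y ^+ 2) ^+ 2)%:E)%E).
  apply: ge0_le_integral => //.
  - by move=> x _; exact: integral_ge0.
  - apply: (@measurable_fun_fubini_tonelli_F _ _ _ _ _ gam (fun z : R * R => (`|resid p z.1 * resid q (t * z.1 + s * z.2)|)%:E)) => //.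
    by apply/measurable_EFinP; exact: measurableT_comp.
  - apply: (@measurable_fun_fubini_tonelli_F _ _ _ _ _ gam (fun z : R * R => ((4 * (1 + z.1 ^+ 2) ^+ 2) * (1 + z.2 ^+ 2) ^+ 2)%:E)).
      apply/measurable_EFinP; apply: measurable_funM; last by apply: measurable_funX; apply: measurable_funD => //; exact: measurable_funX.
      by apply: measurable_funM => //; apply: measurable_funX; apply: measurable_funD => //; exact: measurable_funX.
    have h (y : R) : 0 <= (1 + y ^+ 2) ^+ 2 by rewrite exprn_ge0// addr_ge0// sqr_ge0.
    by move=> x; rewrite lee_fin; apply: mulr_ge0 => //; exact: mulr_ge0.
  - move=> x _; apply: ge0_le_integral => //.
    + by apply/measurable_EFinP; apply: measurableT_comp => //; exact: (measurableT_comp m12 (measurable_pair1 x)).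
    + by apply/measurable_EFinP; apply: measurable_funM => //; apply: measurable_funX; exact: measurable_funD.
    + by move=> y _; rewrite lee_fin bnd.
have E (x : R) : (\int[gam]_y ((4 * (1 + x ^+ 2) ^+ 2) * (1 + y ^+ 2) ^+ 2)%:E = (4 * gmom * (1 + x ^+ 2) ^+ 2)%:E)%E.
  under eq_integral do rewrite EFinM.
  rewrite integralZl//; last exact: integrable_gmom.
  have -> : (\int[gam]_y ((1 + y ^+ 2) ^+ 2)%:E = gmom%:E)%E.
    by rewrite fineK//; apply: integrable_fin_num => //; exact: integrable_gmom.
  by rewrite -EFinM; congr EFin; ring.
under eq_integral do rewrite E EFinM.
rewrite integralZl//; last exact: integrable_gmom.
have -> : (\int[gam]_y ((1 + y ^+ 2) ^+ 2)%:E = gmom%:E)%E.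
  by rewrite fineK//; apply: integrable_fin_num => //; exact: integrable_gmom.
by rewrite -EFinM ltry.
Qed.

Lemma resid_sqr_le d (T : measurableType d) (P : probability T R) (U : {RV P >-> R}) p :
  gaussian_rv U 0 1 ->
  P.-integrable setT (EFin \o (fun w => resid p (U w) ^+ 2)) /\
  \int[P]_w (resid p (U w) ^+ 2) <= 2 * gmom.
Proof.
move=> gU.
have mr : measurable_fun setT (fun u => resid p u ^+ 2).
  by apply: measurable_funX; exact: measurable_resid.
have bnd (u : R) : `|resid p u ^+ 2| <= 2 * (1 + u ^+ 2) ^+ 2.
  have h := resid_le p u; rewrite ger0_norm ?sqr_ge0//.
  apply: (@le_trans _ _ ((1 + `|u|) ^+ 2)).
    by rewrite -(real_normK (num_real (resid p u))) ler_pXn2r ?nnegrE ?addr_ge0.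
  rewrite -(real_normK (num_real u)); move: `|u| (normr_ge0 u) => b b0.
  have := sqr_ge0 (b - 1); have := sqr_ge0 b; nra.
have i := gauss_integrable mr bnd.
have [|i2 E] := @gaussian_integral R _ _ P U 0 1 (fun u => resid p u ^+ 2) ler01 gU mr.
  by apply: eq_integrable i => // x _ /=; rewrite sqrtr1 mul1r addr0.
split => //; rewrite E.
under eq_Rintegral do rewrite sqrtr1 mul1r addr0.
apply: le_trans (ler_norm _) _; exact: gauss_norm_le.
Qed.

(** Given U, only the conditional mean of the second residual contributes, and it is O(t^2). [C] is
    chosen before the probability space and the variables, so that one constant serves all pairs of
    averages. *)
Lemma resid_cov_le : exists2 C : R, 0 <= C &
  forall d (T : measurableType d) (P : probability T R) (U V : {RV P >-> R}) (t p q : R),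
  `|t| <= 1 -> `|q| <= 1 ->
  (forall a b, \int[P]_w cos (a * U w + b * V w) = expR (- ((a ^+ 2 + 2 * a * b * t + b ^+ 2) / 2))) ->
  (forall a b, \int[P]_w sin (a * U w + b * V w) = 0) ->
  P.-integrable setT (EFin \o (fun w => resid p (U w) * resid q (V w))) /\
  `|\int[P]_w (resid p (U w) * resid q (V w))| <= C * t ^+ 2.
Proof.
(* For |t| < 1/2 the factor 10 of [resid_cond_le] doubles through 1 + |u| <= 2 (1 + u^2). For |t| >=
   1/2 the two second moments sum to at most [4 * gmom], which is below [20 * gmom * t ^+ 2] since
   t^2 >= 1/4. *)
exists (20 * gmom); first by rewrite mulr_ge0 ?gmom_ge0.
move=> d T P U V t p q t1 q1 Ec Es.
have mU : measurable_fun setT U by exact: measurable_funPT.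
have mV : measurable_fun setT V by exact: measurable_funPT.
have gU : gaussian_rv U 0 1.
  apply: gauss_char_law => // s.
    have := Ec s 0; rewrite expr0n/= mulr0 mul0r !addr0 mulr1 => <-.
    by apply: eq_Rintegral => w _; rewrite mul0r addr0.
  by have := Es s 0 => <-; apply: eq_Rintegral => w _; rewrite mul0r addr0.
have gV : gaussian_rv V 0 1.
  apply: gauss_char_law => // s.
    have := Ec 0 s; rewrite expr0n/= mulr0 mul0r mul0r !add0r mulr1 => <-.
    by apply: eq_Rintegral => w _; rewrite mul0r add0r.
  by have := Es 0 s => <-; apply: eq_Rintegral => w _; rewrite mul0r add0r.
have [iU UE] := resid_sqr_le p gU.
have [iV VE] := resid_sqr_le q gV.
have mUV : measurable_fun setT (fun w => resid p (U w) * resid q (V w)).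
  by apply: measurable_funM; [exact: (measurableT_comp (measurable_resid p))|exact: (measurableT_comp (measurable_resid q))].
have iB : P.-integrable setT (EFin \o (fun w => resid p (U w) ^+ 2 + resid q (V w) ^+ 2)).
  exact: integrable_addR.
have bnd w : `|resid p (U w) * resid q (V w)| <= resid p (U w) ^+ 2 + resid q (V w) ^+ 2.
  move: (resid _ _) (resid _ _) => a b; rewrite ler_norml.
  by apply/andP; split; have := sqr_ge0 (a - b); have := sqr_ge0 (a + b); nra.
have iUV : P.-integrable setT (EFin \o (fun w => resid p (U w) * resid q (V w))).
  apply: le_integrable iB => //; first exact/measurable_EFinP.
  by move=> w _; rewrite /= lee_fin [leRHS]ger0_norm ?addr_ge0 ?sqr_ge0.
split=> //.
have [t2|t2] := leP (2^-1) `|t|.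
  apply: le_trans (le_normr_Rintegral _ iUV) _ => //.
  apply: (@le_trans _ _ (\int[P]_w (resid p (U w) ^+ 2 + resid q (V w) ^+ 2))).
    by apply: le_Rintegral => //; exact: integrable_norm iUV.
  rewrite RintegralD//; apply: le_trans (lerD UE VE) _.
  have : 4^-1 <= t ^+ 2.
    have -> : 4^-1 = 2^-1 ^+ 2 :> R by field.
    by rewrite -(real_normK (num_real t)) ler_pXn2r ?nnegrE.
  by have := gmom_ge0; move: gmom (t ^+ 2) => g v g0 v4; nra.
have t4 : t ^+ 2 < 1.
  by rewrite -(real_normK (num_real t)) exprn_ilt1//; lra.
pose s : R := Num.sqrt (1 - t ^+ 2).
have s2 : s ^+ 2 = 1 - t ^+ 2 by rewrite sqr_sqrtr// subr_ge0 ltW.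
have s0 : 0 < s by rewrite sqrtr_gt0 subr_gt0.
have s1 : s <= 1 by rewrite leNgt; apply/negP => s_gt1; have := sqr_ge0 t; nra.
(* The normalized innovation of V with respect to U; together with U it has the transform of two
   independent standard normals. *)
pose W : {RV P >-> R} := (s^-1 \o* (V - t \o* U))%R.
have WE w : W w = s^-1 * (V w - t * U w) by rewrite /W/=; rewrite mulrC (mulrC t).
have VE' w : V w = t * U w + s * W w by rewrite WE mulrA divff ?gt_eqF// mul1r addrCA subrr addr0.
have law := @joint_gauss_law R _ _ P U W.
have {law} law : forall A B : set R, measurable A -> measurable B ->
    P (U @^-1` A `&` W @^-1` B) = (gam A * gam B)%E.
  apply: law => a b.
    transitivity (\int[P]_w cos ((a - b * t / s) * U w + (b / s) * V w)).
      by apply: eq_Rintegral => w _; rewrite WE; congr cos; field; rewrite gt_eqF.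
    rewrite Ec; congr (expR (- (_ / 2))).
    have -> : a ^+ 2 + b ^+ 2 = a ^+ 2 + b ^+ 2 / s ^+ 2 * (1 - t ^+ 2).
      by rewrite -s2 divfK// expf_neq0// gt_eqF.
    by field; rewrite gt_eqF.
  transitivity (\int[P]_w sin ((a - b * t / s) * U w + (b / s) * V w)).
    by apply: eq_Rintegral => w _; rewrite WE; congr sin; field; rewrite gt_eqF.
  by rewrite Es.
pose UW (w : T) : measurableTypeR R * measurableTypeR R := (U w, W w).
have mW : measurable_fun setT W by exact: measurable_funPT.
have mUW : measurable_fun setT UW := measurable_fun_pair mU mW.
pose m_ : {measure set (measurableTypeR R * measurableTypeR R) -> \bar R} := pushforward P UW.
pose m := m_ mUW.
have gm : forall A, measurable A -> gg A = m A.
  apply: product_measure_unique => A B mA mB.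
  rewrite /m /m_/= /pushforward -law//; congr (P _).
have mphi : measurable_fun setT (fun z : R * R => resid p z.1 * resid q (t * z.1 + s * z.2)).
  apply: measurable_funM; first exact: (measurableT_comp (measurable_resid p)).
  apply: (measurableT_comp (measurable_resid q)).
  by apply: measurable_funD; apply: measurable_funM.
have ig : gg.-integrable setT (EFin \o (fun z : R * R => resid p z.1 * resid q (t * z.1 + s * z.2))).
  by apply: integrable_resid_prod => //; rewrite ger0_norm// ltW.
have -> : \int[P]_w (resid p (U w) * resid q (V w)) =
    \int[gam]_u (resid p u * (gcdf ((q - t * u) / s) - gcdf q + gpdf q * (t * u))).
  transitivity (\int[gg]_z (resid p z.1 * resid q (t * z.1 + s * z.2))).
    rewrite /Rintegral; congr fine.
    have -> : (\int[gg]_z (resid p z.1 * resid q (t * z.1 + s * z.2))%:E =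
        \int[m]_z (resid p z.1 * resid q (t * z.1 + s * z.2))%:E)%E.
      by apply: eq_measure_integral => A mA _; exact: gm.
    rewrite /m /m_ integral_pushforward//.
    - by apply: eq_integral => w _; rewrite /= VE'.
    - exact/measurable_EFinP.
    - by apply: eq_integrable iUV => // w _; rewrite /= VE'.
  have Fub := integral12_prod_meas1 ig.
  rewrite /Rintegral -[X in fine X]Fub; congr fine; apply: eq_integral => u _.
  rewrite /fubini_F.
  transitivity ((resid p u)%:E * \int[gam]_w (resid q (t * u + s * w))%:E)%E.
    rewrite -integralZl//; apply: (@gauss_integrable _ _ (2 + `|u|)).
      apply: (measurableT_comp (measurable_resid q)).
      by apply: measurable_funD => //; exact: measurable_funM.
    move=> w; apply: le_trans (resid_le _ _) _.
    have h3 : `|t * u + s * w| <= `|u| + `|w|.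
      by apply: le_trans (ler_normD _ _) _; rewrite !normrM lerD// ler_piMl// ger0_norm// ltW.
    apply: (@le_trans _ _ (1 + (`|u| + `|w|))); first by rewrite lerD2l.
    rewrite -(real_normK (num_real w)); move: `|w| `|u| (normr_ge0 w) (normr_ge0 u) => b a b0 a0.
    exact: affine_le_sqr.
  rewrite EFinM; congr (_ * _)%E; rewrite -resid_cond// /Rintegral fineK//.
  apply: integrable_fin_num => //; apply: (@gauss_integrable _ _ (2 + `|u|)).
    apply: (measurableT_comp (measurable_resid q)).
    by apply: measurable_funD => //; exact: measurable_funM.
  move=> w; apply: le_trans (resid_le _ _) _.
  have h3 : `|t * u + s * w| <= `|u| + `|w|.
    by apply: le_trans (ler_normD _ _) _; rewrite !normrM lerD// ler_piMl// ger0_norm// ltW.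
  apply: (@le_trans _ _ (1 + (`|u| + `|w|))); first by rewrite lerD2l.
  rewrite -(real_normK (num_real w)); move: `|w| `|u| (normr_ge0 w) (normr_ge0 u) => b a b0 a0.
  exact: affine_le_sqr.
rewrite (_ : 20 * gmom * t ^+ 2 = (20 * t ^+ 2) * gmom); last by ring.
apply: gauss_norm_le.
  apply: measurable_funM; first exact: measurable_resid.
  apply: measurable_funD; last by apply: measurable_funM => //; exact: measurable_funM.
  apply: measurable_funB => //; apply: (measurableT_comp (continuous_measurable_fun continuous_gcdf)).
  by apply: measurable_funM => //; apply: measurable_funB => //; exact: measurable_funM.
move=> u; rewrite normrM.
have h1 := resid_le p u; have h2 := resid_cond_le u s0 s2 (ltW t2) q1.
apply: le_trans (ler_pM (normr_ge0 _) (normr_ge0 _) h1 h2) _.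
rewrite (_ : (1 + `|u|) * _ = t ^+ 2 * (10 * ((1 + `|u|) * (1 + u ^+ 2)))); last by ring.
rewrite (_ : 20 * t ^+ 2 * _ = t ^+ 2 * (10 * ((2 * (1 + u ^+ 2)) * (1 + u ^+ 2)))); last by ring.
apply: ler_wpM2l; first exact: sqr_ge0.
apply: ler_wpM2l => //; apply: ler_wpM2r; first by rewrite addr_ge0// sqr_ge0.
rewrite -(real_normK (num_real u)); have := sqr_ge0 (`|u| - 1); move: `|u|; clear=> b; nra.
Qed.

End bivariate.

(** * Slowly varying functions *)

Section uct.
Context {R : realType}.
Local Notation mu := (@lebesgue_measure R).

Lemma lebesgue_translate (A : set R) (u : R) : measurable A ->
  mu ((fun x => x - u) @^-1` A) = mu A.
Proof.
move=> mA.
have mT : measurable ((fun x : R => x - u) @^-1` A).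
  by rewrite -[X in measurable X]setTI; apply: measurable_funB.
have E := @ge0_integral_affine R 1 (- u) (fun x => (\1_A x)%:E) (oner_neq0 _).
have : (\int[mu]_x (\1_A (1 * x + - u))%:E = \int[mu]_x (\1_A x)%:E)%E.
  rewrite E; first by rewrite normr1 invr1 mul1e.
  - by apply/measurable_EFinP; exact: measurable_indic.
  - by move=> x; rewrite lee_fin.
have I (B : set R) : measurable B -> mu B = (\int[mu]_x (\1_B x)%:E)%E.
  by move=> mB; rewrite -[in LHS](setIT B) -integral_indic.
move=> H; rewrite (I _ mT) (I _ mA) -H.
by apply: eq_integral => x _; rewrite mul1r !indicE; congr (_%:R%:E); congr nat_of_bool; apply/idP/idP; rewrite !inE.
Qed.

Variable ell : R -> R.
Hypothesis mell : measurable_fun setT ell.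
Hypothesis slow : forall u, ell (t + u) / ell t @[t --> +oo] --> (1 : R).

(** The shifts in [0, 2 U] for which the ratio has settled within [eta] along the sequence [s] from
    index [n] on. When [s] tends to +oo these sets increase to the whole interval. *)
Let V (s : nat -> R) (U eta : R) (n : nat) : set R :=
  `[0, 2 * U] `&` [set x | forall m, (n <= m)%N -> `|ell (s m + x) / ell (s m) - 1| < eta].

Let mV s U eta n : measurable (V s U eta n).
Proof.
apply: measurableI => //.
rewrite (_ : [set x | _] = \bigcap_m [set x | (n <= m)%N -> `|ell (s m + x) / ell (s m) - 1| < eta]); last first.
  by apply/seteqP; split => x /= h m; [move=> _; exact: h|exact: h].
apply: bigcapT_measurable => m.
have [nm|nm] := leqP n m; last first.
  rewrite (_ : [set _ | _] = setT)//; apply/seteqP; split => // x _ /=.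
rewrite (_ : [set _ | _] = (fun x => `|ell (s m + x) / ell (s m) - 1|) @^-1` `]-oo, eta[); last first.
  by apply/seteqP; split => x /=; rewrite in_itv/= => h //; exact: h.
rewrite -[X in measurable X]setTI.
have mf : measurable_fun setT (fun x => `|ell (s m + x) / ell (s m) - 1|).
  apply: measurableT_comp => //; apply: measurable_funB => //; apply: measurable_funM => //.
  by apply: (measurableT_comp mell); exact: measurable_funD.
by apply: mf.
Qed.

Let Vcvg (s : nat -> R) (U eta : R) : s @ \oo --> +oo -> 0 < U -> 0 < eta ->
  \forall n \near \oo, 3 / 2 * U < fine (mu (V s U eta n)).
Proof.
move=> soo U0 eta0.
have UV : \bigcup_n V s U eta n = `[0, 2 * U]%classic.
  apply/seteqP; split => [x [n _ []]//|x xU].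
  have := @cvg_comp _ _ _ s (fun t => ell (t + x) / ell t) _ _ _ soo (slow x).
  move=> /cvgrPdist_lt /(_ _ eta0) [N _ NP].
  by exists N => //; split => // m Nm; rewrite distrC; exact: NP.
have H : mu (V s U eta n) @[n --> \oo] --> mu (\bigcup_n V s U eta n).
  apply: nondecreasing_cvg_mu; first by move=> n; exact: mV.
    by apply: bigcup_measurable => n _; exact: mV.
  move=> n m nm; apply/subsetPset => x [x1 x2]; split => // k mk.
  by apply: x2; exact: leq_trans mk.
rewrite UV lebesgue_measure_itv/= lte_fin mulr_gt0// oppr0 adde0 in H.
have H2 : fine (mu (V s U eta n)) @[n --> \oo] --> 2 * U by exact: fine_cvg.
by apply: (cvgr_gt _ H2); lra.
Qed.

(** Uniform convergence theorem for measurable slowly varying functions. If it fails there are bad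
    pairs (s_n, u_n). The good shifts for s_n, and those for s_n + u_n moved by u_n, have measure
    above 3U/2 inside [0, 3U], so some y is common to both; the value at s_n + y is then close to
    the values at s_n and at s_n + u_n, a contradiction. *)
Lemma uniform_slow (U eps : R) : 0 < U -> 0 < eps < 1 ->
  exists t0 : R, forall t u, t0 <= t -> 0 <= u <= U -> `|ell (t + u) / ell t - 1| <= eps.
Proof.
move=> U0 /andP[e0 e1]; apply: contrapT => /forallNP H.
have {}H : forall n : nat, exists p : R * R, [/\ n%:R <= p.1, 0 <= p.2 <= U & eps < `|ell (p.1 + p.2) / ell p.1 - 1|].
  move=> n; apply: contrapT => H2; apply: (H n%:R) => t u nt uU.
  by rewrite leNgt; apply/negP => h; apply: H2; exists (t, u).
have [f fP] := choice H.
pose eta := eps / 4; have eta0 : 0 < eta by rewrite /eta; lra.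
pose s n := (f n).1; pose v n := (f n).1 + (f n).2.
have soo : s @ \oo --> +oo.
  apply: (@ger_cvgy _ _ _ R (fun n => n%:R)); last exact: cvgr_idn.
  by apply: nearW => n; case: (fP n).
have voo : v @ \oo --> +oo.
  apply: (@ger_cvgy _ _ _ R (fun n => n%:R)); last exact: cvgr_idn.
  by apply: nearW => n; rewrite /v; case: (fP n) => h /andP[h2 _] _; lra.
have [N _ NP] := filterI (Vcvg soo U0 eta0) (Vcvg voo U0 eta0).
have [/= V1 V2] := NP N (leqnn N).
have [fN /andP[u0 uU] bad] := fP N; set u := (f N).2 in u0 uU bad.
pose A1 := V s U eta N; pose A2 := (fun x => x - u) @^-1` V v U eta N.
have mA1 : measurable A1 by exact: mV.
have mA2 : measurable A2.
  by rewrite -[X in measurable X]setTI; apply: measurable_funB => //; exact: mV.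
have fin s' : mu (V s' U eta N) \is a fin_num.
  rewrite ge0_fin_numE//; apply: (@le_lt_trans _ _ (mu `[0, 2 * U])).
    by apply: le_measure; rewrite ?inE//; [exact: mV|exact: subIsetl].
  by rewrite lebesgue_measure_itv/= lte_fin mulr_gt0// -EFinB ltry.
have [y [[y1 y2] [y3 y4]]] : A1 `&` A2 !=set0.
  apply/set0P/negP => /eqP A12.
  have sub : A1 `|` A2 `<=` `[0, 3 * U].
    move=> x [[+ _]|[+ _]]; rewrite /= !in_itv/= => /andP[x1 x2];
      by move: x1 x2 u0 uU; clear; move=> *; apply/andP; split; lra.
  have := @le_measure _ _ _ mu (A1 `|` A2) `[0, 3 * U]%classic.
  rewrite !inE => /(_ (measurableU _ _ mA1 mA2) (measurable_itv _) sub).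
  rewrite measureU// [X in (_ + X)%E]lebesgue_translate; last exact: mV.
  have E3 : mu `[0, 3 * U]%classic = (3 * U)%:E.
    by rewrite lebesgue_measure_itv/= lte_fin mulr_gt0// oppr0 adde0.
  rewrite [X in (_ <= X)%E](_ : _ = (3 * U)%:E)//.
  move=> H3; have : (mu (V s U eta N) + mu (V v U eta N) <= (3 * U)%:E)%E := H3.
  rewrite -(fineK (fin s)) -(fineK (fin v)) -EFinD lee_fin.
  move: V1 V2; lra.
have r1 := y2 N (leqnn N); have r2 := y4 N (leqnn N).
rewrite (_ : v N + (y - u) = s N + y) in r2; last by rewrite /v /s /u; ring.
move: bad; rewrite -/(s N) -/(v N) ltNge => /negP; apply.
move: r1 r2; set a := ell (s N + y); set b := ell (s N); set c := ell (v N) => r1 r2.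
(* Division by zero gives 0, so a vanishing value would put a ratio at distance 1 from 1. *)
have b0 : b != 0.
  by apply/eqP => b0; move: r1; rewrite b0 invr0 mulr0 sub0r normrN1 /eta; lra.
have c0 : c != 0.
  by apply/eqP => c0; move: r2; rewrite c0 invr0 mulr0 sub0r normrN1 /eta; lra.
have a0 : a != 0.
  by apply/eqP => a0; move: r1; rewrite a0 mul0r sub0r normrN1 /eta; lra.
have -> : c / b = (a / b) / (a / c) by field; rewrite a0 b0 c0.
move: r1 r2; rewrite !ltr_norml; move: (a / b) (a / c) => p q /andP[p1 p2] /andP[q1 q2].
have q0 : 0 < q by rewrite /eta in q1; lra.
rewrite (_ : p / q - 1 = (p - q) / q); last by field; rewrite gt_eqF.
rewrite normrM normfV (gtr0_norm q0) ler_pdivrMr// ler_norml.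
by rewrite /eta in p1 p2 q1 q2; apply/andP; split; nra.
Qed.

End uct.

(** The substitution x = exp t turns dilations into translations. *)
Lemma slowly_varying_uniform (R : realType) (L : R -> R) (U eps : R) :
  slowly_varying L -> 1 < U -> 0 < eps < 1 ->
  exists x0 : R, 0 < x0 /\ forall x y, x0 <= x -> x <= y <= U * x -> `|L y / L x - 1| <= eps.
Proof.
move=> [[A mL] sL] U1 e01.
(* [L] is measurable only on a half-line, so it is cut off below [A']; the cut-off does not act at
   [expR t] once [A' <= t]. *)
pose A' := Num.max A 1.
pose M : R -> R := L \_ `[A', +oo[.
have ML x : A' <= x -> M x = L x by move=> Ax; rewrite /M patchE ifT// inE/= in_itv/= andbT.
have mM : measurable_fun setT M.
  apply/(measurable_restrictT _ _).1 => //; apply: measurable_funS mL => //.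
  by apply: subset_itvr; rewrite bnd_simp le_max lexx.
have mell : measurable_fun setT (fun t => M (expR t)).
  by apply: (measurableT_comp mM).
have slow u : M (expR (t + u)) / M (expR t) @[t --> +oo] --> (1 : R).
  have e0 : 0 < expR u by exact: expR_gt0.
  have h := sL _ e0.
  have ey : @expR R x @[x --> +oo] --> +oo.
    apply: (@ger_cvgy _ _ _ R id); last exact: cvg_id.
    by apply: nearW => x; have := expR_ge1Dx x; lra.
  have h2 := @cvg_comp _ _ _ (@expR R) (fun x => L (expR u * x) / L x) _ _ _ ey h.
  apply: cvg_trans h2; apply: near_eq_cvg.
  near=> t.
  have t1 : A' <= t by near: t; apply: nbhs_pinfty_ge; exact: num_real.
  have t2 : A' - u <= t by near: t; apply: nbhs_pinfty_ge; exact: num_real.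
  have h4 := expR_ge1Dx t; have h5 := expR_ge1Dx (t + u).
  have a1 : A' <= expR t by lra.
  have a2 : A' <= expR (t + u) by lra.
  by rewrite /comp !ML// (addrC t) expRD.
have lU : 0 < ln U by rewrite ln_gt0.
have [t0 t0P] := uniform_slow mell slow lU e01.
exists (Num.max A' (expR t0)); split; first by rewrite lt_max expR_gt0 orbT.
move=> x y; rewrite ge_max => /andP[Ax tx] /andP[xy yU].
have x0 : 0 < x by apply: lt_le_trans tx; exact: expR_gt0.
have y0 : 0 < y by exact: lt_le_trans xy.
have := t0P (ln x) (ln y - ln x).
rewrite (addrC (ln x)) subrK !lnK ?posrE// !ML//; last exact: le_trans xy.
apply; first by rewrite -[t0]expRK ler_ln ?posrE ?expR_gt0.
rewrite subr_ge0 ler_ln ?posrE// xy/= lerBlDl -lnM ?posrE//; last lra.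
by rewrite ler_ln ?posrE ?mulr_gt0//; lra.
Unshelve. all: by end_near. Qed.

Lemma cvg_dist_le (R : realType) (f h : nat -> R) (l : R) :
  (\forall n \near \oo, `|f n - l| <= h n) -> h @ \oo --> (0 : R) -> f @ \oo --> l.
Proof.
move=> fh h0; apply/cvgrPdist_le => e e0.
move/cvgrPdist_le : h0 => /(_ e e0); apply: filterS2 fh => n fn.
by rewrite sub0r normrN distrC => hn; apply: le_trans fn (le_trans (ler_norm _) hn).
Qed.

(** * Sums of powers of integers compared with integrals *)

Section powsum.
Context {R : realType}.
Implicit Types b x y : R.

Lemma powR_diff b x : 0 < x -> 0 < b -> exists2 c, x <= c <= x + 1 & (x + 1) `^ b - x `^ b = b * c `^ (b - 1).
Proof.
move=> x0 b0; have xx1 : x <= x + 1 by lra.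
have d (z : R) : x <= z -> is_derive z (1 : R) ((powR (R:=R))^~ b) (b * z `^ (b - 1)).
  by move=> xz; apply: is_derive1_powR; lra.
have [||c cx ->] := MVT_segment xx1 (f := (powR (R:=R))^~ b) (df := fun z => b * z `^ (b - 1)).
- by move=> z; rewrite in_itv/= => /andP[/ltW xz _]; exact: d.
- apply: derivable_within_continuous => z; rewrite in_itv/= => /andP[xz _].
  by case: (d z xz).
by rewrite (_ : x + 1 - x = 1) ?mulr1; [exists c => //; move: cx; rewrite in_itv|ring].
Qed.

Lemma powRN_le b x y : 0 <= b -> 0 < x -> x <= y -> y `^ (- b) <= x `^ (- b).
Proof.
move=> b0 x0 xy; rewrite !powRN lef_pV2 ?posrE ?powR_gt0//; last lra.
by rewrite ge0_ler_powR ?nnegrE//; lra.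
Qed.

(** The increment of x^(1-b) is (1 - b) c^(-b) for some c in [n, n+1], and x^(-b) decreases. The
    mean value argument excludes n = 0, where the claim reduces to 1 <= 1/(1 - b). *)
Lemma powR_natV_le b (n : nat) : 0 < b < 1 ->
  n.+1%:R `^ (- b) <= (n.+1%:R `^ (1 - b) - n%:R `^ (1 - b)) / (1 - b) :> R.
Proof.
move=> /andP[b0 b1]; have b1' : 0 < 1 - b by lra.
rewrite ler_pdivlMr//; case: n => [|n].
  by rewrite !powR1 powR0 ?gt_eqF// subr0; lra.
have [c /andP[c1 c2]] := powR_diff (ltr0Sn R n) b1'.
rewrite natr1 => ->; rewrite mulrC; apply: ler_wpM2l; first exact: ltW.
rewrite (_ : 1 - b - 1 = - b); last by ring.
by apply: powRN_le; [exact: ltW|exact: lt_le_trans (ltr0Sn R n) c1|rewrite -natr1].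
Qed.

Lemma sum_powR_le b y (n : nat) : 0 < b < 1 -> 0 <= y ->
  \sum_(k < n | k.+1%:R <= y) k.+1%:R `^ (- b) <= y `^ (1 - b) / (1 - b) :> R.
Proof.
move=> b01 y0; have /andP[b0 b1] := b01; have b1' : 0 < 1 - b by lra.
have V0 : 0 <= (1 - b)^-1 by rewrite invr_ge0 ltW.
suff H : \sum_(k < n | k.+1%:R <= y) k.+1%:R `^ (- b) <= (Num.min n%:R y) `^ (1 - b) / (1 - b).
  apply: le_trans H _; rewrite ler_wpM2r// ge0_ler_powR ?nnegrE ?le_min ?ler0n ?ge_min ?lexx ?orbT//; exact: ltW.
elim: n => [|n IH]; first by rewrite big_ord0 mulr_ge0 ?powR_ge0.
rewrite big_mkcond big_ord_recr/= -big_mkcond/=.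
case: ifPn => [ny|_]; last first.
  rewrite addr0; apply: le_trans IH _; rewrite ler_wpM2r// ge0_ler_powR ?nnegrE ?le_min ?ler0n//; first exact: ltW.
  rewrite ge_min ge_min lexx orbT !andbT; apply/orP; left; by rewrite ler_nat.
have ny' : n%:R <= y by apply: le_trans ny; rewrite ler_nat.
move: IH; rewrite !min_l// => IH.
apply: le_trans (lerD IH (powR_natV_le n b01)) _.
by rewrite -mulrDl addrC subrK.
Qed.

Lemma sum_powR_le_nat b (n : nat) : 0 < b < 1 ->
  \sum_(k < n) k.+1%:R `^ (- b) <= n%:R `^ (1 - b) / (1 - b) :> R.
Proof.
move=> b01; apply: le_trans (sum_powR_le n b01 (ler0n _ n)).
by rewrite [leRHS](eq_bigl xpredT)// => k; rewrite ler_nat ltn_ord.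
Qed.

Lemma powR_cvgy b : 0 < b -> n%:R `^ b @[n --> \oo] --> +oo.
Proof.
move=> b0; apply/cvgryPge => A.
have := nbhs_infty_ger ((`|A| + 1) `^ b^-1 : R); apply: filterS => n /= hn.
apply: (@le_trans _ _ (((`|A| + 1) `^ b^-1) `^ b)).
  rewrite -powRrM mulVf ?gt_eqF// powRr1 ?addr_ge0//.
  by have := ler_norm A; lra.
by rewrite ge0_ler_powR ?nnegrE ?powR_ge0 ?ler0n// ltW.
Qed.

Lemma powRN_cvg0 b : 0 < b -> n%:R `^ (- b) @[n --> \oo] --> (0 : R).
Proof.
move=> b0; under eq_fun do rewrite powRN.
apply/gtr0_cvgV0; last exact: powR_cvgy.
by exists 1%N => // n /= n0; rewrite powR_gt0// ltr0n.
Qed.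

(* The two cases of monotonicity of x^(b-1) both compare the sum with the telescoping x^b. *)
Lemma sum_powR_cvg b : 0 < b < 2 ->
  n%:R `^ (- b) * \sum_(k < n) k.+1%:R `^ (b - 1) @[n --> \oo] --> b^-1.
Proof.
move=> /andP[b0 b2].
have step (k : nat) : (0 < k)%N -> exists2 c : R, k%:R <= c <= k.+1%:R & k.+1%:R `^ b - k%:R `^ b = b * c `^ (b - 1).
  move=> k0; have k0' : 0 < k%:R :> R by rewrite ltr0n.
  by have [c h E] := powR_diff k0' b0; exists c; rewrite -natr1.
have mono x y : 0 < x -> x <= y -> if 1 <= b then x `^ (b - 1) <= y `^ (b - 1) else y `^ (b - 1) <= x `^ (b - 1).
  move=> x0 xy; case: ifPn => b1.
    by rewrite ge0_ler_powR ?nnegrE//; lra.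
  rewrite -ltNge in b1; rewrite (_ : b - 1 = - (1 - b)); last by ring.
  by apply: powRN_le => //; lra.
pose S n : R := \sum_(k < n) k.+1%:R `^ (b - 1).
(* For b >= 1 the sum lies between the telescoping sums up to n and up to n + 1. For b < 1 the order
   reverses, and the [+ 1] accounts for a telescoping sum that starts at 1 instead of 0. *)
have SB n : `|b * S n - n%:R `^ b| <= n.+1%:R `^ b - n%:R `^ b + 1.
  case: (leP 1 b) => b1.
    have lo : n%:R `^ b <= b * S n.
      elim: n => [|n IH]; first by rewrite /S big_ord0 mulr0 powR0// gt_eqF.
      rewrite /S big_ord_recr/= mulrDr -/(S n).
      case: n IH => [|n] IH; first by rewrite /S big_ord0 mulr0 add0r !powR1 mulr1.
      have [c /andP[c1 c2] E] := step n.+1 (ltn0Sn _).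
      have := mono c n.+2%:R (lt_le_trans (ltr0Sn R n) c1) c2; rewrite b1 => m.
      have := ler_wpM2l (ltW b0) m; lra.
    have up : b * S n <= n.+1%:R `^ b.
      elim: n {lo} => [|n IH]; first by rewrite /S big_ord0 mulr0 powR_ge0.
      rewrite /S big_ord_recr/= mulrDr -/(S n).
      have [c /andP[c1 c2] E] := step n.+1 (ltn0Sn _).
      have := mono n.+1%:R c (ltr0Sn R n) c1; rewrite b1 => m.
      have := ler_wpM2l (ltW b0) m; lra.
    rewrite ger0_norm; lra.
  have nb1 : (1 <= b) = false by rewrite leNgt b1.
  have up : b * S n <= n%:R `^ b.
    elim: n => [|n IH]; first by rewrite /S big_ord0 mulr0 powR_ge0.
    rewrite /S big_ord_recr/= mulrDr -/(S n).
    case: n IH => [|n] IH; first by rewrite /S big_ord0 mulr0 add0r !powR1 mulr1 ltW.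
    have [c /andP[c1 c2] E] := step n.+1 (ltn0Sn _).
    have := mono c n.+2%:R (lt_le_trans (ltr0Sn R n) c1) c2; rewrite nb1 => m.
    have := ler_wpM2l (ltW b0) m; lra.
  have lo : n.+1%:R `^ b - 1 <= b * S n.
    elim: n {up} => [|n IH]; first by rewrite /S big_ord0 mulr0 powR1 subrr.
    rewrite /S big_ord_recr/= mulrDr -/(S n).
    have [c /andP[c1 c2] E] := step n.+1 (ltn0Sn _).
    have := mono n.+1%:R c (ltr0Sn R n) c1; rewrite nb1 => m.
    have := ler_wpM2l (ltW b0) m; lra.
  have : n%:R `^ b <= n.+1%:R `^ b by rewrite ge0_ler_powR ?nnegrE ?ler0n ?ler_nat// ltW.
  by move=> mn; rewrite ler0_norm; lra.
have Sn0 n : 0 <= S n by apply: sumr_ge0 => i _; exact: powR_ge0.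
have bnd n : `|n.+1%:R `^ (- b) * S n.+1 - b^-1| <= b^-1 * (3 * n.+1%:R^-1 + n.+1%:R `^ (- b)).
  have nn0 : 0 < n.+1%:R `^ b :> R by rewrite powR_gt0.
  have -> : n.+1%:R `^ (- b) * S n.+1 - b^-1 = b^-1 * (n.+1%:R `^ (- b) * (b * S n.+1 - n.+1%:R `^ b)).
    by rewrite powRN; field; rewrite !gt_eqF.
  have bV : 0 <= b^-1 by rewrite invr_ge0 ltW.
  rewrite normrM (ger0_norm bV) ler_wpM2l//.
  rewrite normrM ger0_norm ?powR_ge0//.
  apply: le_trans (ler_wpM2l (powR_ge0 _ _) (SB n.+1)) _.
  rewrite mulrDr mulr1 lerD2r mulrBr powRN mulVf ?gt_eqF//.
  have -> : (n.+1%:R `^ b)^-1 * n.+2%:R `^ b = (n.+2%:R / n.+1%:R) `^ b :> R.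
    by rewrite powRM ?invr_ge0// -(powR_inv1 (ler0n _ _)) -powRrM mulN1r powRN mulrC.
  have m1 : 1 <= n.+2%:R / n.+1%:R :> R by rewrite ler_pdivlMr// mul1r ler_nat.
  (* Here [b < 2] enters: (1 + h)^b - 1 <= (1 + h)^2 - 1 <= 3 h for h = 1/(n+1). *)
  apply: (@le_trans _ _ ((n.+2%:R / n.+1%:R) `^ 2%:R - 1)).
    by rewrite lerB//; apply: ler_powR => //; exact: ltW.
  rewrite powR_mulrn ?(le_trans _ m1)//.
  have : n.+1%:R^-1 <= 1 :> R by rewrite invf_le1// ler1n.
  have : 0 < n.+1%:R^-1 :> R by rewrite invr_gt0.
  have -> : n.+2%:R / n.+1%:R = 1 + n.+1%:R^-1 :> R.
    by rewrite -natr1 mulrDl divff// mul1r.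
  by move: (_^-1 : R) => v v0 v1; nra.
rewrite -(cvg_shiftS (fun n => n%:R `^ (- b) * S n)) /=.
have lim : b^-1 * (3 * n.+1%:R^-1 + n.+1%:R `^ (- b)) @[n --> \oo] --> (0 : R).
  rewrite -[X in _ --> X](mulr0 b^-1); apply: cvgMr.
  rewrite -[X in _ --> X](addr0 0); apply: cvgD.
    by rewrite -[X in _ --> X](mulr0 3); apply: cvgMr; exact: cvg_harmonic.
  by rewrite (cvg_shiftS (fun n => n%:R `^ (- b) : R)); exact: powRN_cvg0.
apply: cvg_dist_le lim; exact: nearW.
Qed.

End powsum.

Definition dist (i j : nat) : nat := ((i - j) + (j - i))%N.

Lemma distC i j : dist i j = dist j i. Proof. by rewrite /dist addnC. Qed.
Lemma distnn i : dist i i = 0%N. Proof. by rewrite /dist subnn. Qed.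

(** Induction borders the matrix by a last row and a last column; each contributes the distances 1,
    ..., n once, next to one new diagonal entry. *)
Lemma sum_dist (R : comNzRingType) (g : nat -> R) n :
  \sum_(i < n) \sum_(j < n) g (dist i j) =
  n%:R * g 0%N + 2 * \sum_(k < n) (n%:R - k.+1%:R) * g k.+1.
Proof.
elim: n => [|n IH]; first by rewrite !big_ord0 mul0r mulr0 addr0.
rewrite big_ord_recr/=.
under eq_bigr do rewrite big_ord_recr/=.
rewrite big_split/= IH big_ord_recr/= distnn.
have S : \sum_(i < n) g (dist i n) = \sum_(k < n) g k.+1.
  rewrite (reindex_inj rev_ord_inj)/=; apply: eq_bigr => k _.
  by congr g; rewrite /dist; have := ltn_ord k; lia.
under [X in _ + (X + _)]eq_bigr do rewrite distC.
rewrite S big_ord_recr/= subrr mul0r addr0.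
under [X in _ = _ + 2 * X]eq_bigr do rewrite -natr1 [(n%:R + 1)%R]addrC -addrA mulrDl mul1r.
by rewrite big_split/= -natr1; ring.
Qed.

(** * Karamata-type estimates for correlations that vary regularly with index -D *)

Section karamata.
Context {R : realType}.
Variables (rho : nat -> R) (D : R).
Hypothesis D01 : 0 < D < 1.
Hypothesis reg : forall U eps : R, 1 < U -> 0 < eps < 1 ->
  exists N, (0 < N)%N /\ forall j k, (N <= j)%N -> (j <= k)%N -> k%:R <= U * j%:R ->
    `|rho k / rho j * (k%:R / j%:R) `^ D - 1| <= eps.
Hypothesis pos : \forall k \near \oo, 0 < rho k.

Let Db : 0 < D /\ D < 1. Proof. exact/andP. Qed.

Lemma reg_pos (U eps : R) : 1 < U -> 0 < eps < 1 ->
  exists N, [/\ (0 < N)%N, forall k, (N <= k)%N -> 0 < rho k &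
   forall j k, (N <= j)%N -> (j <= k)%N -> k%:R <= U * j%:R ->
    (1 - eps) * (rho j * j%:R `^ D) <= rho k * k%:R `^ D <= (1 + eps) * (rho j * j%:R `^ D)].
Proof.
move=> U1 e01; have [N [N0 NP]] := reg U1 e01; have [M _ MP] := pos.
exists (maxn N M); split; first by rewrite leq_max N0.
  by move=> k; rewrite geq_max => /andP[_]; exact: MP.
move=> j k; rewrite geq_max => /andP[Nj Mj] jk kU.
have := NP j k Nj jk kU.
have j0 : (0 < j)%N by exact: leq_trans Nj.
have rj : 0 < rho j by exact: MP.
have jD : 0 < j%:R `^ D :> R by rewrite powR_gt0// ltr0n.
have -> : rho k / rho j * (k%:R / j%:R) `^ D = (rho k * k%:R `^ D) / (rho j * j%:R `^ D).
  rewrite powRM ?invr_ge0// -(powR_inv1 (ler0n _ _)) -powRrM mulN1r powRN.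
  by field; rewrite !gt_eqF.
rewrite ler_norml lerBlDr lerBrDr => /andP[].
rewrite ler_pdivlMr ?mulr_gt0// ler_pdivrMr ?mulr_gt0// => h1 h2.
by apply/andP; split; lra.
Qed.

(** Rounded-up halving m of n, the step of the inductions below: n/m is at most 2, so [reg] applies
    with U = 2, and m/n is at most 3/4, which supplies the gain in powers. *)
Let half (n : nat) : (1 < n)%N -> [/\ (uphalf n < n)%N, (n <= 2 * uphalf n)%N & (4 * uphalf n <= 3 * n)%N].
Proof.
move=> n1; have := odd_double_half n; rewrite uphalf_half -muln2.
case: (odd n) => /= E; split; lia.
Qed.

(** Potter's bound, by halving n until n <= 2 k. Each halving loses at most a factor q through
    regular variation and gains (m/n)^(beta - D) <= q, so losses do not accumulate; only the final
    comparison costs 1/q. *)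
Lemma potter_up (beta : R) : D < beta -> exists N (C : R), [/\ (0 < N)%N, 0 < C,
  forall k, (N <= k)%N -> 0 < rho k &
  forall k n, (N <= k)%N -> (k <= n)%N -> rho k * k%:R `^ beta <= C * (rho n * n%:R `^ beta)].
Proof.
have [D0 D1] := Db.
move=> Dbe; pose q : R := (3 / 4) `^ (beta - D).
have q0 : 0 < q by rewrite powR_gt0.
have q1 : q < 1.
  have : (3 / 4) `^ (beta - D) < 1 `^ (beta - D) :> R by apply: gt0_ltr_powR; rewrite ?nnegrE; lra.
  by rewrite powR1.
have q01 : 0 < 1 - q < 1 by apply/andP; split; lra.
have two1 : 1 < 2 :> R by lra.
have [N [N0 NP Nreg]] := reg_pos two1 q01.
exists N, q^-1; split => //; first by rewrite invr_gt0.
have split_pow (n : nat) : (0 < n)%N -> n%:R `^ beta = n%:R `^ D * n%:R `^ (beta - D) :> R.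
  by move=> n0; rewrite -powRD; [congr (_ `^ _); ring|apply/implyP => _; rewrite pnatr_eq0 -lt0n].
move=> k n Nk; rewrite ler_pdivlMl//; elim/ltn_ind: n => n IH kn.
have k0 : (0 < k)%N by exact: leq_trans Nk.
have n0 : (0 < n)%N by exact: leq_trans kn.
have rk := NP k Nk; have rn := NP n (leq_trans Nk kn).
have [n2k|k2n] := leqP n (2 * k).
  have := Nreg k n Nk kn; rewrite -natrM ler_nat => /(_ n2k)/andP[h _].
  rewrite !split_pow// mulrA [leRHS]mulrA; apply: (@le_trans _ _ (rho n * n%:R `^ D * k%:R `^ (beta - D))).
    by rewrite !mulrA ler_wpM2r ?powR_ge0//; move: h; rewrite opprB addrC subrK mulrA.
  rewrite ler_wpM2l ?mulr_ge0 ?powR_ge0 ?(ltW rn)//.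
  by rewrite ge0_ler_powR ?nnegrE ?ler_nat//; lra.
have n1 : (1 < n)%N by move: k0 k2n; clear; lia.
have [h1 h2 h3] := half n1.
have km : (k <= uphalf n)%N by move: k2n h2; clear; lia.
have Nm := leq_trans Nk km; have rm := NP _ Nm.
apply: le_trans (IH _ h1 km) _.
have := Nreg (uphalf n) n Nm (ltnW h1); rewrite -natrM ler_nat => /(_ h2)/andP[h _].
have m0 : (0 < uphalf n)%N by exact: leq_trans km.
move: h; rewrite opprB addrC subrK => h.
rewrite !split_pow// mulrA [leRHS]mulrA.
apply: (@le_trans _ _ (q * (rho (uphalf n) * (uphalf n)%:R `^ D) * n%:R `^ (beta - D))).
  rewrite [leRHS](_ : _ = rho (uphalf n) * (uphalf n)%:R `^ D * (q * n%:R `^ (beta - D))); last ring.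
  apply: ler_wpM2l; first by rewrite mulr_ge0 ?powR_ge0 ?(ltW rm).
  rewrite /q -powRM//.
  apply: ge0_ler_powR; rewrite ?nnegrE ?mulr_ge0//; first lra.
  by rewrite mulrAC ler_pdivlMr// -!natrM ler_nat; move: h3; clear; lia.
by rewrite ler_wpM2r ?powR_ge0.
Qed.

(** The same halving with the opposite inequality: the growth of k^D rho(k) by a factor at most 1 +
    e = (4/3)^(D/2) is compensated by (m/n)^(D/2) <= (3/4)^(D/2). *)
Lemma rho_decay : exists N (M : R), [/\ (0 < N)%N, 0 <= M & forall n, (N <= n)%N -> 0 < rho n /\ rho n * n%:R `^ (D / 2) <= M].
Proof.
have [D0 D1] := Db.
pose e : R := (4 / 3) `^ (D / 2) - 1.
have e0 : 0 < e.
  have : 1 `^ (D / 2) < (4 / 3) `^ (D / 2) :> R by apply: gt0_ltr_powR; rewrite ?nnegrE; lra.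
  by rewrite powR1 subr_gt0.
have e1 : e < 1.
  have : (4 / 3) `^ (D / 2) <= 4 / 3 :> R by apply: ler1_powR; lra.
  by rewrite /e; lra.
have e01 : 0 < e < 1 by rewrite e0 e1.
have two1 : 1 < 2 :> R by lra.
have [N [N0 NP Nreg]] := reg_pos two1 e01.
(* [M] covers the indices up to 2 N, where the halving stops. *)
pose M := \sum_(i < (2 * N).+1) `|rho i| * i%:R `^ (D / 2).
exists N, M; split=> //; first by apply: sumr_ge0 => i _; rewrite mulr_ge0// powR_ge0.
have split_pow (n : nat) : (0 < n)%N -> n%:R `^ (D / 2) = n%:R `^ D * n%:R `^ (- (D / 2)) :> R.
  by move=> n0; rewrite -powRD; [congr (_ `^ _); field|apply/implyP => _; rewrite pnatr_eq0 -lt0n].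
move=> n; elim/ltn_ind: n => n IH Nn; split; first exact: NP.
have n0 : (0 < n)%N by exact: leq_trans Nn.
have rn := NP n Nn.
have [n2N|Nn2] := leqP n (2 * N).
  rewrite /M (bigD1 (Ordinal (_ : n < (2 * N).+1)%N))//= (gtr0_norm rn) lerDl.
  by apply: sumr_ge0 => i _; rewrite mulr_ge0// powR_ge0.
have n1 : (1 < n)%N by move: N0 Nn2; clear; lia.
have [h1 h2 h3] := half n1.
have Nm : (N <= uphalf n)%N by move: Nn2 h2; clear; lia.
have [rm IHm] := IH _ h1 Nm; apply: le_trans IHm.
have := Nreg (uphalf n) n Nm (ltnW h1); rewrite -natrM ler_nat => /(_ h2)/andP[_ h].
have m0 : (0 < uphalf n)%N by exact: leq_trans Nm.
rewrite !split_pow// mulrA [leRHS]mulrA.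
apply: le_trans (ler_wpM2r (powR_ge0 _ _) h) _.
rewrite (_ : 1 + e = (4 / 3) `^ (D / 2)); last by rewrite /e addrC subrK.
rewrite mulrAC [leRHS]mulrC ler_wpM2r ?mulr_ge0 ?powR_ge0 ?(ltW rm)//.
rewrite !powRN ler_pdivrMr ?powR_gt0 ?ltr0n// [leRHS]mulrC ler_pdivlMr ?powR_gt0 ?ltr0n//.
rewrite -powRM//.
apply: ge0_ler_powR; rewrite ?nnegrE ?mulr_ge0//; first lra.
by rewrite mulrAC ler_pdivrMr// -!natrM ler_nat; move: h3; clear; lia.
Qed.

Lemma rho_cvg0 : rho @ \oo --> (0 : R).
Proof.
have [D0 D1] := Db.
have [N [M [N0 M0 NP]]] := rho_decay.
have D2 : 0 < D / 2 by lra.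
have lim : M * n%:R `^ (- (D / 2)) @[n --> \oo] --> (0 : R).
  by rewrite -[X in _ --> X](mulr0 M); apply: cvgMr; exact: powRN_cvg0.
apply: cvg_dist_le lim; exists N => // n /= Nn; have [rn h] := NP n Nn.
rewrite subr0 gtr0_norm// powRN ler_pdivlMr// powR_gt0// ltr0n.
exact: leq_trans Nn.
Qed.

(** An exponent strictly between D, as Potter's bound requires, and 1, so that the averages of
    (k/n)^(-be) stay bounded. *)
Let be := (1 + D) / 2.
Let be01 : 0 < be < 1. Proof. by have [D0 D1] := Db; rewrite /be; apply/andP; split; lra. Qed.
Let be1 : 0 < 1 - be. Proof. by have [D0 D1] := Db; rewrite /be; lra. Qed.

(** Potter's bound from the fixed index N gives n rho(n) >= c n^(1 - be). This is long memory: the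
    diagonal and any finite number of lags are negligible against n^2 rho(n). *)
Lemma n_rho_cvgy : n%:R * rho n @[n --> \oo] --> +oo.
Proof.
have [D0 D1] := Db.
have Dbe' : D < be by rewrite /be; lra.
have be0 : 0 < be by rewrite /be; lra.
have be1' := be1.
have [N [C [N0 C0 NP Npot]]] := potter_up Dbe'.
have c0 : 0 < rho N * N%:R `^ be / C by rewrite divr_gt0// mulr_gt0 ?powR_gt0 ?ltr0n ?NP.
apply: (@ger_cvgy _ _ _ R (fun n => (rho N * N%:R `^ be / C) * n%:R `^ (1 - be))); last first.
  apply/cvgryPge => A.
  have /cvgryPge/(_ (A / (rho N * N%:R `^ be / C))) := powR_cvgy be1'.
  by apply: filterS => n; rewrite ler_pdivrMr// mulrC.
exists N => // n /= Nn; have n0 : (0 < n)%N by exact: leq_trans Nn.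
have h := Npot N n (leqnn _) Nn.
rewrite mulrAC ler_pdivrMr//.
apply: le_trans (ler_wpM2r (powR_ge0 _ _) h) _.
rewrite -!mulrA -powRD; last by apply/implyP => _; rewrite pnatr_eq0 -lt0n.
rewrite (_ : be + (1 - be) = 1); last by ring.
by rewrite powRr1// le_eqVlt; apply/orP; left; apply/eqP; ring.
Qed.

(** The L^1 distance on the grid k/n between the rescaled correlations and the power x^(-D); it
    controls sums of correlations with bounded weights. *)
Definition rho_dev n : R := n%:R^-1 * \sum_(k < n) `|rho k.+1 / rho n - (k.+1%:R / n%:R) `^ (- D)|.

(** Three ranges of k. Below N nothing is known, but a fixed sum is divided by n rho(n). Up to eta
    n, Potter's bound makes both parts integrable near 0. Beyond eta n the ratio n/k is bounded and
    regular variation is uniform. Each range contributes at most e/3. *)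
Lemma rho_dev_cvg0 : rho_dev n @[n --> \oo] --> (0 : R).
Proof.
have [D0 D1] := Db.
have Dbe' : D < be by rewrite /be; lra.
have be0 : 0 < be by rewrite /be; lra.
have be1' := be1.
have [N [C [N0 C0 NP Npot]]] := potter_up Dbe'.
have C1 : 0 < C + 1 by rewrite addr_gt0.
apply/cvgrPdist_le => e e0.
(* [t] will be eta^(1 - be), so the singularity has mass t/(1 - be) on [0, eta]; the bound on [t]
   gives (C + 1) t/(1 - be) <= e/3. *)
pose t : R := Num.min 2^-1 (e * (1 - be) / (3 * (C + 1))).
have t0 : 0 < t by rewrite lt_min invr_gt0 ltr0n/= divr_gt0 ?mulr_gt0//; lra.
have t2 : t <= 2^-1 by rewrite ge_min lexx.
have t3 : t <= e * (1 - be) / (3 * (C + 1)) by rewrite ge_min lexx orbT.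
pose eta : R := t `^ (1 - be)^-1.
have eta0 : 0 < eta by rewrite powR_gt0.
have etaE : eta `^ (1 - be) = t by rewrite /eta -powRrM mulVf ?gt_eqF// powRr1// ltW.
have eta1 : eta < 1.
  rewrite ltNge; apply/negP => h.
  have : 1 `^ (1 - be) <= eta `^ (1 - be) by rewrite ge0_ler_powR ?nnegrE ?(ltW be1) ?(ltW eta0).
  by rewrite powR1 etaE; lra.
(* The last range contributes 2 eps/(1 - be) <= e/3. *)
pose eps : R := Num.min 2^-1 (e * (1 - be) / 6).
have eps0 : 0 < eps by rewrite lt_min invr_gt0 ltr0n/= divr_gt0 ?mulr_gt0.
have eps2 : eps <= 2^-1 by rewrite ge_min lexx.
have eps3 : eps <= e * (1 - be) / 6 by rewrite ge_min lexx orbT.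
have etaV : 1 < eta^-1 by rewrite invf_gt1.
have eps01 : 0 < eps < 1 by apply/andP; split; lra.
have [N' [N'0 N'P Nreg]] := reg_pos etaV eps01.
pose M0 : R := \sum_(k < N) `|rho k.+1|.
have M00 : 0 <= M0 by apply: sumr_ge0.
have near1 : \forall n \near \oo, 3 * M0 / e <= n%:R * rho n by move/cvgryPge: n_rho_cvgy => /(_ (3 * M0 / e)).
have near2 : \forall n \near \oo, N'%:R / eta <= n%:R :> R by exact: nbhs_infty_ger.
have near3 : \forall n \near \oo, (N <= n)%N by exists N.
near=> n.
have hn1 : 3 * M0 / e <= n%:R * rho n by near: n.
have hn2 : N'%:R / eta <= n%:R :> R by near: n.
have Nn : (N <= n)%N by near: n.
have n0 : (0 < n)%N by exact: leq_trans Nn.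
have n0' : 0 < n%:R :> R by rewrite ltr0n.
have rn := NP n Nn.
have nn0 : 0 < n%:R * rho n by exact: mulr_gt0.
rewrite sub0r normrN ger0_norm; last first.
  by rewrite /rho_dev mulr_ge0 ?invr_ge0// sumr_ge0.
have ratio k : (k.+1%:R / n%:R) `^ (- be) = n%:R `^ be * k.+1%:R `^ (- be) :> R.
  by rewrite powRM ?invr_ge0// -(powR_inv1 (ler0n _ _)) -powRrM mulrNN mul1r mulrC.
have term (k : 'I_n) : `|rho k.+1 / rho n - (k.+1%:R / n%:R) `^ (- D)| <=
   (if (k < N)%N then `|rho k.+1| / rho n else 0) +
   ((if k.+1%:R <= eta * n%:R then (C + 1) * (n%:R `^ be * k.+1%:R `^ (- be)) else 0) +
    2 * eps * (n%:R `^ be * k.+1%:R `^ (- be))).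
  have kn1 : k.+1%:R / n%:R <= 1 :> R by rewrite ler_pdivrMr// mul1r ler_nat ltn_ord.
  have kn0 : 0 < k.+1%:R / n%:R :> R by rewrite divr_gt0.
  have Dbe : (k.+1%:R / n%:R) `^ (- D) <= (k.+1%:R / n%:R) `^ (- be) :> R.
    by apply: ger_powR; [rewrite kn0|rewrite /be; lra].
  have q0 : 0 <= n%:R `^ be * k.+1%:R `^ (- be) :> R by rewrite mulr_ge0 ?powR_ge0.
  case: (leP (k.+1%:R : R) (eta * n%:R)) => keta.
    apply: le_trans (ler_normB _ _) _.
    rewrite normrM normfV (gtr0_norm rn) (ger0_norm (powR_ge0 _ _)).
    have h1 : `|rho k.+1| / rho n <= (if (k < N)%N then `|rho k.+1| / rho n else 0) + C * (n%:R `^ be * k.+1%:R `^ (- be)).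
      case: ifPn => [_|]; first by rewrite lerDl mulr_ge0// ltW.
      rewrite -leqNgt => Nk; rewrite add0r (gtr0_norm (NP _ (leqW Nk))) ler_pdivrMr//.
      have := Npot k.+1 n (leqW Nk) (ltn_ord k).
      have kb : 0 < k.+1%:R `^ be :> R by rewrite powR_gt0.
      by rewrite -ler_pdivlMr// powRN => h; apply: le_trans h _; rewrite le_eqVlt; apply/orP; left; apply/eqP; ring.
    have h2 : (k.+1%:R / n%:R) `^ (- D) <= n%:R `^ be * k.+1%:R `^ (- be) :> R by rewrite -ratio.
    have h3 : 0 <= 2 * eps * (n%:R `^ be * k.+1%:R `^ (- be)) by rewrite !mulr_ge0 ?powR_ge0// ltW.
    by move: h1 h2 h3; clear; move=> *; lra.
  rewrite add0r.
  have N'k : (N' <= k.+1)%N.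
    rewrite -(ler_nat R); move: hn2; rewrite ler_pdivrMr// mulrC => hn2.
    by apply: le_trans hn2 _; exact: ltW.
  have kU : n%:R <= eta^-1 * k.+1%:R by rewrite ler_pdivlMl// ltW.
  have /andP[r1 r2] := Nreg k.+1 n N'k (ltn_ord k) kU.
  have h1 : 0 <= (if (k < N)%N then `|rho k.+1| / rho n else 0).
    by case: ifP => // _; rewrite divr_ge0// ltW.
  rewrite -[leLHS]add0r lerD//.
  have rk := N'P _ N'k.
  have kD : 0 < k.+1%:R `^ D :> R by rewrite powR_gt0.
  have nD : 0 < n%:R `^ D :> R by rewrite powR_gt0.
  (* [Nreg] bounds the values at n by those at k, whereas the inverse ratio is needed; inverting
     costs a factor 2 since eps <= 1/2. *)
  have E1 : rho k.+1 / rho n = (rho k.+1 * k.+1%:R `^ D) / (rho n * n%:R `^ D) * (k.+1%:R / n%:R) `^ (- D).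
    rewrite powRM ?invr_ge0// -(powR_inv1 (ler0n _ n)) -powRrM mulrNN mul1r powRN.
    by field; rewrite !gt_eqF.
  apply: (@le_trans _ _ (2 * eps * (k.+1%:R / n%:R) `^ (- D))); last first.
    by rewrite -ratio ler_wpM2l// mulr_ge0// ltW.
  rewrite {1}E1 -{2}(mul1r (_ `^ (- D))) -mulrBl normrM (ger0_norm (powR_ge0 _ _)).
  rewrite ler_wpM2r ?powR_ge0//.
  have A0 : 0 < rho k.+1 * k.+1%:R `^ D by exact: mulr_gt0.
  have B0 : 0 < rho n * n%:R `^ D by exact: mulr_gt0.
  move: (rho k.+1 * k.+1%:R `^ D) (rho n * n%:R `^ D) A0 B0 r1 r2 => a b a0 b0 r1 r2.
  have -> : a / b - 1 = (a - b) / b by field; rewrite gt_eqF.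
  rewrite normrM normfV (gtr0_norm b0) ler_pdivrMr// ler_norml.
  by move: eps0 eps2 a0 b0 r1 r2; clear; move=> *; apply/andP; split; nra.
have S1 : \sum_(k < n) (if (k < N)%N then `|rho k.+1| / rho n else 0) <= M0 / rho n.
  rewrite -big_mkcond/= -mulr_suml ler_wpM2r ?invr_ge0 ?(ltW rn)//.
  by rewrite (big_ord_narrow (F := fun k => `|rho k.+1|) Nn).
have S2 : \sum_(k < n) (if k.+1%:R <= eta * n%:R then (C + 1) * (n%:R `^ be * k.+1%:R `^ (- be)) else 0) <= n%:R * (e / 3).
  rewrite -big_mkcond/= -mulr_sumr -mulr_sumr.
  have h := sum_powR_le n be01 (mulr_ge0 (ltW eta0) (ltW n0')).
  apply: (@le_trans _ _ ((C + 1) * (n%:R `^ be * ((eta * n%:R) `^ (1 - be) / (1 - be))))).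
    by apply: ler_wpM2l; [exact: ltW|apply: ler_wpM2l => //; exact: powR_ge0].
  rewrite powRM ?(ltW eta0)// ?(ltW n0')// etaE.
  have E : n%:R `^ be * n%:R `^ (1 - be) = n%:R :> R.
    rewrite -powRD; last by apply/implyP => _; rewrite gt_eqF.
    by rewrite (_ : be + (1 - be) = 1) ?powRr1//; ring.
  rewrite [leLHS](_ : _ = (n%:R `^ be * n%:R `^ (1 - be)) * ((C + 1) * t / (1 - be))); last by field; rewrite gt_eqF.
  rewrite E ler_wpM2l// ?(ltW n0')// ler_pdivrMr// mulrC -ler_pdivlMr//.
  by apply: le_trans t3 _; rewrite le_eqVlt; apply/orP; left; apply/eqP; field; exact: lt0r_neq0.
have S3 : \sum_(k < n) (2 * eps * (n%:R `^ be * k.+1%:R `^ (- be))) <= n%:R * (e / 3).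
  rewrite -mulr_sumr -mulr_sumr.
  have h := sum_powR_le_nat n be01.
  apply: (@le_trans _ _ (2 * eps * (n%:R `^ be * (n%:R `^ (1 - be) / (1 - be))))).
    by apply: ler_wpM2l; [by rewrite mulr_ge0// ltW|apply: ler_wpM2l => //; exact: powR_ge0].
  have E : n%:R `^ be * n%:R `^ (1 - be) = n%:R :> R.
    rewrite -powRD; last by apply/implyP => _; rewrite gt_eqF.
    by rewrite (_ : be + (1 - be) = 1) ?powRr1//; ring.
  rewrite [leLHS](_ : _ = (n%:R `^ be * n%:R `^ (1 - be)) * (2 * eps / (1 - be))); last by field; rewrite gt_eqF.
  rewrite E ler_wpM2l ?(ltW n0')// ler_pdivrMr//.
  by rewrite [leRHS](_ : _ = 2 * (e * (1 - be) / 6)); [rewrite ler_pM2l|field].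
rewrite /rho_dev ler_pdivrMl//.
apply: le_trans (ler_sum _ (fun k _ => term k)) _.
rewrite big_split big_split/=.
have S4 : M0 / rho n <= n%:R * (e / 3).
  rewrite ler_pdivrMr// [leRHS](_ : _ = n%:R * rho n * e / 3); last by field.
  by rewrite ler_pdivlMr// mulrC -ler_pdivrMr.
by move: S1 S2 S3 S4; clear; move=> *; lra.
Unshelve. all: by end_near. Qed.

Lemma rho_gt0 : \forall n \near \oo, (0 < n)%N /\ 0 < rho n.
Proof. by near=> n; split; near: n; [exists 1%N|exact: pos]. Unshelve. all: by end_near. Qed.

Lemma n_rhoV_cvg0 : (n%:R * rho n)^-1 @[n --> \oo] --> (0 : R).
Proof.
apply/gtr0_cvgV0; last exact: n_rho_cvgy.
by apply: filterS rho_gt0 => n [n0 rn]; rewrite mulr_gt0// ltr0n.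
Qed.

Lemma sum_rpowD_cvg : n%:R^-1 * (\sum_(k < n) (k.+1%:R / n%:R) `^ (- D)) @[n --> \oo] --> (1 - D)^-1.
Proof.
have [D0 D1] := Db.
have b : 0 < 1 - D < 2 by apply/andP; split; lra.
apply: cvg_trans (sum_powR_cvg b); apply: near_eq_cvg.
near=> n; have n0 : 0 < n%:R :> R by rewrite ltr0n; near: n; exists 1%N.
rewrite !mulr_sumr; apply: eq_bigr => k _.
rewrite powRM ?invr_ge0// -(powR_inv1 (ler0n _ n)) -powRrM mulrNN mul1r.
rewrite (_ : 1 - D - 1 = - D); last ring.
rewrite (_ : n%:R `^ (- (1 - D)) = n%:R `^ (-1) * n%:R `^ D); first by ring.
rewrite -powRD; last by apply/implyP => _; rewrite gt_eqF.
by congr (_ `^ _); ring.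
Unshelve. all: by end_near. Qed.

Lemma sum_rpowD1_cvg : n%:R^-1 * (\sum_(k < n) (k.+1%:R / n%:R) `^ (1 - D)) @[n --> \oo] --> (2 - D)^-1.
Proof.
have [D0 D1] := Db.
have b : 0 < 2 - D < 2 by apply/andP; split; lra.
apply: cvg_trans (sum_powR_cvg b); apply: near_eq_cvg.
near=> n; have n0 : 0 < n%:R :> R by rewrite ltr0n; near: n; exists 1%N.
rewrite !mulr_sumr; apply: eq_bigr => k _.
rewrite powRM ?invr_ge0// -{2}(powR_inv1 (ler0n _ n)) -powRrM.
rewrite (_ : 2 - D - 1 = 1 - D); last ring.
rewrite (_ : n%:R `^ (- (2 - D)) = n%:R^-1 * n%:R `^ (-1 * (1 - D))); first by ring.
rewrite -(powR_inv1 (ler0n _ n)) -powRD; last by apply/implyP => _; rewrite gt_eqF.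
by congr (_ `^ _); ring.
Unshelve. all: by end_near. Qed.

Lemma rho_mean_bound : exists C : R, 0 < C /\
  \forall n \near \oo, \sum_(k < n) `|rho k.+1| <= C * (n%:R * rho n).
Proof.
have [D0 D1] := Db.
have l0 : 0 < (1 - D)^-1 by rewrite invr_gt0; lra.
exists ((1 - D)^-1 + 2); split; first lra.
near=> n.
have [n0 rn] : (0 < n)%N /\ 0 < rho n by near: n; exact: rho_gt0.
have n0' : 0 < n%:R :> R by rewrite ltr0n.
have h1 : rho_dev n <= 1.
  near: n; have /cvgr_le := rho_dev_cvg0; apply; lra.
have h2 : n%:R^-1 * (\sum_(k < n) (k.+1%:R / n%:R) `^ (- D)) <= (1 - D)^-1 + 1.
  near: n; have /cvgr_le := sum_rpowD_cvg; apply; lra.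
have h3 : n%:R^-1 * (\sum_(k < n) `|rho k.+1| / rho n) <= (1 - D)^-1 + 2.
  apply: (@le_trans _ _ (rho_dev n + n%:R^-1 * (\sum_(k < n) (k.+1%:R / n%:R) `^ (- D)))); last lra.
  rewrite /rho_dev -mulrDr ler_pM2l ?invr_gt0// -big_split/=; apply: ler_sum => k _.
  rewrite -{1}(gtr0_norm rn) -normfV -normrM.
  rewrite -{2}(ger0_norm (powR_ge0 (k.+1%:R / n%:R) (- D))) -{1}(subrK ((k.+1%:R / n%:R) `^ (- D)) (rho k.+1 / rho n)).
  exact: ler_normD.
move: h3; rewrite -mulr_suml ler_pdivrMl// ler_pdivrMr// => h3; apply: le_trans h3 _.
by rewrite le_eqVlt; apply/orP; left; apply/eqP; ring.
Unshelve. all: by end_near. Qed.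

(** Grouped by distance, the sum is a Riemann sum for 2 int_0^1 (1 - x) x^(-D) dx = 2 (1/(1 - D) -
    1/(2 - D)). The diagonal carries rho(0)/(n rho(n)) -> 0, and the weights 1 - k/n lie in [0, 1],
    so [rho_dev] controls the error. *)
Lemma rho_sum_cvg :
  (n%:R ^+ 2 * rho n)^-1 * \sum_(i < n) \sum_(j < n) rho (dist i j) @[n --> \oo] -->
  2 / ((1 - D) * (2 - D)).
Proof.
have [D0 D1] := Db.
pose q n (k : nat) : R := k.+1%:R / n%:R.
pose G n : R := (n%:R * rho n)^-1 * rho 0%N + 2 * (n%:R^-1 * (\sum_(k < n) (q n k) `^ (- D)) - n%:R^-1 * (\sum_(k < n) (q n k) `^ (1 - D))).
pose A n : R := n%:R^-1 * \sum_(k < n) (1 - q n k) * (rho k.+1 / rho n - (q n k) `^ (- D)).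
have A0 : A n @[n --> \oo] --> (0 : R).
  apply: (cvg_dist_le _ rho_dev_cvg0); near=> n.
  have [n0 rn] : (0 < n)%N /\ 0 < rho n by near: n; exact: rho_gt0.
  have n0' : 0 < n%:R :> R by rewrite ltr0n.
  rewrite subr0 /A /rho_dev normrM ger0_norm ?invr_ge0// ler_pM2l ?invr_gt0//.
  apply: le_trans (ler_norm_sum _ _ _) _; apply: ler_sum => k _; rewrite normrM.
  rewrite ler_piMl// ger0_norm; first by rewrite gerBl divr_ge0.
  by rewrite subr_ge0 /q ler_pdivrMr// mul1r ler_nat.
have G0 : G n @[n --> \oo] --> 0 * rho 0%N + 2 * ((1 - D)^-1 - (2 - D)^-1).
  apply: cvgD; first by apply: cvgMl; exact: n_rhoV_cvg0.
  apply: cvgMr; apply: cvgB; [exact: sum_rpowD_cvg|exact: sum_rpowD1_cvg].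
have -> : 2 / ((1 - D) * (2 - D)) = (0 * rho 0%N + 2 * ((1 - D)^-1 - (2 - D)^-1)) + 2 * 0.
  by field; apply/andP; split; lra.
have GA : G n + 2 * A n @[n --> \oo] --> (0 * rho 0%N + 2 * ((1 - D)^-1 - (2 - D)^-1)) + 2 * 0.
  by apply: cvgD => //; exact: cvgMr.
apply: cvg_trans GA; apply: near_eq_cvg; near=> n.
have [n0 rn] : (0 < n)%N /\ 0 < rho n by near: n; exact: rho_gt0.
have n0' : 0 < n%:R :> R by rewrite ltr0n.
rewrite /G /A /= sum_dist.
have -> : \sum_(k < n) (n%:R - k.+1%:R) * rho k.+1 = n%:R * rho n * \sum_(k < n) (1 - q n k) * (rho k.+1 / rho n).
  by rewrite mulr_sumr; apply: eq_bigr => k _; rewrite /q; field; rewrite !gt_eqF.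
have -> : \sum_(k < n) (1 - q n k) * (rho k.+1 / rho n - q n k `^ (- D)) =
   \sum_(k < n) (1 - q n k) * (rho k.+1 / rho n) - (\sum_(k < n) q n k `^ (- D) - \sum_(k < n) q n k `^ (1 - D)).
  rewrite -!sumrB; apply: eq_bigr => k _.
  have q0 : 0 < q n k by rewrite divr_gt0.
  rewrite (powRD (x := q n k) (r := 1) (s := - D)); last by apply/implyP => _; rewrite gt_eqF.
  by rewrite powRr1 ?(ltW q0)//; ring.
by field; rewrite !gt_eqF.
Unshelve. all: by end_near. Qed.

Lemma rho_abs_sum_bound : exists C : R, 0 < C /\
  \forall n \near \oo, \sum_(i < n) \sum_(j < n) `|rho (dist i j)| <= C * (n%:R ^+ 2 * rho n).
Proof.
have [C [C0 CP]] := rho_mean_bound.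
exists (`|rho 0%N| + 2 * C); split; first by rewrite ltr_wpDl// mulr_gt0.
near=> n.
have [n0 rn] : (0 < n)%N /\ 0 < rho n by near: n; exact: rho_gt0.
have n0' : 0 < n%:R :> R by rewrite ltr0n.
have h1 : 1 <= n%:R * rho n.
  by near: n; move/cvgryPge: n_rho_cvgy; apply.
have h2 : \sum_(k < n) `|rho k.+1| <= C * (n%:R * rho n) by near: n.
rewrite (sum_dist (fun k => `|rho k|)).
have h3 : \sum_(k < n) (n%:R - k.+1%:R) * `|rho k.+1| <= n%:R * (C * (n%:R * rho n)).
  apply: le_trans (ler_wpM2l (ltW n0') h2); rewrite mulr_sumr; apply: ler_sum => k _.
  by rewrite ler_wpM2r// gerBl.
have h4 : n%:R * `|rho 0%N| * 1 <= n%:R * `|rho 0%N| * (n%:R * rho n) by rewrite ler_wpM2l// mulr_ge0.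
rewrite mulr1 in h4.
apply: (le_trans (lerD h4 (ler_wpM2l (ler0n _ 2) h3))).
by rewrite le_eqVlt; apply/orP; left; apply/eqP; ring.
Unshelve. all: by end_near. Qed.

(** Meant for rho^2, which bounds the variance of the residuals, and for the indicator of strongly
    correlated lags. *)
Lemma small_sum_cvg0 (g : nat -> R) :
  (forall e : R, 0 < e -> \forall k \near \oo, `|g k| <= e * `|rho k|) ->
  (n%:R ^+ 2 * rho n)^-1 * \sum_(i < n) \sum_(j < n) `|g (dist i j)| @[n --> \oo] --> (0 : R).
Proof.
move=> gP; have [C [C0 CP]] := rho_mean_bound.
apply/cvgrPdist_le => e e0.
have e1 : 0 < e / (4 * C) by rewrite divr_gt0// mulr_gt0.
have [N _ NP] := gP _ e1.
pose M : R := `|g 0%N| + 2 * \sum_(k < N) `|g k.+1|.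
have M0 : 0 <= M by rewrite addr_ge0// mulr_ge0// sumr_ge0.
near=> n.
have [n0 rn] : (0 < n)%N /\ 0 < rho n by near: n; exact: rho_gt0.
have n0' : 0 < n%:R :> R by rewrite ltr0n.
have nr0 : 0 < n%:R * rho n by exact: mulr_gt0.
have Nn : (N <= n)%N by near: n; exists N.
have h1 : M / (e / 2) <= n%:R * rho n.
  by near: n; move/cvgryPge: n_rho_cvgy; apply.
have h2 : \sum_(k < n) `|rho k.+1| <= C * (n%:R * rho n) by near: n.
rewrite sub0r normrN ger0_norm; last first.
  rewrite mulr_ge0 ?invr_ge0 ?(mulr_ge0 (sqr_ge0 _) (ltW rn))//.
  by apply: sumr_ge0 => i _; apply: sumr_ge0.
rewrite (sum_dist (fun k => `|g k|)) ler_pdivrMl; last by rewrite mulr_gt0// exprn_gt0.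
have h3 : \sum_(k < n) (n%:R - k.+1%:R) * `|g k.+1| <= n%:R * \sum_(k < n) `|g k.+1|.
  rewrite mulr_sumr; apply: ler_sum => k _.
  by rewrite ler_wpM2r// gerBl.
have h4 : \sum_(k < n) `|g k.+1| <= \sum_(k < N) `|g k.+1| + e / (4 * C) * \sum_(k < n) `|rho k.+1|.
  apply: (@le_trans _ _ (\sum_(k < n) ((if (k < N)%N then `|g k.+1| else 0) + e / (4 * C) * `|rho k.+1|))).
    apply: ler_sum => k _; case: ltnP => kN; first by rewrite lerDl mulr_ge0// ltW.
    by rewrite add0r; apply: NP; rewrite /= ltnW.
  rewrite big_split/= -mulr_sumr lerD2r -big_mkcond/=.
  by rewrite (big_ord_narrow (F := fun k => `|g k.+1|) Nn).
have h5 : e / (4 * C) * \sum_(k < n) `|rho k.+1| <= e / 4 * (n%:R * rho n).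
  apply: le_trans (ler_wpM2l (ltW e1) h2) _.
  by rewrite le_eqVlt; apply/orP; left; apply/eqP; field; rewrite gt_eqF.
have h6 : M <= n%:R * rho n * (e / 2) by rewrite -ler_pdivrMr// divr_gt0.
have h7 : n%:R * `|g 0%N| + 2 * \sum_(k < n) (n%:R - k.+1%:R) * `|g k.+1| <= n%:R * (M + 2 * (e / 4 * (n%:R * rho n))).
  rewrite /M; apply: (@le_trans _ _ (n%:R * `|g 0%N| + 2 * (n%:R * \sum_(k < n) `|g k.+1|))); first by rewrite lerD2l ler_pM2l.
  rewrite [leLHS](_ : _ = n%:R * (`|g 0%N| + 2 * \sum_(k < n) `|g k.+1|)); last ring.
  by rewrite ler_pM2l// -addrA -mulrDr lerD2l ler_pM2l//; apply: le_trans h4 _; rewrite lerD2l.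
apply: le_trans h7 _.
rewrite [leRHS](_ : _ = n%:R * (n%:R * rho n * e)); last ring.
rewrite ler_pM2l// [leRHS](_ : _ = n%:R * rho n * (e / 2) + 2 * (e / 4 * (n%:R * rho n))); last by field.
by rewrite lerD2r.
Unshelve. all: by end_near. Qed.

End karamata.

Lemma slowly_varying_reg (R : realType) (rho : nat -> R) (D : R) (L : R -> R) :
  (forall k, (1 <= k)%N -> rho k = k%:R `^ (- D) * L k%:R) -> slowly_varying L ->
  forall U eps : R, 1 < U -> 0 < eps < 1 ->
  exists N, (0 < N)%N /\ forall j k, (N <= j)%N -> (j <= k)%N -> k%:R <= U * j%:R ->
    `|rho k / rho j * (k%:R / j%:R) `^ D - 1| <= eps.
Proof.
move=> hrho sv U eps U1 e01.
have [x0 [x00 xP]] := slowly_varying_uniform sv U1 e01.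
have [N _ NP] : \forall n \near \oo, x0 <= n%:R by exact: nbhs_infty_ger.
exists (maxn N 1); split; first by rewrite leq_max orbT.
move=> j k; rewrite geq_max => /andP[Nj j0] jk kU.
have := xP j%:R k%:R (NP _ Nj).
have k0 : (0 < k)%N by exact: leq_trans jk.
have j0' : 0 < j%:R :> R by rewrite ltr0n.
have k0' : 0 < k%:R :> R by rewrite ltr0n.
rewrite !ler_nat jk/= kU => /(_ isT).
have jD : 0 < j%:R `^ D :> R by rewrite powR_gt0.
have kD : 0 < k%:R `^ D :> R by rewrite powR_gt0.
suff -> : rho k / rho j * (k%:R / j%:R) `^ D = L k%:R / L j%:R by [].
rewrite !hrho// powRM ?invr_ge0// -(powR_inv1 (ler0n _ j)) -powRrM mulN1r !powRN invfM invrK.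
set x := L k%:R; set y := (L j%:R)^-1.
by field; rewrite !gt_eqF.
Qed.

(** * Gaussian processes *)

Section gaussian_rv_facts.
Context d (T : measurableType d) (R : realType) (P : probability T R).
Local Notation gam := (@normal_prob R 0 1).

Lemma gauss_integrable_sqr_affine (s m : R) :
  gam.-integrable setT (EFin \o (fun x => (s * x + m) ^+ 2)).
Proof.
apply: (@gauss_integrable _ _ (2 * (s ^+ 2 + m ^+ 2))).
  by apply: measurable_funX; exact: measurable_affine.
move=> x; rewrite ger0_norm ?sqr_ge0//.
have h1 : 2 * (s * x) * m <= (s * x) ^+ 2 + m ^+ 2 by have := sqr_ge0 (s * x - m); nra.
have : (s * x + m) ^+ 2 <= 2 * (s ^+ 2 * x ^+ 2 + m ^+ 2) by nra.
move: (sqr_ge0 s) (sqr_ge0 m) (sqr_ge0 x).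
move: (s ^+ 2) (m ^+ 2) (x ^+ 2) => a b c a0 b0 c0 h.
apply: le_trans h _; rewrite -mulrA ler_pM2l//.
have c2 : 0 <= c ^+ 2 by exact: sqr_ge0.
have := mulr_ge0 a0 c0; have := mulr_ge0 b0 c0; have := mulr_ge0 a0 c2; have := mulr_ge0 b0 c2; nra.
Qed.

Lemma gauss_integrable_affine (s m : R) :
  gam.-integrable setT (EFin \o (fun x => s * x + m)).
Proof.
apply: (@gauss_integrable _ _ (`|s| + `|m|)); first exact: measurable_affine.
move=> x; apply: le_trans (ler_normD _ _) _; rewrite normrM.
rewrite -(real_normK (num_real x)); move: `|x| `|s| `|m| (normr_ge0 x) (normr_ge0 s) (normr_ge0 m) => c a b c0 a0 b0.
have h1 : c <= (1 + c ^+ 2) ^+ 2 by have := sqr_ge0 c; have := sqr_ge0 (c - 1); nra.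
have h2 : 1 <= (1 + c ^+ 2) ^+ 2 by have := sqr_ge0 c; nra.
by move: (_ ^+ 2) h1 h2 => z h1 h2; nra.
Qed.

Lemma gaussian_moments (X : {RV P >-> R}) (m v : R) : 0 <= v -> gaussian_rv X m v ->
  [/\ P.-integrable setT (EFin \o X), \int[P]_w X w = m,
      P.-integrable setT (EFin \o (fun w => X w ^+ 2)) &
      \int[P]_w (X w ^+ 2) = v + m ^+ 2].
Proof.
move=> v0 Xg; have vE : Num.sqrt v ^+ 2 = v by rewrite sqr_sqrtr.
have [i1 e1] := gaussian_integral v0 Xg (f := idfun) (@measurable_id _ _ _) (gauss_integrable_affine (Num.sqrt v) m).
have mX : measurable_fun [set: R] (fun x : R => x ^+ 2) by exact: measurable_funX.
have [i2 e2] := gaussian_integral v0 Xg mX (gauss_integrable_sqr_affine (Num.sqrt v) m).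
have ix : gam.-integrable setT (EFin \o (fun x : R => x)).
  have -> : (fun x : R => x) = (fun x => 1 * x + 0) by apply/funext => x; rewrite mul1r addr0.
  exact: gauss_integrable_affine.
have ix2 : gam.-integrable setT (EFin \o (fun x : R => x ^+ 2)).
  have -> : (fun x : R => x ^+ 2) = (fun x => (1 * x + 0) ^+ 2) by apply/funext => x; rewrite mul1r addr0.
  exact: gauss_integrable_sqr_affine.
split => //.
- rewrite e1 /= RintegralD//; last 2 first.
  + exact: integrable_scaleR.
  + by apply: (@gauss_integrable _ _ `|m|) => // x; rewrite ler_peMr//; have := sqr_ge0 x; nra.
  by rewrite RintegralZl// gauss_mean mulr0 add0r Rintegral_prob_cst.
- rewrite e2.
  have -> : \int[gam]_x ((Num.sqrt v * x + m) ^+ 2) = \int[gam]_x (v * x ^+ 2 + (2 * Num.sqrt v * m * x + m ^+ 2)).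
    by apply: eq_Rintegral => x _; rewrite -{2}vE; ring.
  have im : gam.-integrable setT (EFin \o (fun x : R => m ^+ 2)).
    by apply: (@gauss_integrable _ _ `|m ^+ 2|) => // x; rewrite ler_peMr//; have := sqr_ge0 x; nra.
  rewrite RintegralD//; last 2 first.
  + exact: integrable_scaleR.
  + by apply: integrable_addR => //; exact: integrable_scaleR.
  rewrite RintegralD//; last exact: integrable_scaleR.
  rewrite RintegralZl// RintegralZl//.
  by rewrite gauss_mean gauss_var mulr0 add0r mulr1 Rintegral_prob_cst.
Qed.

Lemma gaussian_char (X : {RV P >-> R}) (v s : R) : 0 <= v -> gaussian_rv X 0 v ->
  \int[P]_w cos (s * X w) = expR (- (s ^+ 2 * v / 2)) /\ \int[P]_w sin (s * X w) = 0.
Proof.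
move=> v0 Xg.
have mc : measurable_fun [set: R] (fun x : R => cos (s * x)) by apply: measurable_cosT; exact: measurable_funM.
have ms : measurable_fun [set: R] (fun x : R => sin (s * x)) by apply: measurable_sinT; exact: measurable_funM.
have ma := measurable_affine (Num.sqrt v) (0 : R).
split.
- have [_ ->] := gaussian_integral v0 Xg mc (@integrable_bounded _ _ _ gam _ 1 (measurableT_comp mc ma) (fun x => cos_max _)).
  under eq_Rintegral do rewrite addr0 mulrA.
  by rewrite gauss_cos exprMn sqr_sqrtr.
- have [_ ->] := gaussian_integral v0 Xg ms (@integrable_bounded _ _ _ gam _ 1 (measurableT_comp ms ma) (fun x => sin_max _)).
  under eq_Rintegral do rewrite addr0 mulrA.
  by rewrite gauss_sin.
Qed.

Lemma gaussian_rv_cdf (X : {RV P >-> R}) (v x : R) : 0 < v -> gaussian_rv X 0 v ->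
  cdf X x = (gcdf (x / Num.sqrt v))%:E.
Proof.
move=> v0 /(gaussian_rvP _ _ (ltW v0)) Xg.
have s0 : 0 < Num.sqrt v by rewrite sqrtr_gt0.
rewrite /cdf /distribution /pushforward Xg// -gamE; congr (gam _).
by apply/seteqP; split => y /=; rewrite !in_itv/= addr0 ler_pdivlMr// mulrC.
Qed.

Lemma sum_scale_mfunE n (c : 'I_n -> R) (X : nat -> {RV P >-> R}) w :
  (\sum_(i < n) scale_mfun (c i) (X i) : {RV P >-> R}) w = \sum_(i < n) c i * X i w.
Proof.
elim/big_ind2: _ => //; first by move=> x1 x2 y1 y2 <- <-.
by move=> i _; rewrite mulrC.
Qed.

Lemma integrable_prod_sqr (X Y : {RV P >-> R}) :
  P.-integrable setT (EFin \o (fun w => X w ^+ 2)) ->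
  P.-integrable setT (EFin \o (fun w => Y w ^+ 2)) ->
  P.-integrable setT (EFin \o (fun w => X w * Y w)).
Proof.
move=> iX iY; apply: (le_integrable _ _ _ (integrable_addR measurableT iX iY)) => //.
  by apply/measurable_EFinP; exact: measurable_funM.
move=> w _ /=; rewrite lee_fin normrM (ger0_norm (addr_ge0 (sqr_ge0 _) (sqr_ge0 _))).
rewrite -(real_normK (num_real (X w))) -(real_normK (num_real (Y w))).
by have := sqr_ge0 (`|X w| - `|Y w|); have := sqr_ge0 (`|X w|);have := sqr_ge0 (`|Y w|); nra.
Qed.

End gaussian_rv_facts.

Section process.
Context d (T : measurableType d) (R : realType) (P : probability T R).
Variables (X : nat -> {RV P >-> R}) (rho : nat -> R).
Hypotheses (Xg : gaussian_process X) (Xs : stationary X)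
  (Xm : forall i, ('E_P[X i] = 0)%E) (Xc : forall k, ('E_P[(X 0%N * X k)%R] = (rho k)%:E)%E).

Let Xfin i : exists m v : R, 0 <= v /\ gaussian_rv (X i) m v.
Proof.
have [m [v [v0 h]]] := Xg (fun j : 'I_i.+1 => (j == ord_max)%:R).
exists m, v; split=> // A mA; rewrite -h//; congr (P _); apply/funext => w /=.
rewrite /preimage/= sum_scale_mfunE (bigD1 ord_max)//= ?eqxx mul1r big1 ?addr0// => j /negPf ->.
by rewrite mul0r.
Qed.

Lemma process_int i : P.-integrable setT (EFin \o X i).
Proof. by have [m [v [v0 h]]] := Xfin i; have [] := gaussian_moments v0 h. Qed.

Lemma process_sqr_int i : P.-integrable setT (EFin \o (fun w => X i w ^+ 2)).
Proof. by have [m [v [v0 h]]] := Xfin i; have [] := gaussian_moments v0 h. Qed.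

Lemma process_prod_int i j : P.-integrable setT (EFin \o (fun w => X i w * X j w)).
Proof. by apply: integrable_prod_sqr; exact: process_sqr_int. Qed.

Lemma process_mean i : \int[P]_w X i w = 0.
Proof. by have := Xm i; rewrite unlock /Rintegral => ->. Qed.

Lemma process_cov0 k : \int[P]_w (X 0%N w * X k w) = rho k.
Proof. by have := Xc k; rewrite unlock /Rintegral => ->. Qed.

(** Stationarity is a statement about laws of vectors; applied to X_h + X_(h+k) it identifies
    Gaussian laws, hence second moments. Polarization then gives all covariances from those of pairs
    starting at index 0. *)
Let pair_sqr h k : \int[P]_w ((X h w + X (h + k)%N w) ^+ 2) = \int[P]_w ((X 0%N w + X k w) ^+ 2).
Proof.
have [m [v [v0 g0]]] := Xg (fun j : 'I_k.+1 => (j == ord0)%:R + (j == ord_max)%:R).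
pose S0 : {RV P >-> R} := X 0%N \+ X k.
pose Sh : {RV P >-> R} := X h \+ X (h + k)%N.
have G0 : gaussian_rv S0 m v.
  move=> A mA; rewrite -g0//; congr (P _); apply/funext => w /=.
  rewrite /preimage/= sum_scale_mfunE; congr A.
  under eq_bigr do rewrite mulrDl; rewrite big_split/=; congr (_ + _).
    by rewrite (bigD1 ord0)//= ?eqxx mul1r big1 ?addr0// => j /negPf ->; rewrite mul0r.
  by rewrite (bigD1 ord_max)//= ?eqxx mul1r big1 ?addr0// => j /negPf ->; rewrite mul0r.
have Gh : gaussian_rv Sh m v.
  move=> A mA; rewrite -G0// /distribution /pushforward.
  pose A' := [set t : k.+1.-tuple R | A (tnth t ord0 + tnth t ord_max)].
  have mA' : measurable A'.
    rewrite -[A']setTI; apply: (measurable_funD (measurable_tnth _) (measurable_tnth _)) => //.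
  have := Xs h mA'; rewrite /A'/= /preimage/=.
  under eq_set do rewrite !tnth_mktuple addn0.
  by under [in RHS]eq_set do rewrite !tnth_mktuple.
have [_ _ _ E0] := gaussian_moments v0 G0.
have [_ _ _ Eh] := gaussian_moments v0 Gh.
by rewrite [LHS]Eh -E0.
Qed.

Let sqrD_int i j : \int[P]_w ((X i w + X j w) ^+ 2) =
  \int[P]_w (X i w ^+ 2) + 2 * \int[P]_w (X i w * X j w) + \int[P]_w (X j w ^+ 2).
Proof.
have iS := process_sqr_int; have iP := process_prod_int.
rewrite -RintegralZl//.
rewrite -RintegralD//; last exact: integrable_scaleR.
rewrite -RintegralD//; last by apply: integrable_addR => //; exact: integrable_scaleR.
by apply: eq_Rintegral => w _; ring.
Qed.

Let var_eq h : \int[P]_w (X h w ^+ 2) = rho 0%N.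
Proof.
have := pair_sqr h 0; rewrite !sqrD_int addn0 process_cov0.
have -> : \int[P]_w (X h w * X h w) = \int[P]_w (X h w ^+ 2) by [].
by lra.
Qed.

Lemma process_cov i j : \int[P]_w (X i w * X j w) = rho (dist i j).
Proof.
have main h k : \int[P]_w (X h w * X (h + k)%N w) = rho k.
  by have := pair_sqr h k; rewrite !sqrD_int !var_eq process_cov0; lra.
have [ij|ji] := leqP i j.
  have -> : dist i j = (j - i)%N by rewrite /dist; lia.
  by rewrite -(main i) subnKC.
have -> : dist i j = (i - j)%N by rewrite /dist; lia.
rewrite -(main j) subnKC ?(ltnW ji)//.
by apply: eq_Rintegral => w _; rewrite mulrC.
Qed.

(** [gaussian_process] leaves the mean and variance of a combination unspecified; its first two
    moments identify them. Nonnegativity of the quadratic form comes along. *)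
Lemma process_law n (c : 'I_n -> R) :
  0 <= \sum_(i < n) \sum_(j < n) c i * c j * rho (dist i j) /\
  gaussian_rv (\sum_(i < n) scale_mfun (c i) (X i) : {RV P >-> R}) 0
    (\sum_(i < n) \sum_(j < n) c i * c j * rho (dist i j)).
Proof.
have [m [v [v0 h]]] := Xg c.
have [_ e1 _ e2] := gaussian_moments v0 h.
have ip i j : P.-integrable setT (EFin \o (fun w => c i * c j * (X i w * X j w))).
  by apply: integrable_scaleR => //; exact: process_prod_int.
have m0 : m = 0.
  rewrite -e1; under eq_Rintegral do rewrite sum_scale_mfunE.
  rewrite Rintegral_sum//; last by move=> i _; apply: integrable_scaleR => //; exact: process_int.
  rewrite big1// => i _; rewrite RintegralZl//; last exact: process_int.
  by rewrite process_mean mulr0.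
have vE : v = \sum_(i < n) \sum_(j < n) c i * c j * rho (dist i j).
  have -> : v = v + m ^+ 2 by rewrite m0 expr0n addr0.
  rewrite -e2.
  transitivity (\int[P]_w \sum_(i < n) \sum_(j < n) (c i * c j * (X i w * X j w))).
    apply: eq_Rintegral => w _; rewrite sum_scale_mfunE expr2 big_distrlr/=.
    by apply: eq_bigr => i _; apply: eq_bigr => j _; ring.
  rewrite Rintegral_sum//; last by move=> i _; apply: integrable_sumR => // j _.
  apply: eq_bigr => i _; rewrite Rintegral_sum//.
  apply: eq_bigr => j _; rewrite RintegralZl//; last exact: process_prod_int.
  by rewrite process_cov.
by move: v0 h; rewrite m0 -vE.
Qed.

Lemma process_char n (c : 'I_n -> R) :
  \int[P]_w cos (\sum_(i < n) c i * X i w) =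
    expR (- ((\sum_(i < n) \sum_(j < n) c i * c j * rho (dist i j)) / 2)) /\
  \int[P]_w sin (\sum_(i < n) c i * X i w) = 0.
Proof.
have [Q0 g] := process_law c; have [h1 h2] := gaussian_char 1 Q0 g.
split.
  move: h1; rewrite expr1n mul1r => <-.
  by apply: eq_Rintegral => w _; rewrite mul1r sum_scale_mfunE.
by rewrite -[RHS]h2; apply: eq_Rintegral => w _; rewrite mul1r sum_scale_mfunE.
Qed.

End process.

(** * Linearization of the U-process *)

Section pair_approximation.
Context {R : realType}.

(** The derivative at 0 of r |-> P((X_i + X_j)/2 <= r) for an uncorrelated pair, whose average has
    variance 1/2. Its value is 1/sqrt(pi). *)
Definition hl_slope : R := gpdf 0 * Num.sqrt 2.

(** The inverse standard deviation of the average of two standard normals with correlation [t]. *)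
Definition pair_scale (t : R) : R := Num.sqrt (2 / (1 + t)).

Lemma hl_slope_gt0 : 0 < hl_slope.
Proof. by rewrite mulr_gt0 ?gpdf_gt0// sqrtr_gt0. Qed.

Lemma sqrt2_bound : 1 <= Num.sqrt (2 : R) <= 2.
Proof.
have h : Num.sqrt (2 : R) ^+ 2 = 2 by rewrite sqr_sqrtr.
have h0 : 0 <= Num.sqrt (2 : R) by exact: sqrtr_ge0.
by apply/andP; split; nra.
Qed.

Lemma hl_slope_le2 : hl_slope <= 2.
Proof.
have /andP[h1 h2] := sqrt2_bound; have := gpdf_le1 (0 : R); have := gpdf_gt0 (0 : R).
by rewrite /hl_slope => g0 g1; nra.
Qed.

(** For s the scale, s^2 - 2 = - s^2 t and s^2 <= 4 because 1 + t >= 1/2; dividing by s + sqrt(2) >=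
    1 gives the last bound. *)
Lemma pair_scale_facts (t : R) : `|t| <= 2^-1 ->
  [/\ 0 < pair_scale t, pair_scale t <= 2, pair_scale t ^+ 2 * (1 + t) = 2 &
      `|pair_scale t - Num.sqrt 2| <= 4 * `|t|].
Proof.
move=> t2; have := t2; rewrite ler_norml => /andP[ta tb].
have t0 : 0 < 1 + t by lra.
have q0 : 0 < 2 / (1 + t) by rewrite divr_gt0.
have s2 : pair_scale t ^+ 2 * (1 + t) = 2.
  by rewrite /pair_scale sqr_sqrtr ?(ltW q0)// mulfVK// gt_eqF.
have s0 : 0 < pair_scale t by rewrite sqrtr_gt0.
have /andP[h1 _] := sqrt2_bound.
have h : Num.sqrt (2 : R) ^+ 2 = 2 by rewrite sqr_sqrtr.
have s4 : pair_scale t ^+ 2 <= 4 by nra.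
split => //; first by nra.
have main (s q : R) : s ^+ 2 * (1 + t) = 2 -> 0 < s -> 1 <= q -> q ^+ 2 = 2 -> s ^+ 2 <= 4 ->
    `|s - q| <= 4 * `|t|; last exact: main.
move=> {s2 s0 h1 h s4} s2 s0 q1 q2 s4.
have E : (s - q) * (s + q) = - (s ^+ 2 * t) by have : s ^+ 2 + s ^+ 2 * t = q ^+ 2; lra.
have : `|s - q| * (s + q) = s ^+ 2 * `|t|.
  have sq : 0 < s + q by lra.
  by rewrite -(gtr0_norm sq) -normrM E normrN normrM (ger0_norm (sqr_ge0 _)).
move: `|s - q| `|t| (normr_ge0 (s - q)) (normr_ge0 t) => a b a0 b0 E2.
have : a * 1 <= a * (s + q) by apply: ler_wpM2l => //; lra.
have : s ^+ 2 * b <= 4 * b by apply: ler_wpM2r.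
by lra.
Qed.

(** No linear term appears, since the density is stationary at 0. *)
Lemma gpdf_dist0 (p : R) : `|gpdf 0 - gpdf p| <= p ^+ 2.
Proof.
have g0 := gpdf_gt0 (0 : R); have g1 := gpdf_le1 (0 : R).
have E : gpdf p = gpdf 0 * expR (- (p ^+ 2 / 2)).
  by rewrite /gpdf expr0n/= mul0r oppr0 expR0 mulr1.
have h : 1 - p ^+ 2 / 2 <= expR (- (p ^+ 2 / 2)) by have := expR_ge1Dx (- (p ^+ 2 / 2)); lra.
have h1 : expR (- (p ^+ 2 / 2)) <= 1.
  have : expR (- (p ^+ 2 / 2)) <= expR 0 by rewrite ler_expR; have := sqr_ge0 p; lra.
  by rewrite expR0.
have p0 := sqr_ge0 p.
rewrite E -{1}(mulr1 (gpdf 0)) -mulrBr normrM (gtr0_norm g0) ger0_norm; last by lra.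
by move: (expR _) h h1 => e h h1; nra.
Qed.

Lemma good_pair_approx (t r x y : R) : `|t| <= 2^-1 -> `|r| <= 2^-1 ->
  `|((x + y) / 2 <= r)%R%:R - 2^-1 - hl_slope * (r - (x + y) / 2) -
     resid (pair_scale t * r) (pair_scale t * ((x + y) / 2))|
  <= 20 * (`|t| + r ^+ 2) * (1 + x ^+ 2 + y ^+ 2).
Proof.
move=> t2 r2; have [s0 s2 _ sd] := pair_scale_facts t2.
set s := pair_scale t; set xi := (x + y) / 2.
rewrite /resid ler_pM2l//.
have T := gcdf_taylor 0 (s * r); rewrite gcdf0 subr0 in T.
have G := gpdf_dist0 (s * r).
have xi_le : `|xi| <= 1 + x ^+ 2 + y ^+ 2.
  rewrite ler_norml /xi; have := sqr_ge0 (x - 1); have := sqr_ge0 (y - 1).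
  by have := sqr_ge0 (x + 1); have := sqr_ge0 (y + 1) => *; apply/andP; split; nra.
have M1 : 1 <= 1 + x ^+ 2 + y ^+ 2 by have := sqr_ge0 x; have := sqr_ge0 y; lra.
move: (1 + x ^+ 2 + y ^+ 2) xi_le M1 => M xi_le M1.
(* The indicators cancel. What remains is the Taylor error of [gcdf] at 0 and the change of [gpdf]
   between 0 and s r, both O(r^2), and the change of scale from s to sqrt(2), which is O(|t|). *)
have -> : (xi <= r)%R%:R - 2^-1 - hl_slope * (r - xi) -
    ((xi <= r)%R%:R - gcdf (s * r) + gpdf (s * r) * (s * xi)) =
  (gcdf (s * r) - 2^-1 - gpdf 0 * (s * r)) + (gpdf 0 - gpdf (s * r)) * (s * xi)
   + gpdf 0 * ((s - Num.sqrt 2) * (r - xi)) by rewrite /hl_slope; ring.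
have r0 := sqr_ge0 r.
have sr2 : (s * r) ^+ 2 <= 4 * r ^+ 2.
  rewrite exprMn ler_wpM2r//; have : s * s <= 2 * 2 by apply: ler_pM => //; exact: ltW.
  by rewrite expr2; lra.
have B2 : `|(gpdf 0 - gpdf (s * r)) * (s * xi)| <= 8 * (r ^+ 2 * M).
  rewrite normrM; apply: (@le_trans _ _ ((4 * r ^+ 2) * (2 * M))); last by lra.
  apply: ler_pM => //; first exact: le_trans G sr2.
  by rewrite normrM (gtr0_norm s0); apply: ler_pM => //; exact: ltW.
have B3 : `|gpdf 0 * ((s - Num.sqrt 2) * (r - xi))| <= 8 * (`|t| * M).
  have g0 := gpdf_gt0 (0 : R); have g1 := gpdf_le1 (0 : R).
  rewrite normrM (gtr0_norm g0); apply: (@le_trans _ _ (1 * `|(s - Num.sqrt 2) * (r - xi)|)).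
    by rewrite ler_wpM2r.
  rewrite mul1r normrM; apply: (@le_trans _ _ ((4 * `|t|) * (2 * M))); last by lra.
  apply: ler_pM => //; apply: le_trans (ler_normB _ _) _; lra.
have B1 : (s * r) ^+ 2 <= 4 * (r ^+ 2 * M).
  by apply: le_trans sr2 _; rewrite ler_pM2l// ler_peMr.
apply: le_trans (ler_normD _ _) _.
apply: (@le_trans _ _ ((4 * (r ^+ 2 * M) + 8 * (r ^+ 2 * M)) + 8 * (`|t| * M))).
  apply: lerD => //; apply: le_trans (ler_normD _ _) _; apply: lerD => //.
  exact: le_trans T B1.
have := mulr_ge0 r0 (le_trans ler01 M1); have := mulr_ge0 (normr_ge0 t) (le_trans ler01 M1).
by lra.
Qed.

Lemma bad_pair_approx (r x y : R) : `|r| <= 2^-1 ->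
  `|((x + y) / 2 <= r)%R%:R - 2^-1 - hl_slope * (r - (x + y) / 2)| <= 20 * (1 + x ^+ 2 + y ^+ 2).
Proof.
move=> r2.
have xi_le : `|(x + y) / 2| <= 1 + x ^+ 2 + y ^+ 2.
  rewrite ler_norml; have := sqr_ge0 (x - 1); have := sqr_ge0 (y - 1).
  by have := sqr_ge0 (x + 1); have := sqr_ge0 (y + 1) => *; apply/andP; split; nra.
have M1 : 1 <= 1 + x ^+ 2 + y ^+ 2 by have := sqr_ge0 x; have := sqr_ge0 y; lra.
move: (1 + x ^+ 2 + y ^+ 2) xi_le M1 => M xi_le M1.
apply: le_trans (ler_normB _ _) _.
have h1 : `|((x + y) / 2 <= r)%R%:R - 2^-1| <= 1 :> R.
  have bb (b : bool) : `|b%:R - 2^-1| <= 1 :> R.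
    by rewrite ler_norml; case: b => /=; apply/andP; split; lra.
  exact: bb.
have h2 : `|hl_slope * (r - (x + y) / 2)| <= 2 * (2 * M).
  rewrite normrM (gtr0_norm hl_slope_gt0); apply: ler_pM => //.
  - exact: ltW hl_slope_gt0.
  - exact: hl_slope_le2.
  - by apply: le_trans (ler_normB _ _) _; lra.
by lra.
Qed.

End pair_approximation.

Lemma sum_cst_ord (R : pzSemiRingType) n (x : R) : \sum_(i < n) x = n%:R * x.
Proof. by rewrite sumr_const card_ord mulr_natl. Qed.

(** Each index occurs in 2 (n - 1) ordered pairs, so the average of the pair means over i <> j is
    exactly the sample mean. *)
Lemma sum_offdiag (R : numFieldType) (x : nat -> R) n r :
  \sum_(i < n) \sum_(j < n | i != j) (r - (x i + x j) / 2) =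
  (n%:R - 1) * (n%:R * r - \sum_(i < n) x i).
Proof.
set S := \sum_(i < n) x i.
have inner (i : 'I_n) : \sum_(j < n | i != j) (r - (x i + x j) / 2) =
    (n%:R * r - S / 2 - r) + (1 - n%:R / 2) * x i.
  have : \sum_(j < n) (r - (x i + x j) / 2) = n%:R * r - (n%:R * x i + S) / 2.
    by rewrite sumrB sum_cst_ord -mulr_suml big_split/= sum_cst_ord.
  rewrite (bigD1 i)//= => h.
  rewrite (eq_bigl (fun j => j != i)); last by move=> j; rewrite eq_sym.
  by apply: (addrI (r - (x i + x i) / 2)); rewrite h; field.
under eq_bigr do rewrite inner.
rewrite big_split/= sum_cst_ord -mulr_sumr -/S.
by field.
Qed.

Section decomposition.
Context d (T : measurableType d) (R : realType) (P : probability T R).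
Variables (X : nat -> {RV P >-> R}) (rho : nat -> R).
Hypotheses (Xg : gaussian_process X) (Xs : stationary X)
  (Xm : forall i, ('E_P[X i] = 0)%E) (Xc : forall k, ('E_P[(X 0%N * X k)%R] = (rho k)%:E)%E).
Hypothesis rho0 : rho 0%N = 1.

Let good n (q : 'I_n * 'I_n) := (q.1 != q.2) && (`|rho (dist q.1 q.2)| <= 2^-1).
Let sc n (q : 'I_n * 'I_n) := pair_scale (rho (dist q.1 q.2)).
Let uu n (q : 'I_n * 'I_n) w : R := sc q * ((X q.1 w + X q.2 w) / 2).
(** The weights that express [uu] as a combination of the whole vector X_0, ..., X_(n-1), the form
    in which the Gaussian hypothesis applies. *)
Let coef n (q : 'I_n * 'I_n) (m : 'I_n) : R := sc q / 2 * ((m == q.1)%:R + (m == q.2)%:R).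

Let sum_delta n (q : 'I_n * 'I_n) (F : 'I_n -> R) :
  \sum_(m < n) coef q m * F m = sc q / 2 * (F q.1 + F q.2).
Proof.
have D (i : 'I_n) : \sum_(m < n) (m == i)%:R * F m = F i.
  by rewrite (bigD1 i)//= eqxx mul1r big1 ?addr0// => m /negPf ->; rewrite mul0r.
transitivity (sc q / 2 * (\sum_(m < n) (m == q.1)%:R * F m + \sum_(m < n) (m == q.2)%:R * F m)); last by rewrite !D.
rewrite -big_split/= mulr_sumr; apply: eq_bigr => m _.
by rewrite /coef; ring.
Qed.

Let uuE n (q : 'I_n * 'I_n) w : uu q w = \sum_(m < n) coef q m * X m w.
Proof. by rewrite (sum_delta q (fun m => X m w)) /uu; ring. Qed.

(** The covariance of two linear combinations of the process. *)
Let quad n (f g : 'I_n -> R) := \sum_(i < n) \sum_(j < n) f i * g j * rho (dist i j).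

Let quad_coef n (q q' : 'I_n * 'I_n) : quad (coef q) (coef q') = sc q * sc q' / 4 *
  (rho (dist q.1 q'.1) + rho (dist q.1 q'.2) + (rho (dist q.2 q'.1) + rho (dist q.2 q'.2))).
Proof.
transitivity (\sum_(i < n) coef q i * (\sum_(j < n) coef q' j * rho (dist i j))).
  by apply: eq_bigr => i _; rewrite mulr_sumr; apply: eq_bigr => j _; rewrite mulrA.
under eq_bigr do rewrite (sum_delta q' (fun j => rho (dist _ j))).
rewrite (sum_delta q (fun i => sc q' / 2 * (rho (dist i q'.1) + rho (dist i q'.2)))).
by field.
Qed.

Let quad_self n (q : 'I_n * 'I_n) : good q -> quad (coef q) (coef q) = 1.
Proof.
move=> /andP[_ h]; have [_ _ E _] := pair_scale_facts h.
rewrite quad_coef !distnn rho0 (distC q.2 q.1); move: E; rewrite -/(sc q); lra.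
Qed.

Let quad_comb n (f g : 'I_n -> R) a b :
  quad (fun m => a * f m + b * g m) (fun m => a * f m + b * g m) =
  a ^+ 2 * quad f f + 2 * a * b * quad f g + b ^+ 2 * quad g g.
Proof.
have S : quad g f = quad f g.
  by rewrite /quad exchange_big/=; apply: eq_bigr => i _; apply: eq_bigr => j _; rewrite distC (mulrC (g j)).
transitivity (a ^+ 2 * quad f f + a * b * quad f g + a * b * quad g f + b ^+ 2 * quad g g); last first.
  by rewrite S; ring.
rewrite /quad !mulr_sumr -!big_split/=; apply: eq_bigr => i _.
rewrite !mulr_sumr -!big_split/=; apply: eq_bigr => j _.
ring.
Qed.

(** Cauchy-Schwarz for two combinations of unit variance: the variances of their sum and of their
    difference are nonnegative. *)
Let quad_cor n (q q' : 'I_n * 'I_n) : good q -> good q' -> `|quad (coef q) (coef q')| <= 1.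
Proof.
move=> gq gq'.
have pos (b : R) : 0 <= 1 + 2 * b * quad (coef q) (coef q') + b ^+ 2.
  have [h _] := process_law Xg Xs Xm Xc (fun m => 1 * coef q m + b * coef q' m).
  by move: h; rewrite [X in 0 <= X -> _](quad_comb (coef q) (coef q') 1 b) !quad_self//; lra.
by have := pos 1; have := pos (-1); rewrite ler_norml => h1 h2; apply/andP; split; lra.
Qed.

Let pair_resid : exists2 C : R, 0 <= C & forall n (q q' : 'I_n * 'I_n) (a b : R), good q -> good q' -> `|b| <= 1 ->
  P.-integrable setT (EFin \o (fun w => resid a (uu q w) * resid b (uu q' w))) /\
  `|\int[P]_w (resid a (uu q w) * resid b (uu q' w))| <=
   C * (rho (dist q.1 q'.1) ^+ 2 + rho (dist q.1 q'.2) ^+ 2 + (rho (dist q.2 q'.1) ^+ 2 + rho (dist q.2 q'.2) ^+ 2)).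
Proof.
have [C C0 CP] := @resid_cov_le R.
(* Since [sc q * sc q' / 4 <= 1], the correlation of two averages is at most the sum of four values
   of rho in absolute value; the square of a sum of four is at most 4 times the sum of squares. *)
exists (4 * C); first by rewrite mulr_ge0.
move=> n q q' a b gq gq' b1.
pose U : {RV P >-> R} := \sum_(m < n) scale_mfun (coef q m) (X m).
pose V : {RV P >-> R} := \sum_(m < n) scale_mfun (coef q' m) (X m).
have UE w : U w = uu q w by rewrite uuE -sum_scale_mfunE.
have VE w : V w = uu q' w by rewrite uuE -sum_scale_mfunE.
have comb (x y : R) w : x * U w + y * V w = \sum_(m < n) (x * coef q m + y * coef q' m) * X m w.
  rewrite UE VE !uuE !mulr_sumr -big_split/=; apply: eq_bigr => m _; ring.
have [||||i1 i2] := CP _ _ P U V (quad (coef q) (coef q')) a b.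
- exact: quad_cor.
- exact: b1.
- move=> x y; under eq_Rintegral do rewrite comb.
  have [-> _] := process_char Xg Xs Xm Xc (fun m => x * coef q m + y * coef q' m).
  rewrite [X in expR (- (X / 2))](quad_comb (coef q) (coef q') x y) !quad_self//.
  by congr expR; ring.
- move=> x y; under eq_Rintegral do rewrite comb.
  by have [_ ->] := process_char Xg Xs Xm Xc (fun m => x * coef q m + y * coef q' m).
have E w : resid a (U w) * resid b (V w) = resid a (uu q w) * resid b (uu q' w) by rewrite UE VE.
split; first by apply: eq_integrable i1 => // w _; rewrite /= E.
under eq_Rintegral do rewrite -E.
apply: le_trans i2 _; rewrite (mulrC 4) -mulrA ler_wpM2l// quad_coef.
have /andP[_ /pair_scale_facts[s0 s2 _ _]] := gq.
have /andP[_ /pair_scale_facts[s0' s2' _ _]] := gq'.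
have h0 : 0 <= sc q * sc q' / 4 by rewrite divr_ge0// mulr_ge0// ltW.
have h1 : sc q * sc q' / 4 <= 1.
  rewrite ler_pdivrMr// mul1r (_ : 4 = 2 * 2); last by ring.
  by apply: ler_pM => //; exact: ltW.
rewrite exprMn; apply: (@le_trans _ _ (1 * (rho (dist q.1 q'.1) + rho (dist q.1 q'.2) + (rho (dist q.2 q'.1) + rho (dist q.2 q'.2))) ^+ 2)).
  by rewrite ler_wpM2r ?sqr_ge0// expr2 mulr_ile1.
rewrite mul1r; move: (rho (dist q.1 q'.1)) (rho (dist q.1 q'.2)) (rho (dist q.2 q'.1)) (rho (dist q.2 q'.2)) => x y z t.
have := sqr_ge0 (x - y); have := sqr_ge0 (x - z); have := sqr_ge0 (x - t).
have := sqr_ge0 (y - z); have := sqr_ge0 (y - t); have := sqr_ge0 (z - t).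
by nra.
Qed.

Let NN n : R := n%:R * (n%:R - 1).

Let NN_bound n : (2 <= n)%N -> 0 < NN n /\ n%:R ^+ 2 <= 2 * NN n.
Proof.
by move=> n2; have h : 2 <= n%:R :> R; [by rewrite ler_nat|split; rewrite /NN; nra].
Qed.

Let centered_sum n r w : (2 <= n)%N ->
  (NN n)^-1 * (\sum_(i < n) \sum_(j < n | i != j) (hl_slope * (r - (X i w + X j w) / 2))) =
  hl_slope * (r - sample_mean X n w).
Proof.
move=> n2; have [N0 _] := NN_bound n2.
have n0 : n%:R != 0 :> R by rewrite pnatr_eq0 -lt0n ltnW.
have n1 : n%:R - 1 != 0 :> R by apply/eqP => h; move: N0; rewrite /NN h mulr0 ltxx.
under eq_bigr do rewrite -mulr_sumr.
rewrite -mulr_sumr (sum_offdiag (fun i => X i w)) /NN /sample_mean.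
by field; rewrite n0.
Qed.

(** Marks the correlations too large for [good]. It is 1 on the diagonal, where the correlation is
    1. *)
Definition hl_bad (t : R) : R := (2^-1 < `|t|)%R%:R.

(** [A] is the sum of the residuals over the good pairs, divided by n (n - 1); expanding its square
    exploits their cancellation. [E] dominates the replacement errors, which do not cancel, and is
    controlled in mean. [K] is uniform in [n] and [r] because [r] will depend on [n]. *)
Lemma hl_decomp : exists2 K : R, 0 <= K & forall n (r : R), (2 <= n)%N -> `|r| <= 2^-1 ->
  exists A E : T -> R, [/\ measurable_fun setT A, measurable_fun setT E,
    forall w, `|U_process (fun i => X i w) n r - 2^-1 - hl_slope * (r - sample_mean X n w) - A w| <= E w,
    P.-integrable setT (EFin \o (fun w => A w ^+ 2)) /\
     \int[P]_w (A w ^+ 2) <= K * (n%:R ^+ 2)^-1 * \sum_(i < n) \sum_(j < n) rho (dist i j) ^+ 2 &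
    P.-integrable setT (EFin \o E) /\
     \int[P]_w E w <= K * (n%:R ^+ 2)^-1 *
       \sum_(i < n) \sum_(j < n) (`|rho (dist i j)| + r ^+ 2 + hl_bad (rho (dist i j)))].
Proof.
have [C C0 CP] := pair_resid.
(* 16 is 4 times 4: four sums over quadruples, and the square of 2 in 1/(n (n - 1)) <= 2/n^2. 120 is
   20 times 3 times 2: the pointwise constant, the mean of 1 + X_i^2 + X_j^2, and the same 2. *)
exists (16 * C + 120); first by lra.
move=> n r n2 r2; have [N0 NN2] := NN_bound n2.
have n0 : 0 < n%:R :> R by rewrite ltr0n; lia.
have n20 : 0 < n%:R ^+ 2 :> R by rewrite exprn_gt0.
have NV : (NN n)^-1 <= 2 * (n%:R ^+ 2)^-1.
  by rewrite ler_pdivlMr// mulrC ler_pdivrMr.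
have NV0 : 0 <= (NN n)^-1 by rewrite invr_ge0 ltW.
pose g (q : 'I_n * 'I_n) w := resid (sc q * r) (uu q w).
have mg q : measurable_fun setT (g q).
  apply: (measurableT_comp (measurable_resid _)); apply: measurable_funM => //.
  by apply: measurable_funM => //; exact: measurable_funD.
(* A scale at most 2 and |r| <= 1/2 give the bound on the threshold that the covariance estimate
   asks for. *)
have qr (q : 'I_n * 'I_n) : good q -> `|sc q * r| <= 1.
  move=> /andP[_ /pair_scale_facts[s0 s2 _ _]]; rewrite normrM (gtr0_norm s0).
  by apply: le_trans (ler_pM (ltW s0) (normr_ge0 r) s2 r2) _; lra.
exists (fun w => (NN n)^-1 * \sum_(q | good q) g q w).
exists (fun w => 20 * (NN n)^-1 * \sum_(i < n) \sum_(j < n)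
  (`|rho (dist i j)| + r ^+ 2 + hl_bad (rho (dist i j))) * (1 + X i w ^+ 2 + X j w ^+ 2)).
have iX i : P.-integrable setT (EFin \o (fun w => X i w ^+ 2)) := process_sqr_int Xg i.
have i1 : P.-integrable setT (EFin \o (fun w : T => 1 : R)).
  by apply: (integrable_bounded _ (M := 1)) => // x; rewrite normr1.
have iM i j : P.-integrable setT (EFin \o (fun w => 1 + X i w ^+ 2 + X j w ^+ 2)).
  by apply: integrable_addR => //; exact: integrable_addR.
have EX2 i : \int[P]_w (X i w ^+ 2) = 1.
  by have := process_cov Xg Xs Xc i i; rewrite distnn rho0.
have EM i j : \int[P]_w (1 + X i w ^+ 2 + X j w ^+ 2) = 3.
  rewrite RintegralD//; last exact: integrable_addR.
  by rewrite RintegralD// !EX2 Rintegral_prob_cst; lra.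
split.
- under eq_fun do rewrite big_mkcond.
  by apply: measurable_funM => //; apply: measurable_sum => q; case: (good q).
- apply: measurable_funM => //; apply: measurable_sum => i; apply: measurable_sum => j.
  apply: measurable_funM => //; apply: measurable_funD; last exact: measurable_funX.
  by apply: measurable_funD => //; exact: measurable_funX.
- move=> w.
  have n1 : n%:R - 1 != 0 :> R by apply/eqP => h; move: N0; rewrite /NN h mulr0 ltxx.
  have cnt : \sum_(i < n) \sum_(j < n | i != j) 2^-1 = NN n * 2^-1 :> R.
    under eq_bigr => i _.
      rewrite sumr_const (_ : #|_| = n.-1); last first.
        by have := cardC1 i; rewrite card_ord => <-; apply: eq_card => j; rewrite !inE eq_sym.
      over.
    rewrite sum_cst_ord -(mulr_natl 2^-1) (_ : n.-1%:R = n%:R - 1); last first.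
      by rewrite -[in RHS](prednK (ltnW n2)) -natr1 addrK.
    by rewrite mulrA.
  have -> : U_process (fun i => X i w) n r - 2^-1 = (NN n)^-1 *
      \sum_(i < n) \sum_(j < n | i != j) (((X i w + X j w) / 2 <= r)%R%:R - 2^-1).
    under [in RHS]eq_bigr do rewrite sumrB.
    by rewrite sumrB cnt mulrBr mulKf// gt_eqF.
  rewrite -(centered_sum r w n2) -!mulrBr normrM (ger0_norm NV0) (mulrC 20) -mulrA ler_wpM2l//.
  have -> : \sum_(q | good q) g q w = \sum_(i < n) \sum_(j < n | i != j)
      (if `|rho (dist i j)| <= 2^-1 then g (i, j) w else 0).
    rewrite pair_big_dep/= big_mkcond [RHS]big_mkcond; apply: eq_bigr => -[i j] _ /=.
    by rewrite /good/=; case: (i != j); case: (_ <= _).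
  rewrite -!sumrB; apply: le_trans (ler_norm_sum _ _ _) _; rewrite mulr_sumr; apply: ler_sum => i _.
  rewrite -!sumrB; apply: le_trans (ler_norm_sum _ _ _) _; rewrite big_mkcond mulr_sumr; apply: ler_sum => j _.
  have M0 : 0 <= 1 + X i w ^+ 2 + X j w ^+ 2 by have := sqr_ge0 (X i w); have := sqr_ge0 (X j w); lra.
  have t0 := normr_ge0 (rho (dist i j)); have r0 := sqr_ge0 r.
  case: ifPn => _; last by rewrite mulr_ge0// mulr_ge0// !addr_ge0.
  rewrite /hl_bad; case: leP => h /=.
    have := good_pair_approx (X i w) (X j w) h r2.
    by move=> H; rewrite addr0; apply: le_trans H _; rewrite mulrA.
  rewrite subr0; apply: le_trans (bad_pair_approx (X i w) (X j w) r2) _.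
  by rewrite ler_pM2l// ler_peMl//; lra.
- have E w : ((NN n)^-1 * \sum_(q | good q) g q w) ^+ 2 =
     (NN n)^-1 ^+ 2 * \sum_(q | good q) \sum_(q' | good q') g q w * g q' w.
    by rewrite exprMn -big_distrlr/= -expr2.
  have ig q q' : good q -> good q' -> P.-integrable setT (EFin \o (fun w => g q w * g q' w)).
    by move=> gq gq'; have [] := CP n q q' (sc q * r) (sc q' * r) gq gq' (qr _ gq').
  have igs q : good q -> P.-integrable setT (EFin \o (fun w => \sum_(q' | good q') g q w * g q' w)).
    by move=> gq; apply: integrable_sumR => // q'; exact: ig.
  under eq_fun do rewrite E.
  split; first by apply: integrable_scaleR => //; apply: integrable_sumR => //.
  rewrite RintegralZl//; last exact: integrable_sumR.
  rewrite Rintegral_sum//.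
  set S := \sum_(i < n) \sum_(j < n) rho (dist i j) ^+ 2.
  have S0 : 0 <= S by apply: sumr_ge0 => i _; apply: sumr_ge0 => j _; exact: sqr_ge0.
  have bound : \sum_(q | good q) \int[P]_w (\sum_(q' | good q') g q w * g q' w) <= C * (4 * n%:R ^+ 2 * S).
    apply: (@le_trans _ _ (\sum_(q : 'I_n * 'I_n) \sum_(q' : 'I_n * 'I_n) C * (rho (dist q.1 q'.1) ^+ 2 + rho (dist q.1 q'.2) ^+ 2 + (rho (dist q.2 q'.1) ^+ 2 + rho (dist q.2 q'.2) ^+ 2)))).
      rewrite big_mkcond; apply: ler_sum => q _; case: ifPn => gq; last first.
        by apply: sumr_ge0 => q' _; rewrite mulr_ge0// !addr_ge0// sqr_ge0.
      rewrite Rintegral_sum//; last by move=> q'; exact: ig.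
      rewrite big_mkcond; apply: ler_sum => q' _; case: ifPn => gq'; last first.
        by rewrite mulr_ge0// !addr_ge0// sqr_ge0.
      by have [_] := CP n q q' (sc q * r) (sc q' * r) gq gq' (qr _ gq'); apply: le_trans (ler_norm _).
    under eq_bigr do rewrite -mulr_sumr.
    rewrite -mulr_sumr ler_wpM2l// le_eqVlt; apply/orP; left; apply/eqP.
    have -> : \sum_(q : 'I_n * 'I_n) \sum_(q' : 'I_n * 'I_n) (rho (dist q.1 q'.1) ^+ 2 + rho (dist q.1 q'.2) ^+ 2 + (rho (dist q.2 q'.1) ^+ 2 + rho (dist q.2 q'.2) ^+ 2)) =
      \sum_(i < n) \sum_(j < n) \sum_(k < n) \sum_(l < n) (rho (dist i k) ^+ 2 + rho (dist i l) ^+ 2 + (rho (dist j k) ^+ 2 + rho (dist j l) ^+ 2)).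
      rewrite [RHS]pair_bigA/=; apply: eq_bigr => q _.
      by rewrite [RHS]pair_bigA/=.
    pose s (i : 'I_n) := \sum_(j < n) rho (dist i j) ^+ 2.
    have inner (i j : 'I_n) : \sum_(k < n) \sum_(l < n) (rho (dist i k) ^+ 2 + rho (dist i l) ^+ 2 + (rho (dist j k) ^+ 2 + rho (dist j l) ^+ 2)) =
       n%:R * 2 * s i + n%:R * 2 * s j.
      under eq_bigr do rewrite !big_split/= !sum_cst_ord -/(s i) -/(s j).
      by rewrite !big_split/= !sum_cst_ord -!mulr_sumr -/(s i) -/(s j); ring.
    under eq_bigr do under eq_bigr do rewrite inner.
    under eq_bigr do rewrite big_split/= sum_cst_ord -mulr_sumr -/S.
    by rewrite big_split/= sum_cst_ord -!mulr_sumr -/S; ring.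
  apply: le_trans (ler_wpM2l (sqr_ge0 _) bound) _.
  have h : (NN n)^-1 ^+ 2 <= (2 * (n%:R ^+ 2)^-1) ^+ 2 by rewrite lerXn2r ?nnegrE// mulr_ge0// invr_ge0 ltW.
  apply: le_trans (ler_wpM2r _ h) _; first by rewrite mulr_ge0// mulr_ge0// mulr_ge0// ltW.
  rewrite [leLHS](_ : _ = 16 * C * (n%:R ^+ 2)^-1 * S); last by field; rewrite gt_eqF.
  by rewrite ler_wpM2r// ler_wpM2r ?invr_ge0 ?(ltW n20)//; lra.
have iE i j : P.-integrable setT (EFin \o (fun w => (`|rho (dist i j)| + r ^+ 2 + hl_bad (rho (dist i j))) * (1 + X i w ^+ 2 + X j w ^+ 2))).
  exact: integrable_scaleR.
have iEs i : P.-integrable setT (EFin \o (fun w => \sum_(j < n) (`|rho (dist i j)| + r ^+ 2 + hl_bad (rho (dist i j))) * (1 + X i w ^+ 2 + X j w ^+ 2))).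
  exact: integrable_sumR.
split; first by apply: integrable_scaleR => //; exact: integrable_sumR.
rewrite RintegralZl//; last exact: integrable_sumR.
rewrite Rintegral_sum//.
under eq_bigr => i _.
  rewrite Rintegral_sum//.
  under eq_bigr do rewrite RintegralZl// EM.
  rewrite -mulr_suml.
  over.
rewrite -mulr_suml.
set S : R := \sum_(i < n) _.
have S0 : 0 <= S.
  by apply: sumr_ge0 => i _; apply: sumr_ge0 => j _; rewrite !addr_ge0// ?sqr_ge0.
rewrite [leLHS](_ : _ = (NN n)^-1 * (60 * S)); last by ring.
apply: le_trans (ler_wpM2r _ NV) _; first by rewrite mulr_ge0.
rewrite [leLHS](_ : _ = 120 * (n%:R ^+ 2)^-1 * S); last by ring.
by rewrite ler_wpM2r// ler_wpM2r ?invr_ge0 ?(ltW n20)//; lra.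
Qed.

End decomposition.

(** The infimum is attained: [U_process] is a step function, constant from [r] up to the nearest
    pair mean above it. *)
Lemma generalized_inverse_le (R : realType) (x : nat -> R) n (r : R) : (2 <= n)%N ->
  (generalized_inverse (U_process x n) 2^-1 <= r) = (2^-1 <= U_process x n r).
Proof.
move=> n2; have hinf := has_inf_U_process x n2.
apply/idP/idP => [infr|Ur]; last by apply: ge_inf => //; have [] := hinf.
pose xi (q : 'I_n * 'I_n) := (x q.1 + x q.2) / 2.
(* The distance from [r] to the next pair mean, capped by the default 1. A point below r + del
   counts no pair that [r] does not count. *)
pose del : R := \big[Num.min/1]_(q : 'I_n * 'I_n | r < xi q) (xi q - r).
have del0 : 0 < del by apply: lt_bigmin => // q qr; rewrite subr_gt0.
have [e Ue edel] := inf_adherent del0 hinf.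
apply: le_trans Ue _; rewrite /U_process ler_wpM2l//.
  rewrite invr_ge0 mulr_ge0// subr_ge0 ler1n; exact: ltnW.
apply: ler_sum => i _; apply: ler_sum => j _; rewrite ler_nat.
case: (leP ((x i + x j) / 2) r) => [_|rxi]; first by case: (_ <= _).
case: leP => // xie; exfalso.
have : del <= xi (i, j) - r by apply: bigmin_le_cond.
by move: infr edel; rewrite /generalized_inverse /xi/=; lra.
Qed.

(** Slutsky's lemma in terms of distribution functions; [dl] stands for a bound on the probability
    that two variables differ by more than [e]. *)
Lemma sandwich_cvg (R : realType) (p : nat -> R) (F : nat -> R -> R) (G : R -> R) (x : R) :
  (forall y, F n y @[n --> \oo] --> G y) -> {for x, continuous G} ->
  (forall e : R, 0 < e -> exists dl : nat -> R, dl @ \oo --> (0 : R) /\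
     \forall n \near \oo, F n (x - e) - dl n <= p n <= F n (x + e) + dl n) ->
  p @ \oo --> G x.
Proof.
move=> FG Gx H; apply/cvgrPdist_le => e e0.
have e3 : 0 < e / 3 by rewrite divr_gt0.
have /cvgrPdist_le/(_ _ e3)/nbhs_ballP[t /= t0 tP] := Gx.
have t2 : 0 < t / 2 by rewrite divr_gt0.
have [dl [dl0 dlP]] := H _ t2.
have near_G (z : R) : `|x - z| <= t / 2 -> `|G x - G z| <= e / 3.
  by move=> h; apply: tP; rewrite /ball/=; apply: le_lt_trans h _; lra.
have G1 : `|G x - G (x - t / 2)| <= e / 3.
  by apply: near_G; rewrite opprB addrC subrK gtr0_norm.
have G2 : `|G x - G (x + t / 2)| <= e / 3.
  by apply: near_G; rewrite opprD addrA subrr add0r normrN gtr0_norm.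
near=> n.
have F1 : `|G (x - t / 2) - F n (x - t / 2)| <= e / 3.
  by near: n; have /cvgrPdist_le := FG (x - t / 2); apply.
have F2 : `|G (x + t / 2) - F n (x + t / 2)| <= e / 3.
  by near: n; have /cvgrPdist_le := FG (x + t / 2); apply.
have D : `|0 - dl n| <= e / 3 by near: n; move/cvgrPdist_le: dl0; apply.
have /andP[p1 p2] : F n (x - t / 2) - dl n <= p n <= F n (x + t / 2) + dl n by near: n.
move: G1 G2 F1 F2 D; rewrite sub0r normrN !ler_norml.
move=> /andP[a1 a2] /andP[b1 b2] /andP[c1 c2] /andP[d1 d2] /andP[f1 f2].
by move: p1 p2 a1 a2 b1 b2 c1 c2 d1 d2 f1 f2; clear; move=> *; apply/andP; split; lra.
Unshelve. all: by end_near. Qed.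

Section prob.
Context d (T : measurableType d) (R : realType) (P : probability T R).

Definition pr (A : set T) : R := fine (P A).

Lemma prE (A : set T) : measurable A -> P A = (pr A)%:E.
Proof. by move=> mA; rewrite /pr fineK// fin_num_measure. Qed.

Lemma pr_le (A B : set T) : measurable A -> measurable B -> A `<=` B -> pr A <= pr B.
Proof.
by move=> mA mB AB; rewrite -lee_fin -!prE//; apply: le_measure; rewrite ?inE.
Qed.

Lemma pr_leU (A B C : set T) : measurable A -> measurable B -> measurable C ->
  A `<=` B `|` C -> pr A <= pr B + pr C.
Proof.
move=> mA mB mC ABC; apply: (le_trans (pr_le mA (measurableU _ _ mB mC) ABC)).
by rewrite -lee_fin EFinD -!prE//; [exact: measureU2|exact: measurableU].
Qed.

Lemma pr_markov (E : T -> R) (t : R) : 0 < t -> P.-integrable setT (EFin \o E) ->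
  measurable_fun setT E -> (forall w, 0 <= E w) -> pr [set w | t < E w] <= t^-1 * \int[P]_w E w.
Proof.
move=> t0 iE mE E0.
have mB : measurable [set w | t < E w].
  by rewrite -[X in measurable X]setTI; exact: (measurable_fun_ltr (measurable_cst t) mE measurableT (Y := [set true])).
rewrite -lee_fin -prE// EFinM /Rintegral fineK; last exact: integrable_fin_num.
rewrite -(setIT [set w | t < E w]) -integral_indic// -integralZl//.
apply: ge0_le_integral => //.
- by apply/measurable_EFinP; exact: measurable_indic.
- by apply/measurable_EFinP; exact: measurable_funM.
move=> w _; rewrite -EFinM lee_fin indicE.
case: (boolP (w \in _)) => [|_] /=; last by rewrite mulr_ge0// invr_ge0 ltW.
by rewrite inE /= => /ltW tE; rewrite ler_pdivlMl// mulr1.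
Qed.

Lemma measurable_le_set (f g : T -> R) : measurable_fun setT f -> measurable_fun setT g ->
  measurable [set w | f w <= g w].
Proof. by move=> mf mg; rewrite -[X in measurable X]setTI; exact: measurable_fun_le. Qed.

End prob.

Lemma continuous_seq_cvg (R : realType) (h : R -> R) (u : nat -> R) (l : R) :
  {for l, continuous h} -> u @ \oo --> l -> h (u n) @[n --> \oo] --> h l.
Proof. by move=> ch ul; exact: (cvg_comp _ _ ul ch). Qed.

Lemma continuous_gcdf_scale (R : realType) (c : R) : continuous (fun y : R => gcdf (y * c)).
Proof.
move=> z; apply: (@continuous_comp _ _ _ (fun y : R => y * c) gcdf).
  by apply: cvgMl; exact: cvg_id.
exact: continuous_gcdf.
Qed.

(** * Limit laws of the sample mean and of the Hodges-Lehmann estimator *)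

Section limits.
Context d (T : measurableType d) (R : realType) (P : probability T R).
Variables (X : nat -> {RV P >-> R}) (rho a : nat -> R) (D : R).
Hypotheses (Xg : gaussian_process X) (Xs : stationary X)
  (Xm : forall i, ('E_P[X i] = 0)%E) (Xc : forall k, ('E_P[(X 0%N * X k)%R] = (rho k)%:E)%E).
Hypothesis rho0 : rho 0%N = 1.
Hypothesis D01 : 0 < D < 1.
Hypothesis reg : forall U eps : R, 1 < U -> 0 < eps < 1 ->
  exists N, (0 < N)%N /\ forall j k, (N <= j)%N -> (j <= k)%N -> k%:R <= U * j%:R ->
    `|rho k / rho j * (k%:R / j%:R) `^ D - 1| <= eps.
Hypothesis pos : \forall k \near \oo, 0 < rho k.
Hypothesis aE : \forall n \near \oo, a n = (Num.sqrt (rho n))^-1.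

Let v : R := 2 / ((1 - D) * (2 - D)).

Lemma lim_var_gt0 : 0 < v.
Proof. by have /andP[D0 D1] := D01; rewrite divr_gt0// mulr_gt0; lra. Qed.

Lemma sample_mean_cvg y :
  pr P [set w | a n * sample_mean X n w <= y] @[n --> \oo] --> gcdf (y / Num.sqrt v).
Proof.
pose vn n : R := (n%:R ^+ 2 * rho n)^-1 * \sum_(i < n) \sum_(j < n) rho (dist i j).
have vn_cvg : vn n @[n --> \oo] --> v by exact: rho_sum_cvg.
have lim : gcdf (y / Num.sqrt (vn n)) @[n --> \oo] --> gcdf (y / Num.sqrt v).
  apply: continuous_seq_cvg; first exact: continuous_gcdf.
  apply: cvgMr; apply: cvgV; first by rewrite gt_eqF// sqrtr_gt0 lim_var_gt0.
  by apply: continuous_seq_cvg => //; exact: sqrt_continuous.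
apply: cvg_trans lim; apply: near_eq_cvg; near=> n.
have [n0 rn] : (0 < n)%N /\ 0 < rho n by near: n; exact: (rho_gt0 pos).
have n0' : 0 < n%:R :> R by rewrite ltr0n.
have an : a n = (Num.sqrt (rho n))^-1 by near: n.
have vn0 : 0 < vn n by near: n; apply: (cvgr_gt _ vn_cvg); exact: lim_var_gt0.
have [_ law] := process_law Xg Xs Xm Xc (fun i : 'I_n => a n / n%:R).
have E : \sum_(i < n) \sum_(j < n) a n / n%:R * (a n / n%:R) * rho (dist i j) = vn n.
  under eq_bigr do rewrite -mulr_sumr.
  rewrite -mulr_sumr; congr (_ * _); rewrite an invfM -expr2 exprMn !exprVn sqr_sqrtr ?(ltW rn)//.
  by rewrite mulrC.
rewrite E in law; have := gaussian_rv_cdf y vn0 law.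
move=> /(congr1 fine)/= <-; rewrite /cdf /distribution /pushforward /pr; congr (fine (P _)).
apply/seteqP; split => w /=; rewrite in_itv/= sum_scale_mfunE -mulr_sumr.
  by rewrite /sample_mean mulrA.
by rewrite /sample_mean mulrA.
Unshelve. all: by end_near. Qed.

(** Unless [A] or [E] is large, a_n (U_n(r) - 1/2) differs from c (x - a_n mean) by at most c e. So
    U_n(r) >= 1/2 implies a_n mean <= x + e and is implied by a_n mean <= x - e. *)
Lemma hodges_lehmann_cvg x :
  pr P [set w | a n * generalized_inverse (U_process (fun i => X i w) n) 2^-1 <= x] @[n --> \oo]
    --> gcdf (x / Num.sqrt v).
Proof.
have c0 := @hl_slope_gt0 R; set c : R := hl_slope in c0.
apply: (sandwich_cvg (F := fun n y => pr P [set w | a n * sample_mean X n w <= y])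
  (G := fun y => gcdf (y / Num.sqrt v))).
- exact: sample_mean_cvg.
- exact: continuous_gcdf_scale.
move=> e e0; have ce0 : 0 < c * e / 2 by rewrite divr_gt0// mulr_gt0.
have [K K0 KP] := hl_decomp Xg Xs Xm Xc rho0.
have [C [C0 CP]] := rho_abs_sum_bound D01 reg pos.
pose S2 n : R := (n%:R ^+ 2 * rho n)^-1 * \sum_(i < n) \sum_(j < n) rho (dist i j) ^+ 2.
have rho_small (t : R) : 0 < t -> \forall k \near \oo, `|rho k| <= t.
  by move=> t0; have /cvgr0Pnorm_le := rho_cvg0 D01 reg pos; exact.
have S2_cvg : S2 n @[n --> \oo] --> (0 : R).
  have H (t : R) : 0 < t -> \forall k \near \oo, `|rho k ^+ 2| <= t * `|rho k|.
    by move=> /rho_small; apply: filterS => k h; rewrite expr2 normrM ler_wpM2r.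
  apply: cvg_trans (small_sum_cvg0 D01 reg pos H); apply: near_eq_cvg.
  apply: nearW => n; congr (_ * _); apply: eq_bigr => i _; apply: eq_bigr => j _.
  by rewrite ger0_norm// sqr_ge0.
have bad_cvg : (n%:R ^+ 2 * rho n)^-1 * \sum_(i < n) \sum_(j < n) hl_bad (rho (dist i j)) @[n --> \oo] --> (0 : R).
  (* [hl_bad] vanishes at all large lags because rho tends to 0. *)
  have H (t : R) : 0 < t -> \forall k \near \oo, `|hl_bad (rho k)| <= t * `|rho k|.
    move=> t0; have h2 : 0 < 2^-1 :> R by rewrite invr_gt0.
    apply: filterS (rho_small _ h2) => k h; rewrite /hl_bad ltNge h normr0 mulr_ge0//; exact: ltW.
  apply: cvg_trans (small_sum_cvg0 D01 reg pos H); apply: near_eq_cvg.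
  by apply: nearW => n; congr (_ * _); apply: eq_bigr => i _; apply: eq_bigr => j _; rewrite ger0_norm.
have sq_cvg : Num.sqrt (rho n) @[n --> \oo] --> (0 : R).
  rewrite -[X in _ --> X](@sqrtr0 R).
  by apply: continuous_seq_cvg; [exact: sqrt_continuous|exact: rho_cvg0 D01 reg pos].
(* Markov's inequality twice: a_n^2 turns the mean square of [A] into a multiple of [S2], and a_n
   turns the O(rho(n)) mean of [E] into a multiple of sqrt(rho(n)). *)
pose dl n : R := (c * e / 2) ^- 2 * K * S2 n + (c * e / 2)^-1 * K * (C + x ^+ 2 + 1) * Num.sqrt (rho n).
exists dl; split.
  have -> : 0 = (c * e / 2) ^- 2 * K * 0 + (c * e / 2)^-1 * K * (C + x ^+ 2 + 1) * 0 :> R by rewrite !mulr0 addr0.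
  by apply: cvgD; apply: cvgMr.
near=> n.
have [n0 rn] : (0 < n)%N /\ 0 < rho n by near: n; exact: (rho_gt0 pos).
have n2 : (2 <= n)%N by near: n; exists 2%N.
have n0' : 0 < n%:R :> R by rewrite ltr0n.
have n20 : 0 < n%:R ^+ 2 :> R by rewrite exprn_gt0.
have an : a n = (Num.sqrt (rho n))^-1 by near: n.
have s0 : 0 < Num.sqrt (rho n) by rewrite sqrtr_gt0.
have an0 : 0 < a n by rewrite an invr_gt0.
have rE : x / a n = x * Num.sqrt (rho n) by rewrite an invrK.
have sx : `|x * Num.sqrt (rho n)| <= 2^-1.
  near: n; have : x * Num.sqrt (rho n) @[n --> \oo] --> x * 0 by apply: cvgMr.
  by rewrite mulr0 => /cvgr0Pnorm_le; apply; rewrite invr_gt0.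
have absb : \sum_(i < n) \sum_(j < n) `|rho (dist i j)| <= C * (n%:R ^+ 2 * rho n) by near: n.
have badb : (n%:R ^+ 2 * rho n)^-1 * \sum_(i < n) \sum_(j < n) hl_bad (rho (dist i j)) <= 1.
  by near: n; apply: (cvgr_le _ bad_cvg).
rewrite -rE in sx.
have [A [E [mA mE AE [iA A2] [iE E2]]]] := KP n _ n2 sx.
set r := x / a n in sx AE A2 E2.
have E0 w : 0 <= E w by apply: le_trans (AE w).
have setE : [set w | a n * generalized_inverse (U_process (fun i => X i w) n) 2^-1 <= x] =
            [set w | 2^-1 <= U_process (fun i => X i w) n r].
  apply/seteqP; split => w /=; rewrite -generalized_inverse_le// /r ler_pdivlMr//; by rewrite mulrC.
have mU : measurable [set w | 2^-1 <= U_process (fun i => X i w) n r].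
  by apply: measurable_le_set => //; exact: measurable_U_process.
have mM y : measurable [set w | a n * sample_mean X n w <= y].
  by apply: measurable_le_set => //; exact: measurable_funM.
(* Half of the slack c e goes to each error term, rescaled by a_n. *)
pose tA : R := ((c * e / 2) / a n) ^+ 2.
pose tE : R := (c * e / 2) / a n.
have tE0 : 0 < tE by rewrite divr_gt0.
have tA0 : 0 < tA by rewrite exprn_gt0.
have mA2 : measurable_fun setT (fun w => A w ^+ 2) by exact: measurable_funX.
have lt_set (f : T -> R) (t : R) : measurable_fun setT f -> measurable [set w | t < f w].
  move=> mf; rewrite -[X in measurable X]setTI.
  exact: (measurable_fun_ltr (measurable_cst t) mf measurableT (Y := [set true])).
have mBA := lt_set _ tA mA2; have mBE := lt_set _ tE mE.
have mB := measurableU _ _ mBA mBE.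
have a2 : a n ^+ 2 = (rho n)^-1 by rewrite an exprVn sqr_sqrtr// ltW.
have pA : pr P [set w | tA < A w ^+ 2] <= (c * e / 2) ^- 2 * K * S2 n.
  apply: le_trans (pr_markov tA0 iA mA2 (fun w => sqr_ge0 _)) _.
  apply: le_trans (ler_wpM2l (ltW _) A2) _; first by rewrite invr_gt0.
  rewrite /tA /S2 exprMn exprVn a2 invrK le_eqVlt; apply/orP; left; apply/eqP.
  set S := \sum_(i < n) _; set ce := (c * e / 2) in ce0 *.
  by field; rewrite !gt_eqF.
have pE : pr P [set w | tE < E w] <= (c * e / 2)^-1 * K * (C + x ^+ 2 + 1) * Num.sqrt (rho n).
  apply: le_trans (pr_markov tE0 iE mE E0) _.
  apply: le_trans (ler_wpM2l (ltW _) E2) _; first by rewrite invr_gt0.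
  have sumE : \sum_(i < n) \sum_(j < n) (`|rho (dist i j)| + r ^+ 2 + hl_bad (rho (dist i j))) <=
      (n%:R ^+ 2 * rho n) * (C + x ^+ 2 + 1).
    under eq_bigr do rewrite !big_split/= sum_cst_ord.
    rewrite !big_split/= sum_cst_ord.
    have -> : r ^+ 2 = x ^+ 2 * rho n by rewrite /r rE exprMn sqr_sqrtr// ltW.
    have b1 : \sum_(i < n) \sum_(j < n) hl_bad (rho (dist i j)) <= n%:R ^+ 2 * rho n.
      by move: badb; rewrite ler_pdivrMl ?mulr1// mulr_gt0.
    rewrite [leRHS](_ : _ = C * (n%:R ^+ 2 * rho n) + n%:R * (n%:R * (x ^+ 2 * rho n)) + n%:R ^+ 2 * rho n); last by ring.
    by apply: lerD => //; rewrite lerD2r.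
  have k0 : 0 <= tE^-1 * (K * (n%:R ^+ 2)^-1).
    by rewrite mulr_ge0 ?invr_ge0 ?(ltW tE0)// mulr_ge0// invr_ge0 ltW.
  rewrite mulrA; apply: le_trans (ler_wpM2l k0 sumE) _.
  rewrite /tE an le_eqVlt; apply/orP; left; apply/eqP.
  have rs : rho n = Num.sqrt (rho n) ^+ 2 by rewrite sqr_sqrtr// ltW.
  have main (s q : R) : 0 < s -> q = s ^+ 2 ->
      (c * e / 2 / s^-1)^-1 * (K * (n%:R ^+ 2)^-1) * (n%:R ^+ 2 * q * (C + x ^+ 2 + 1)) =
      (c * e / 2)^-1 * K * (C + x ^+ 2 + 1) * s.
    by move=> s1 ->; field; rewrite !gt_eqF.
  exact: main.
have pB : pr P ([set w | tA < A w ^+ 2] `|` [set w | tE < E w]) <= dl n.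
  have U2 := pr_leU P mB mBA mBE (fun w h => h).
  by apply: le_trans U2 _; exact: lerD.
have small w : ~ ([set w | tA < A w ^+ 2] `|` [set w | tE < E w]) w -> `|a n * A w| <= c * e / 2 /\ a n * E w <= c * e / 2.
  move=> h; have h1 : A w ^+ 2 <= tA by rewrite leNgt; apply/negP => h1; apply: h; left.
  have h2 : E w <= tE by rewrite leNgt; apply/negP => h2; apply: h; right.
  split; last by rewrite mulrC -ler_pdivlMr.
  rewrite normrM (gtr0_norm an0) mulrC -ler_pdivlMr//.
  by move: h1; rewrite /tA -/tE -(real_normK (num_real (A w))) ler_pXn2r// nnegrE// ltW.
have key w : `|a n * (U_process (fun i => X i w) n r - 2^-1) - c * (x - a n * sample_mean X n w) - a n * A w| <= a n * E w.
  have -> : a n * (U_process (fun i => X i w) n r - 2^-1) - c * (x - a n * sample_mean X n w) - a n * A w =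
    a n * (U_process (fun i => X i w) n r - 2^-1 - c * (r - sample_mean X n w) - A w).
    by rewrite /r; field; rewrite gt_eqF.
  by rewrite normrM (gtr0_norm an0) ler_pM2l.
rewrite setE; apply/andP; split.
  rewrite lerBlDr; apply: (@le_trans _ _ (pr P [set w | 2^-1 <= U_process (fun i => X i w) n r] +
    pr P ([set w | tA < A w ^+ 2] `|` [set w | tE < E w]))); last by rewrite lerD2l.
  apply: pr_leU => // w /= Mw; have [|nb] := pselect (([set w | tA < A w ^+ 2] `|` [set w | tE < E w]) w).
    by right.
  left => /=; have [s1 s2] := small w nb; have := key w.
  move: s1; rewrite !ler_norml => /andP[s1 s1'] /andP[k1 k2].
  rewrite -subr_ge0 -(pmulr_rge0 _ an0).
  have cM : c * (a n * sample_mean X n w) <= c * (x - e) by rewrite ler_pM2l.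
  by move: s1 s1' k1 k2 cM s2; clear; move=> *; lra.
apply: (@le_trans _ _ (pr P [set w | a n * sample_mean X n w <= x + e] +
    pr P ([set w | tA < A w ^+ 2] `|` [set w | tE < E w]))); last by rewrite lerD2l.
apply: pr_leU => // w /= Uw; have [|nb] := pselect (([set w | tA < A w ^+ 2] `|` [set w | tE < E w]) w).
  by right.
left => /=; have [s1 s2] := small w nb; have := key w.
move: s1; rewrite !ler_norml => /andP[s1 s1'] /andP[k1 k2].
have aU : 0 <= a n * (U_process (fun i => X i w) n r - 2^-1) by rewrite pmulr_rge0// subr_ge0.
have : c * (a n * sample_mean X n w) <= c * (x + e) by move: s1 s1' s2 k1 k2 aU; clear; move=> *; lra.
by rewrite ler_pM2l.
Unshelve. all: by end_near. Qed.

End limits.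

(** Makes the staircase approximation of a function with values in [0, 1] by indicators of its level
    sets uniformly accurate. *)
Lemma count_below (R : realType) (m : nat) (y : R) : 0 <= y <= m%:R ->
  `|\sum_(k < m) (k%:R < y)%R%:R - y| <= 1.
Proof.
elim: m y => [|m IH] y /andP[y0 ym].
  by rewrite big_ord0 sub0r normrN ger0_norm//; apply: le_trans ym _.
rewrite big_ord_recr/=; have [my|ym'] := ltP m%:R y; last first.
  by rewrite addr0; apply: IH; rewrite y0.
rewrite (eq_bigr (fun=> 1)); last first.
  by move=> k _; rewrite (lt_trans _ my)// ltr_nat.
rewrite sumr_const card_ord /=; move: ym; rewrite -natr1 => ym.
by rewrite ler_norml; apply/andP; split; lra.
Qed.

(** * Wiener integrals *)

Section independence.
Context d (T : measurableType d) (R : realType) (P : probability T R).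

Let mRV (V : {RV P >-> R}) (g : R -> R) : measurable_fun setT g -> measurable_fun setT (fun w => g (V w)).
Proof. by move=> mg; exact: measurableT_comp. Qed.

(** The staircase [gm] averages m + 1 indicators of level sets of [g] and is within 1/(m + 1) of it,
    so the factorization passes from indicators to [g] by bounded convergence. *)
Lemma integral_indep_unit (H : T -> R) (V : {RV P >-> R}) (g : R -> R) :
  measurable_fun setT H -> (forall w, `|H w| <= 1) ->
  (forall A : set R, measurable A -> \int[P]_w (H w * \1_A (V w)) = \int[P]_w H w * \int[P]_w \1_A (V w)) ->
  measurable_fun setT g -> (forall x, 0 <= g x <= 1) ->
  \int[P]_w (H w * g (V w)) = \int[P]_w H w * \int[P]_w g (V w).
Proof.
move=> mH H1 HA mg g01.
have gn x : `|g x| <= 1 by have /andP[? ?] := g01 x; rewrite ger0_norm.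
have intb (f : T -> R) (M : R) : measurable_fun setT f -> (forall w, `|f w| <= M) -> P.-integrable setT (EFin \o f).
  by move=> mf fM; apply: (@integrable_bounded _ _ _ P f M).
pose gm (m : nat) x : R := m.+1%:R^-1 * \sum_(k < m.+1) (k%:R < m.+1%:R * g x)%R%:R.
have gmE m x : `|gm m x - g x| <= m.+1%:R^-1.
  have /andP[g0 g1] := g01 x.
  have h : 0 <= m.+1%:R * g x <= m.+1%:R by rewrite mulr_ge0// ler_piMr.
  have := count_below h; rewrite /gm.
  have -> : m.+1%:R^-1 * \sum_(k < m.+1) (k%:R < m.+1%:R * g x)%R%:R - g x =
      m.+1%:R^-1 * (\sum_(k < m.+1) (k%:R < m.+1%:R * g x)%R%:R - m.+1%:R * g x).
    by rewrite mulrBr mulKf// pnatr_eq0.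
  by move=> h2; rewrite normrM gtr0_norm ?invr_gt0// ler_piMr// invr_ge0.
pose A (m k : nat) := [set x : R | k%:R < m.+1%:R * g x].
have mA m k : measurable (A m k).
  have -> : A m k = setT `&` g @^-1` `]k%:R / m.+1%:R, +oo[%classic.
    by rewrite setTI; apply/seteqP; split=> x; rewrite /A /= in_itv/= andbT ltr_pdivrMr// mulrC.
  exact: mg.
have gmA m x : gm m x = \sum_(k < m.+1) m.+1%:R^-1 * \1_(A m k) x.
  rewrite /gm mulr_sumr; apply: eq_bigr => k _; rewrite indicE; congr (_ * _%:R).
  by congr nat_of_bool; apply/idP/idP; rewrite inE.
have mind m k : measurable_fun setT (fun w => \1_(A m k) (V w) : R).
  by apply: mRV; exact: measurable_indic.
have ind1 (B : set R) x : `|\1_B x| <= 1 :> R by rewrite indicE; case: (_ \in _); rewrite ?normr1 ?normr0.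
have iI m k : P.-integrable setT (EFin \o (fun w => \1_(A m k) (V w))) by apply: (intb _ 1).
have prod1 (x y : R) : `|x| <= 1 -> `|y| <= 1 -> `|x * y| <= 1 by move=> *; rewrite normrM mulr_ile1.
have iHI m k : P.-integrable setT (EFin \o (fun w => H w * \1_(A m k) (V w))).
  by apply: (intb _ 1); [exact: measurable_funM|move=> w; exact: prod1].
have E m : \int[P]_w (H w * gm m (V w)) = \int[P]_w H w * \int[P]_w gm m (V w).
  under eq_Rintegral do rewrite gmA mulr_sumr.
  have -> : \int[P]_w gm m (V w) = \int[P]_w (\sum_(k < m.+1) m.+1%:R^-1 * \1_(A m k) (V w)).
    by apply: eq_Rintegral => w _; exact: gmA.
  rewrite !Rintegral_sum//; last 2 first.
  - by move=> k _; apply: integrable_scaleR.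
  - move=> k _; have := integrable_scaleR measurableT m.+1%:R^-1 (iHI m k).
    by apply: eq_integrable => // w _; rewrite /= mulrCA.
  rewrite mulr_sumr; apply: eq_bigr => k _.
  under eq_Rintegral do rewrite mulrCA.
  by rewrite !RintegralZl// HA// mulrCA.
have mgm m : measurable_fun setT (fun w => gm m (V w)).
  under eq_fun do rewrite gmA.
  by apply: measurable_sum => k; apply: measurable_funM.
have mgV : measurable_fun setT (fun w => g (V w)) by exact: mRV.
have inv1 m : m.+1%:R^-1 <= 1 :> R by rewrite invf_le1// ler1n.
have gm2 m x : `|gm m x| <= 2.
  have main (a b c : R) : c <= 1 -> `|b| <= 1 -> `|a - b| <= c -> `|a| <= 2.
    by rewrite !ler_norml => h /andP[a1 a2] /andP[b1 b2]; apply/andP; split; lra.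
  exact: main (inv1 m) (gn x) (gmE m x).
have lim x : gm m x @[m --> \oo] --> g x.
  have i0 : (m.+1%:R^-1 : R) @[m --> \oo] --> (0 : R) by exact: cvg_harmonic.
  apply/cvgrPdist_le => e e0; move/cvgrPdist_le : i0 => /(_ _ e0); apply: filterS => m.
  rewrite sub0r normrN gtr0_norm ?invr_gt0// => h; rewrite distrC; exact: le_trans (gmE m x) h.
have L1 : \int[P]_w (H w * gm m (V w)) @[m --> \oo] --> \int[P]_w (H w * g (V w)).
  apply: (bounded_cvg _ (M := 2)) => //.
  - by move=> m; exact: measurable_funM.
  - exact: measurable_funM.
  - move=> m w; rewrite normrM; apply: le_trans (ler_pM (normr_ge0 _) (normr_ge0 _) (H1 w) (gm2 m (V w))) _.
    by rewrite mul1r.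
  - by move=> w; apply: cvgMr.
have L2 : \int[P]_w (H w * gm m (V w)) @[m --> \oo] --> \int[P]_w H w * \int[P]_w g (V w).
  under eq_fun do rewrite E.
  by apply: cvgMr; apply: (bounded_cvg _ (M := 2)).
by rewrite -(cvg_lim _ L1)// -(cvg_lim _ L2).
Qed.

(** The map x |-> (x + 1)/2 brings the values of [g] into [0, 1], and both sides are affine in
    [g]. *)
Lemma integral_indep (H : T -> R) (V : {RV P >-> R}) (g : R -> R) :
  measurable_fun setT H -> (forall w, `|H w| <= 1) ->
  (forall A : set R, measurable A -> \int[P]_w (H w * \1_A (V w)) = \int[P]_w H w * \int[P]_w \1_A (V w)) ->
  measurable_fun setT g -> (forall x, `|g x| <= 1) ->
  \int[P]_w (H w * g (V w)) = \int[P]_w H w * \int[P]_w g (V w).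
Proof.
move=> mH H1 HA mg g1.
have h01 x : 0 <= 2^-1 * (g x + 1) <= 1.
  by have := g1 x; rewrite ler_norml => /andP[? ?]; apply/andP; split; lra.
have mh : measurable_fun setT (fun x : R => 2^-1 * (g x + 1)).
  by apply: measurable_funM => //; exact: measurable_funD.
have iH : P.-integrable setT (EFin \o H) by apply: (@integrable_bounded _ _ _ P H 1).
have ig : P.-integrable setT (EFin \o (fun w => g (V w))).
  by apply: (@integrable_bounded _ _ _ P _ 1) => //; exact: mRV.
have i1 : P.-integrable setT (EFin \o (fun w : T => 1 : R)).
  by apply: (@integrable_bounded _ _ _ P _ 1) => // x; rewrite normr1.
have iHg : P.-integrable setT (EFin \o (fun w => H w * g (V w))).
  apply: (@integrable_bounded _ _ _ P _ 1); first by apply: measurable_funM => //; exact: mRV.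
  by move=> w; rewrite normrM mulr_ile1.
have := integral_indep_unit mH H1 HA mh h01.
have -> : \int[P]_w (H w * (2^-1 * (g (V w) + 1))) = 2^-1 * (\int[P]_w (H w * g (V w)) + \int[P]_w H w).
  rewrite -RintegralD// -RintegralZl//; last exact: integrable_addR.
  by apply: eq_Rintegral => w _; ring.
have -> : \int[P]_w (2^-1 * (g (V w) + 1)) = 2^-1 * (\int[P]_w g (V w) + 1).
  rewrite -[X in _ + X](Rintegral_prob_cst P) -RintegralD// -RintegralZl//; exact: integrable_addR.
by lra.
Qed.

(** Independence is given for events, that is for indicators; the factors are freed one at a time,
    with the product of the others in the role of [H]. *)
Lemma independent_integral n (X : 'I_n -> {RV P >-> R}) (g : 'I_n -> R -> R) :
  independent_rvs X -> (forall i, measurable_fun setT (g i)) -> (forall i x, `|g i x| <= 1) ->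
  \int[P]_w (\prod_(i < n) g i (X i w)) = \prod_(i < n) \int[P]_w g i (X i w).
Proof.
move=> ind.
have ind1 (B : set R) x : `|\1_B x| <= 1 :> R by rewrite indicE; case: (_ \in _); rewrite ?normr1 ?normr0.
(* Factors of index at least k are indicators, those below k are arbitrary; k = 0 is the definition
   of independence. *)
have S k : forall h : 'I_n -> R -> R, (forall i, measurable_fun setT (h i)) -> (forall i x, `|h i x| <= 1) ->
    (forall i : 'I_n, (k <= i)%N -> exists2 A : set R, measurable A & h i = \1_A) ->
    \int[P]_w (\prod_(i < n) h i (X i w)) = \prod_(i < n) \int[P]_w h i (X i w).
  elim: k => [|k IH] h mh h1 hA.
    have /choice[A AP] : forall i, exists A : set R, measurable A /\ h i = \1_A.
      by move=> i; have [A mA E] := hA i (leq0n _); exists A.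
    have mA i : measurable (A i) by have [] := AP i.
    have hE i : h i = \1_(A i) by have [] := AP i.
    have mX i : measurable (X i @^-1` A i) by rewrite -[X in measurable X]setTI; exact: measurable_funPT.
    have := ind A mA.
    have I (B : set T) : measurable B -> P B = (\int[P]_w \1_B w)%:E.
      move=> mB; rewrite -(setIT B) -integral_indic// /Rintegral fineK ?setIT//.
      by apply: integrable_fin_num => //; exact: integrable_indic.
    rewrite I; last by apply: fin_bigcap_measurable => //; exact: finite_finpred.
    under [in RHS]eq_bigr do rewrite I//.
    rewrite prodEFin => -[E].
    transitivity (\int[P]_w \1_(\bigcap_i X i @^-1` A i) w).
      apply: eq_Rintegral => w _; under eq_bigr do rewrite hE.
      rewrite indicE; case: (boolP (w \in _)) => [|].
        rewrite inE => wA; rewrite big1// => i _; rewrite indicE mem_set//; exact: (wA i Logic.I).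
      move=> /negP wA.
      have [i iA] : exists i, ~ A i (X i w).
        by apply/existsNP => wA'; apply: wA; rewrite inE => i _; exact: wA'.
      by rewrite (bigD1 i)//= indicE memNset// mul0r.
    rewrite E; apply: eq_bigr => i _; apply: eq_Rintegral => w _.
    by rewrite hE !indicE.
  have [kn|nk] := ltnP k n; last first.
    by apply: IH => // i ki; have := ltn_ord i; rewrite ltnNge (leq_trans nk ki).
  pose K := Ordinal kn.
  pose h' (A : set R) i := if i == K then \1_A else h i.
  have IHA (A : set R) : measurable A -> \int[P]_w (\prod_(i < n) h' A i (X i w)) = \prod_(i < n) \int[P]_w h' A i (X i w).
    move=> mA; apply: IH.
    - by move=> i; rewrite /h'; case: eqP => // _; exact: measurable_indic.
    - by move=> i x; rewrite /h'; case: eqP.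
    - move=> i ki; rewrite /h'; case: eqP => [_|/eqP iK]; first by exists A.
      by apply: hA; rewrite ltn_neqAle ki andbT; apply: contra iK => /eqP E; apply/eqP/val_inj.
  pose H w := \prod_(i < n | i != K) h i (X i w).
  have mH : measurable_fun setT H.
    rewrite /H; under eq_fun do rewrite big_mkcond; apply: measurable_prod => i _.
    by case: (i != K) => //; exact: mRV.
  have H1 w : `|H w| <= 1.
    by rewrite /H normr_prod; apply: prodr_ile1 => i _; rewrite normr_ge0 h1.
  have HA (A : set R) : measurable A -> \int[P]_w (H w * \1_A (X K w)) =
      (\prod_(i < n | i != K) \int[P]_w h i (X i w)) * \int[P]_w \1_A (X K w).
    have h'K : h' A K = \1_A by rewrite /h' eqxx.
    have h'N i : i != K -> h' A i = h i by move=> /negPf iK; rewrite /h' iK.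
    move=> mA; transitivity (\int[P]_w (\prod_(i < n) h' A i (X i w))).
      apply: eq_Rintegral => w _; rewrite [RHS](bigD1 K)//= h'K mulrC; congr (_ * _).
      by apply: eq_bigr => i iK; rewrite h'N.
    rewrite IHA// (bigD1 K)//= h'K mulrC; congr (_ * _).
    by apply: eq_bigr => i iK; rewrite h'N.
  (* Taking the whole line as the event of the K-th factor gives the integral of the remaining
     product. *)
  have HT : \int[P]_w H w = \prod_(i < n | i != K) \int[P]_w h i (X i w).
    have := HA setT measurableT.
    have -> : \int[P]_w \1_[set: R] (X K w) = 1.
      rewrite -[RHS](Rintegral_prob_cst P); apply: eq_Rintegral => w _.
      by rewrite indicE mem_set.
    rewrite mulr1 => <-; apply: eq_Rintegral => w _.
    by rewrite indicE mem_set// mulr1.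
  rewrite (bigD1 K)//= -HT mulrC -integral_indep//.
    by apply: eq_Rintegral => w _; rewrite (bigD1 K)//= mulrC.
  by move=> A mA; rewrite HA// HT.
move=> mg g1; apply: (S n) => // i; by rewrite leqNgt ltn_ord.
Qed.

(** The product formula for characteristic functions in real form: cosine and sine of the partial
    sums are carried together through the addition formulas, and the sine part stays 0. *)
Lemma independent_gauss_char n (X : 'I_n -> {RV P >-> R}) (c v : 'I_n -> R) :
  independent_rvs X -> (forall i, 0 <= v i) -> (forall i, gaussian_rv (X i) 0 (v i)) ->
  \int[P]_w cos (\sum_(i < n) c i * X i w) = expR (- ((\sum_(i < n) c i ^+ 2 * v i) / 2)) /\
  \int[P]_w sin (\sum_(i < n) c i * X i w) = 0.
Proof.
move=> ind v0 Xg.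
have mc (i : 'I_n) : measurable_fun [set: R] (fun x : R => cos (c i * x)).
  by apply: measurable_cosT; exact: measurable_funM.
have ms (i : 'I_n) : measurable_fun [set: R] (fun x : R => sin (c i * x)).
  by apply: measurable_sinT; exact: measurable_funM.
(* The factors [g i] with i >= k stay free, so that the induction hypothesis can be used with
   [cos (c K * x)] and with [sin (c K * x)] as K-th factor. *)
have S k : (k <= n)%N -> forall g : 'I_n -> R -> R,
    (forall i, measurable_fun setT (g i)) -> (forall i x, `|g i x| <= 1) ->
    \int[P]_w (cos (\sum_(i < n | (i < k)%N) c i * X i w) * \prod_(i < n | (k <= i)%N) g i (X i w)) =
      (\prod_(i < n | (i < k)%N) expR (- (c i ^+ 2 * v i / 2))) * \prod_(i < n | (k <= i)%N) \int[P]_w g i (X i w) /\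
    \int[P]_w (sin (\sum_(i < n | (i < k)%N) c i * X i w) * \prod_(i < n | (k <= i)%N) g i (X i w)) = 0.
  elim: k => [_|k IH kn] g mg g1.
    rewrite big_pred0// mul1r; split.
      rewrite -independent_integral//; apply: eq_Rintegral => w _.
      by rewrite big_pred0// cos0 mul1r.
    under eq_Rintegral do rewrite big_pred0// sin0 mul0r.
    by rewrite Rintegral_prob_cst.
  pose K := Ordinal kn.
  have lt_split (i : 'I_n) : ((i < k.+1)%N && (i != K)) = (i < k)%N.
    by rewrite ltnS ltn_neqAle andbC; congr (_ && _).
  have ge_split (i : 'I_n) : ((k <= i)%N && (i != K)) = (k < i)%N.
    by rewrite [RHS]ltn_neqAle andbC eq_sym; congr (_ && _).
  pose gc (f : R -> R) (i : 'I_n) := if i == K then f else g i.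
  have gcE (f : R -> R) w : \prod_(i < n | (k <= i)%N) gc f i (X i w) = f (X K w) * \prod_(i < n | (k < i)%N) g i (X i w).
    rewrite (bigD1 K)//= {1}/gc eqxx; congr (_ * _); apply: eq_big => // i.
    by rewrite ge_split /gc => /andP[_ /negPf ->] || (move=> /andP[_ /negPf iK]; rewrite /gc iK).
  have gcI (f : R -> R) : \prod_(i < n | (k <= i)%N) \int[P]_w gc f i (X i w) =
     \int[P]_w f (X K w) * \prod_(i < n | (k < i)%N) \int[P]_w g i (X i w).
    rewrite (bigD1 K)//= {1}/gc eqxx; congr (_ * _); apply: eq_big => // i.
    by move=> /andP[_ /negPf iK]; rewrite /gc iK.
  have sumK w : \sum_(i < n | (i < k.+1)%N) c i * X i w = c K * X K w + \sum_(i < n | (i < k)%N) c i * X i w.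
    by rewrite (bigD1 K)//=; congr (_ + _); apply: eq_bigl.
  have hc := IH (ltnW kn) (gc (fun x => cos (c K * x))).
  have hs := IH (ltnW kn) (gc (fun x => sin (c K * x))).
  have {}hc := hc (fun i => ltac:(by rewrite /gc; case: ifP)) (fun i x => ltac:(by rewrite /gc; case: ifP => // _; exact: cos_max)).
  have {}hs := hs (fun i => ltac:(by rewrite /gc; case: ifP)) (fun i x => ltac:(by rewrite /gc; case: ifP => // _; exact: sin_max)).
  have [gcK gsK] := gaussian_char (c K) (v0 K) (Xg K).
  rewrite !gcI gcK in hc; rewrite !gcI gsK mul0r mulr0 in hs.
  pose Pi w := \prod_(i < n | (k < i)%N) g i (X i w).
  pose Si w := \sum_(i < n | (i < k)%N) c i * X i w.
  have mPi : measurable_fun setT Pi.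
    rewrite /Pi; under eq_fun do rewrite big_mkcond; apply: measurable_prod => i _.
    by case: (k < i)%N => //; exact: mRV.
  have Pi1 w : `|Pi w| <= 1.
    by rewrite /Pi normr_prod; apply: prodr_ile1 => i _; rewrite normr_ge0 g1.
  have mSi : measurable_fun setT Si.
    rewrite /Si; under eq_fun do rewrite big_mkcond; apply: measurable_sum => i.
    by case: (i < k)%N => //; exact: measurable_funM.
  have mcS : measurable_fun setT (fun w => cos (Si w)) by exact: measurable_cosT.
  have msS : measurable_fun setT (fun w => sin (Si w)) by exact: measurable_sinT.
  have mcK : measurable_fun setT (fun w => cos (c K * X K w)) by exact: (mRV _ (mc K)).
  have msK : measurable_fun setT (fun w => sin (c K * X K w)) by exact: (mRV _ (ms K)).
  have int3 (f1 f2 : T -> R) : measurable_fun setT f1 -> measurable_fun setT f2 ->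
      (forall w, `|f1 w| <= 1) -> (forall w, `|f2 w| <= 1) -> P.-integrable setT (EFin \o (fun w => f1 w * (f2 w * Pi w))).
    move=> m1 m2 b1 b2; apply: (@integrable_bounded _ _ _ P _ 1).
      by apply: measurable_funM => //; exact: measurable_funM.
    by move=> w; rewrite normrM mulr_ile1// normrM mulr_ile1.
  have icc := int3 _ _ mcS mcK (fun w => cos_max _) (fun w => cos_max _).
  have ics := int3 _ _ mcS msK (fun w => cos_max _) (fun w => sin_max _).
  have isc := int3 _ _ msS mcK (fun w => sin_max _) (fun w => cos_max _).
  have iss := int3 _ _ msS msK (fun w => sin_max _) (fun w => sin_max _).
  move: hc hs; under eq_Rintegral do rewrite gcE -/(Pi _) -/(Si _).
  move=> [hcc hsc].
  under eq_Rintegral do rewrite gcE -/(Pi _) -/(Si _).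
  move=> [hcs hss].
  split.
    transitivity (\int[P]_w (cos (Si w) * (cos (c K * X K w) * Pi w) - sin (Si w) * (sin (c K * X K w) * Pi w))).
      apply: eq_Rintegral => w _; rewrite sumK -/(Si w) -/(Pi w) cosD; ring.
    rewrite RintegralB// hcc.
    have -> : \int[P]_w (sin (Si w) * (sin (c K * X K w) * Pi w)) = 0.
      by rewrite -[RHS]hss; apply: eq_Rintegral => w _; rewrite gcE.
    have -> : \prod_(i < n | (i < k.+1)%N) expR (- (c i ^+ 2 * v i / 2)) =
        expR (- (c K ^+ 2 * v K / 2)) * \prod_(i < n | (i < k)%N) expR (- (c i ^+ 2 * v i / 2)).
      by rewrite (bigD1 K)//=; congr (_ * _); apply: eq_bigl.
    by rewrite subr0; ring.
  transitivity (\int[P]_w (cos (Si w) * (sin (c K * X K w) * Pi w) + sin (Si w) * (cos (c K * X K w) * Pi w))).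
    apply: eq_Rintegral => w _; rewrite sumK -/(Si w) -/(Pi w) sinD; ring.
  rewrite RintegralD// hcs.
  have -> : \int[P]_w (sin (Si w) * (cos (c K * X K w) * Pi w)) = 0.
    by rewrite -[RHS]hsc; apply: eq_Rintegral => w _; rewrite ?gcE.
  by rewrite addr0.
have [h1 h2] := S n (leqnn n) (fun=> cst 1) (fun=> measurable_cst _) (fun _ _ => ltac:(by rewrite normr1)).
have T1 (i : 'I_n) : (i < n)%N = true by rewrite ltn_ord.
have T2 (i : 'I_n) : (n <= i)%N = false by rewrite leqNgt ltn_ord.
split.
  transitivity (\int[P]_w (cos (\sum_(i < n | (i < n)%N) c i * X i w) * \prod_(i < n | (n <= i)%N) (1 : R))).
    by apply: eq_Rintegral => w _; rewrite [X in _ = _ * X]big_pred0// mulr1; congr cos; apply: eq_bigl => i; rewrite T1.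
  rewrite h1 [X in _ * X]big_pred0// mulr1 (eq_bigl xpredT)//.
  rewrite mulr_suml -sumrN expR_sum; by apply: eq_bigr.
rewrite -[RHS]h2; apply: eq_Rintegral => w _.
by rewrite [X in _ = _ * X]big_pred0// mulr1; congr sin; apply: eq_bigl => i; rewrite T1.
Qed.

End independence.

Lemma integrable_normR d (T : measurableType d) (R : realType) (mu : {measure set T -> \bar R}) (D : set T)
  (f : T -> R) : measurable D -> mu.-integrable D (EFin \o f) ->
  mu.-integrable D (EFin \o (fun x => `|f x|)).
Proof. by move=> mD fi; exact: (integrable_abse fi). Qed.

Section L2.
Context d (T : measurableType d) (R : realType) (mu : {measure set T -> \bar R}).

Lemma L2_small (h : nat -> T -> R) (e : R) : 0 < e ->
  ('N[mu]_2%:E[EFin \o (h n)] @[n --> \oo] --> 0)%E ->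
  \forall n \near \oo, (\int[mu]_x ((h n x) ^+ 2)%:E <= e%:E)%E.
Proof.
move=> e0 /fine_cvgP[fin lim].
have se0 : 0 < Num.sqrt e by rewrite sqrtr_gt0.
have /cvgr0Pnorm_le/(_ _ se0) small := lim.
near=> n.
have fn : ('N[mu]_2%:E[EFin \o (h n)])%E \is a fin_num by near: n.
have sn : `|fine ('N[mu]_2%:E[EFin \o (h n)])%E| <= Num.sqrt e by near: n.
have NE : ('N[mu]_2%:E[EFin \o (h n)] = (\int[mu]_x ((h n x) ^+ 2)%:E) `^ 2^-1)%E.
  rewrite unlock /=; congr (_ `^ _)%E; apply: eq_integral => x _ /=.
  by rewrite powR_mulrn// real_normK// num_real.
move: fn sn; rewrite NE.
have I0 : (0 <= \int[mu]_x ((h n x) ^+ 2)%:E)%E by apply: integral_ge0 => x _; rewrite lee_fin sqr_ge0.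
case: (\int[mu]_x _)%E I0 => [r| |]//=; last by rewrite invr_eq0 pnatr_eq0.
rewrite !lee_fin => r0 _; rewrite powR12_sqrt// ger0_norm ?sqrtr_ge0// => h1.
by rewrite -(ler_sqrt _ (ltW e0)).
Unshelve. all: by end_near. Qed.

Lemma integrable_sqr_sub (f g : T -> R) : measurable_fun setT f -> measurable_fun setT g ->
  mu.-integrable setT (EFin \o (fun x => f x ^+ 2)) ->
  mu.-integrable setT (EFin \o (fun x => g x ^+ 2)) ->
  mu.-integrable setT (EFin \o (fun x => (f x - g x) ^+ 2)).
Proof.
move=> mf mg if2 ig2.
have i2 : mu.-integrable setT (EFin \o (fun x => 2 * f x ^+ 2 + 2 * g x ^+ 2)).
  by apply: integrable_addR => //; exact: integrable_scaleR.
apply: le_integrable i2 => //.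
  by apply/measurable_EFinP; apply: measurable_funX; exact: measurable_funB.
move=> x _ /=; rewrite lee_fin ger0_norm ?sqr_ge0// ger0_norm.
  by have := sqr_ge0 (f x + g x); nra.
by rewrite addr_ge0// mulr_ge0// sqr_ge0.
Qed.

(** Rests on |a^2 - b^2| <= eta a^2 + (1 + 1/eta) (a - b)^2, which refers to the limit alone and so
    asks for no uniform bound on the norms of the [g n]. *)
Lemma L2_sqr_cvg (f : T -> R) (g : nat -> T -> R) : measurable_fun setT f -> (forall n, measurable_fun setT (g n)) ->
  mu.-integrable setT (EFin \o (fun x => f x ^+ 2)) ->
  (forall n, mu.-integrable setT (EFin \o (fun x => g n x ^+ 2))) ->
  ('N[mu]_2%:E[EFin \o (f \- g n)%R] @[n --> \oo] --> 0)%E ->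
  \int[mu]_x (g n x ^+ 2) @[n --> \oo] --> \int[mu]_x (f x ^+ 2).
Proof.
move=> mf mg if2 ig2 lim; apply/cvgrPdist_le => e e0.
set V : R := \int[mu]_x (f x ^+ 2).
have V0 : 0 <= V by apply: Rintegral_ge0 => x _; exact: sqr_ge0.
(* [eta] makes the first term at most e/2, and [dl] does the same for the second. *)
pose eta : R := e / (2 * (V + 1)).
have eta0 : 0 < eta by rewrite divr_gt0// mulr_gt0//; lra.
pose dl : R := e / (2 * (1 + eta^-1)).
have ie0 : 0 < eta^-1 by rewrite invr_gt0.
have dl0 : 0 < dl by rewrite divr_gt0// mulr_gt0//; lra.
have small := L2_small dl0 lim.
apply: filterS small => n small.
have id2 := integrable_sqr_sub mf (mg n) if2 (ig2 n).
have D : \int[mu]_x ((f x - g n x) ^+ 2) <= dl.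
  by rewrite -lee_fin /Rintegral fineK//; exact: integrable_fin_num.
have iw : mu.-integrable setT (EFin \o (fun x => eta * f x ^+ 2 + (1 + eta^-1) * (f x - g n x) ^+ 2)).
  by apply: integrable_addR => //; exact: integrable_scaleR.
have W : \int[mu]_x (eta * f x ^+ 2 + (1 + eta^-1) * (f x - g n x) ^+ 2) = eta * V + (1 + eta^-1) * \int[mu]_x ((f x - g n x) ^+ 2).
  by rewrite RintegralD//; [rewrite !RintegralZl//|exact: integrable_scaleR|exact: integrable_scaleR].
have Wle : \int[mu]_x (eta * f x ^+ 2 + (1 + eta^-1) * (f x - g n x) ^+ 2) <= e.
  have h1 : eta * V <= e / 2.
    rewrite /eta mulrAC ler_pdivrMr; last by rewrite mulr_gt0//; lra.
    by rewrite (_ : e / 2 * (2 * (V + 1)) = e * V + e); [lra|field].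
  have h2 : (1 + eta^-1) * dl = e / 2.
    have q0 : 1 + eta^-1 != 0 by rewrite gt_eqF//; lra.
    by rewrite /dl; move: (1 + eta^-1) q0 => q q0; field.
  have : (1 + eta^-1) * \int[mu]_x ((f x - g n x) ^+ 2) <= (1 + eta^-1) * dl by rewrite ler_pM2l//; lra.
  by rewrite W; lra.
have point (a b : R) : `|a ^+ 2 - b ^+ 2| <= eta * a ^+ 2 + (1 + eta^-1) * (a - b) ^+ 2.
  have E : eta * a ^+ 2 + eta^-1 * (a - b) ^+ 2 - 2 * (a * (a - b)) = eta * (a - eta^-1 * (a - b)) ^+ 2.
    by field; rewrite gt_eqF.
  have E' : eta * a ^+ 2 + eta^-1 * (a - b) ^+ 2 + 2 * (a * (a - b)) = eta * (a + eta^-1 * (a - b)) ^+ 2.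
    by field; rewrite gt_eqF.
  have p1 : 0 <= eta * (a - eta^-1 * (a - b)) ^+ 2 by rewrite mulr_ge0 ?sqr_ge0// ltW.
  have p2 : 0 <= eta * (a + eta^-1 * (a - b)) ^+ 2 by rewrite mulr_ge0 ?sqr_ge0// ltW.
  rewrite -E in p1; rewrite -E' in p2.
  have F : a ^+ 2 - b ^+ 2 = 2 * (a * (a - b)) - (a - b) ^+ 2 by ring.
  have q := sqr_ge0 (a - b).
  rewrite F ler_norml mulrDl mul1r; move: (eta^-1 * (a - b) ^+ 2) (eta * a ^+ 2) ((a - b) ^+ 2) (a * (a - b)) p1 p2 q => x y z t p1 p2 q.
  by apply/andP; split; lra.
rewrite -RintegralB//.
apply: le_trans (le_normr_Rintegral _ _) _ => //.
  by apply: integrable_subR.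
apply: le_trans Wle; apply: le_Rintegral => //.
by apply: integrable_normR => //; exact: integrable_subR.
Qed.

End L2.

(** All end points are sorted into one partition, and each cell receives the coefficients of the
    intervals covering it. Arbitrary increments of [G] let the same cells serve the step function,
    with G u the indicator of x <= u, and its integral, with G u = B u w. *)
Lemma step_partition (R : realType) (s : seq (R * R * R)) : (forall p, p \in s -> p.1.1 <= p.1.2) ->
  exists n (t : nat -> R) (c : 'I_n -> R), {homo t : i j / (i <= j)%N >-> i <= j} /\
   forall G : R -> R, \sum_(p <- s) p.2 * (G p.1.2 - G p.1.1) = \sum_(k < n) c k * (G (t k.+1) - G (t k)).
Proof.
move=> s_le.
pose pts := sort <=%R ([seq p.1.1 | p <- s] ++ [seq p.1.2 | p <- s]).
have st : sorted <=%R pts by apply: sort_sorted; exact: le_total.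
(* Past the end of the list [t] keeps the last point, so it stays monotone and the cell added at the
   end is empty. *)
pose t k := nth (last 0 pts) pts k.
have in1 p : p \in s -> p.1.1 \in pts by move=> ps; rewrite mem_sort mem_cat (map_f (fun p => p.1.1)).
have in2 p : p \in s -> p.1.2 \in pts by move=> ps; rewrite mem_sort mem_cat (map_f (fun p => p.1.2)) ?orbT.
have tmono : {homo t : i j / (i <= j)%N >-> i <= j}.
  move=> i j ij; rewrite /t.
  have [js|sj] := ltnP j (size pts).
    by apply: (sorted_leq_nth le_trans le_refl) => //; rewrite inE ?(leq_ltn_trans ij).
  rewrite [leRHS]nth_default//.
  have [is_|si] := ltnP i (size pts); last by rewrite nth_default.
  have El : last 0 pts = t (size pts).-1.
    transitivity (nth 0 pts (size pts).-1); first by rewrite nth_last.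
    by apply: set_nth_default; rewrite prednK// (leq_trans _ is_).
  apply: (@le_trans _ _ (t (size pts).-1)); last by rewrite -El.
  have pl : ((size pts).-1 < size pts)%N by rewrite prednK// (leq_trans _ is_).
  have il : (i <= (size pts).-1)%N by rewrite -ltnS prednK// (leq_trans _ is_).
  exact: (sorted_leq_nth le_trans le_refl).
have tidx x : x \in pts -> t (index x pts) = x by move=> xp; rewrite /t nth_index.
pose lo (p : R * R * R) := index p.1.1 pts; pose hi (p : R * R * R) := index p.1.2 pts.
exists (size pts), t, (fun k => \sum_(p <- s) p.2 * ((lo p <= k < hi p)%N)%:R); split => // G.
under [RHS]eq_bigr do rewrite mulr_suml.
rewrite exchange_big/=; apply: eq_big_seq => p ps.
have lohi : (lo p <= hi p)%N.
  rewrite leqNgt; apply/negP => hl; have := tmono _ _ (ltnW hl); rewrite !tidx ?in1 ?in2// => h.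
  have E : p.1.1 = p.1.2 by apply/eqP; rewrite eq_le h s_le.
  by move: hl; rewrite /lo /hi E ltnn.
have his : (hi p <= size pts)%N by exact: index_size.
under [RHS]eq_bigr do rewrite -mulrA.
rewrite -mulr_sumr; congr (_ * _).
rewrite -[in LHS](tidx _ (in1 _ ps)) -[in LHS](tidx _ (in2 _ ps)) -/(lo p) -/(hi p).
rewrite -(telescope_sumr (fun k => G (t k)) lohi).
rewrite (big_nat_widen _ _ _ _ _ his) (big_nat_widenl _ _ _ _ _ (leq0n (lo p))) big_mkord big_mkcond/=.
apply: eq_bigr => k _; rewrite [X in if X then _ else _]andbC; case: (_ && _); by rewrite ?mul1r ?mul0r.
Qed.

Section steps.
Context {R : realType}.
Local Notation mu := (@lebesgue_measure R).

Lemma indic_itv_split (a b x : R) : a <= b ->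
  \1_`]a, b] x = (x <= b)%R%:R - (x <= a)%R%:R :> R.
Proof.
move=> ab; rewrite indicE.
have -> : (x \in `]a, b]%classic) = (a < x) && (x <= b).
  by apply/idP/idP; rewrite inE/= in_itv/=.
case: (leP x a) => /= xa; last by rewrite subr0.
by rewrite (le_trans xa ab) subrr.
Qed.

(** The cells are disjoint, so no cross products survive. *)
Lemma step_sqr n (t : nat -> R) (c : 'I_n -> R) x : {homo t : i j / (i <= j)%N >-> i <= j} ->
  (\sum_(k < n) c k * ((x <= t k.+1)%R%:R - (x <= t k)%R%:R)) ^+ 2 =
  \sum_(k < n) c k ^+ 2 * ((x <= t k.+1)%R%:R - (x <= t k)%R%:R).
Proof.
move=> tm; pose dd (k : 'I_n) : R := (x <= t k.+1)%R%:R - (x <= t k)%R%:R.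
have d01 (k : 'I_n) : dd k = ((t k < x) && (x <= t k.+1))%:R.
  rewrite /dd; have := tm k k.+1 (leqnSn _).
  case: (leP x (t k)) => /= xt h; last by rewrite subr0.
  by rewrite (le_trans xt h) subrr.
have d0 (k l : 'I_n) : k != l -> dd k * dd l = 0.
  have main (i j : 'I_n) : (i < j)%N -> dd i * dd j = 0.
    move=> ij; rewrite !d01; case: (leP x (t i.+1)) => /= h; last by rewrite andbF mul0r.
    have -> : (t j < x) = false by rewrite ltNge (le_trans h (tm _ _ ij)).
    by rewrite mulr0.
  by move=> kl; have [|lk|E] := ltngtP k l; [exact: main|rewrite mulrC; exact: main|move: kl; rewrite -val_eqE/= E eqxx].
have dsq (k : 'I_n) : dd k * dd k = dd k by rewrite d01; case: (_ && _); rewrite ?mul1r ?mul0r.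
rewrite expr2 big_distrlr/=; apply: eq_bigr => k _.
rewrite (bigD1 k)//= big1 ?addr0 => [|l lk].
  by rewrite -/(dd k) mulrACA dsq expr2.
by rewrite -/(dd k) -/(dd l) mulrACA d0 ?mulr0// eq_sym.
Qed.

Lemma step_funE (s : seq (R * R * R)) x : (forall p, p \in s -> p.1.1 <= p.1.2) ->
  step_fun s x = \sum_(p <- s) p.2 * ((x <= p.1.2)%R%:R - (x <= p.1.1)%R%:R).
Proof. by move=> sle; apply: eq_big_seq => p ps; rewrite indic_itv_split// sle. Qed.

Lemma integral_itv_ind (a b : R) : a <= b ->
  mu.-integrable setT (EFin \o (fun x => (x <= b)%R%:R - (x <= a)%R%:R)) /\
  \int[mu]_x ((x <= b)%R%:R - (x <= a)%R%:R) = b - a.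
Proof.
move=> ab.
have E : (fun x : R => (x <= b)%R%:R - (x <= a)%R%:R) = \1_`]a, b] :> (R -> R).
  by apply/funext => x; rewrite indic_itv_split.
have fi : (mu `]a, b]%classic < +oo)%E by rewrite lebesgue_measure_itv/=; case: ifP => //; rewrite ltry.
rewrite E; split; first exact: (integrable_indic_itv a b false false).
have Ei : (\int[mu]_x (\1_`]a, b] x)%:E = mu `]a, b]%classic)%E by rewrite integral_indic// setIT.
rewrite /Rintegral Ei lebesgue_measure_itv/= lte_fin.
by move: ab; rewrite le_eqVlt => /predU1P[->|->]//; rewrite ltxx subrr.
Qed.

Lemma measurable_step_fun (s : seq (R * R * R)) : measurable_fun setT (step_fun s).
Proof.
rewrite /step_fun; apply: measurable_sum => p; apply: measurable_funM => //.
Qed.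

End steps.

Section wiener.
Context d (T : measurableType d) (R : realType) (P : probability T R).
Local Notation mu := (@lebesgue_measure R).
Variable B : R -> {RV P >-> R}.
Hypothesis hB : brownian_motion B.

(** On the refined partition the integral is a combination of independent Gaussian increments, whose
    variance is the integral of the squared step function: the isometry on step functions. *)
Lemma step_char (s : seq (R * R * R)) (l : R) : (forall p, p \in s -> p.1.1 <= p.1.2) ->
  [/\ mu.-integrable setT (EFin \o (fun x => step_fun s x ^+ 2)),
   \int[P]_w cos (l * step_int B s w) = expR (- (l ^+ 2 * \int[mu]_x (step_fun s x ^+ 2) / 2)) &
   \int[P]_w sin (l * step_int B s w) = 0].
Proof.
move=> sle; have [n [t [c [tm tE]]]] := step_partition sle.
have [_ gB iB _] := hB.
have sq x : step_fun s x ^+ 2 = \sum_(k < n) c k ^+ 2 * ((x <= t k.+1)%R%:R - (x <= t k)%R%:R).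
  by rewrite step_funE// (tE (fun u => (x <= u)%R%:R)) step_sqr.
have ik (k : 'I_n) := integral_itv_ind (tm _ _ (leqnSn k)).
have i1 (k : 'I_n) : mu.-integrable setT (EFin \o (fun x => c k ^+ 2 * ((x <= t k.+1)%R%:R - (x <= t k)%R%:R))).
  by apply: integrable_scaleR => //; have [] := ik k.
have isq : mu.-integrable setT (EFin \o (fun x => step_fun s x ^+ 2)).
  by under eq_fun do rewrite sq; apply: integrable_sumR => // k _; exact: i1.
have I2 : \int[mu]_x (step_fun s x ^+ 2) = \sum_(k < n) c k ^+ 2 * (t k.+1 - t k).
  under eq_Rintegral do rewrite sq.
  rewrite Rintegral_sum//; apply: eq_bigr => k _.
  by have [h1 h2] := ik k; rewrite RintegralZl// h2.
have SE w : l * step_int B s w = \sum_(k < n) (l * c k) * (B (t k.+1) - B (t k) : {RV P >-> R}) w.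
  rewrite /step_int (tE (fun u => B u w)) mulr_sumr; apply: eq_bigr => k _.
  by rewrite mulrA.
have v0 (k : 'I_n) : 0 <= t k.+1 - t k by rewrite subr_ge0 tm.
have gk (k : 'I_n) : gaussian_rv (B (t k.+1) - B (t k) : {RV P >-> R}) 0 (t k.+1 - t k).
  by apply: gB; exact: tm.
have [h1 h2] := independent_gauss_char (fun k : 'I_n => l * c k) (iB n t tm) v0 gk.
split=> //.
  under eq_Rintegral do rewrite SE.
  rewrite h1 I2; congr (expR (- (_ / 2))); rewrite mulr_sumr; apply: eq_bigr => k _; ring.
by under eq_Rintegral do rewrite SE.
Qed.

Lemma cos_lip (x y : R) : `|cos x - cos y| <= `|x - y|.
Proof.
wlog xy : x y / x < y => [hw|].
  have [|yx|->] := ltgtP x y; [exact: hw|by rewrite distrC (distrC x); exact: hw|by rewrite !subrr].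
have [|c _ E] := @MVT_segment R cos (fun z => - sin z) x y (ltW xy).
- by apply: continuous_subspaceT => z; exact: continuous_cos.
rewrite distrC E normrM normrN (distrC x); rewrite -[leRHS]mul1r ler_wpM2r//; exact: sin_max.
Qed.

Lemma sin_lip (x y : R) : `|sin x - sin y| <= `|x - y|.
Proof.
wlog xy : x y / x < y => [hw|].
  have [|yx|->] := ltgtP x y; [exact: hw|by rewrite distrC (distrC x); exact: hw|by rewrite !subrr].
have [|c _ E] := @MVT_segment R sin cos x y (ltW xy).
- by apply: continuous_subspaceT => z; exact: continuous_sin.
rewrite distrC E normrM (distrC x); rewrite -[leRHS]mul1r ler_wpM2r//; exact: cos_max.
Qed.

(** The difference is at most |l| times the mean of |Z - S_n|, and |y| <= k + y^2/k takes the place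
    of Cauchy-Schwarz. *)
Lemma L2_lip_cvg (phi : R -> R) (Z : {RV P >-> R}) (S : nat -> T -> R) (l : R) :
  (forall n, measurable_fun setT (S n)) -> measurable_fun setT phi -> (forall x, `|phi x| <= 1) ->
  (forall x y, `|phi x - phi y| <= `|x - y|) ->
  ('N[P]_2%:E[EFin \o (Z \- S n)%R] @[n --> \oo] --> 0)%E ->
  \int[P]_w phi (l * S n w) @[n --> \oo] --> \int[P]_w phi (l * Z w).
Proof.
move=> mS mphi phi1 lip lim; apply/cvgrPdist_le => e e0.
(* Chosen so that (|l| + 1) (k + k) = e. *)
pose k : R := e / (2 * (`|l| + 1)).
have l0 := normr_ge0 l.
have k0 : 0 < k by rewrite divr_gt0// mulr_gt0//; lra.
have k20 : 0 < k ^+ 2 by rewrite exprn_gt0.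
apply: filterS (L2_small k20 lim) => n small.
have mD : measurable_fun setT (fun w => (Z w - S n w) ^+ 2).
  by apply: measurable_funX; exact: measurable_funB.
have iD : P.-integrable setT (EFin \o (fun w => (Z w - S n w) ^+ 2)).
  apply/integrableP; split; first exact/measurable_EFinP.
  apply: le_lt_trans (ltry (k ^+ 2)); apply: le_trans small.
  rewrite le_eqVlt; apply/orP; left; apply/eqP; apply: eq_integral => w _ /=.
  by rewrite ger0_norm// sqr_ge0.
have D : \int[P]_w ((Z w - S n w) ^+ 2) <= k ^+ 2.
  by rewrite -lee_fin /Rintegral fineK//; exact: integrable_fin_num.
have intb (f : T -> R) : measurable_fun setT f -> P.-integrable setT (EFin \o (fun w => phi (l * f w))).
  move=> mf; apply: (@integrable_bounded _ _ _ P _ 1) => //.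
  by apply: (measurableT_comp mphi); exact: measurable_funM.
have iZ := intb _ (measurable_funPT Z); have iS := intb _ (mS n).
have ik : P.-integrable setT (EFin \o (fun w : T => k)).
  by apply: (@integrable_bounded _ _ _ P _ `|k|).
have ib : P.-integrable setT (EFin \o (fun w => `|l| * (k + k^-1 * (Z w - S n w) ^+ 2))).
  apply: integrable_scaleR => //; apply: integrable_addR => //; exact: integrable_scaleR.
rewrite -RintegralB//; apply: le_trans (le_normr_Rintegral _ _) _ => //.
  exact: integrable_subR.
apply: (@le_trans _ _ (\int[P]_w (`|l| * (k + k^-1 * (Z w - S n w) ^+ 2)))).
  apply: le_Rintegral => //.
    by apply: integrable_normR => //; exact: integrable_subR.
  move=> w _; apply: le_trans (lip _ _) _; rewrite -mulrBr normrM ler_wpM2l//.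
  rewrite -(real_normK (num_real (Z w - S n w))); move: `|Z w - S n w| => y.
  have -> : k + k^-1 * y ^+ 2 = y + k^-1 * ((y - k / 2) ^+ 2 + 3 / 4 * k ^+ 2) by field; rewrite gt_eqF.
  by rewrite lerDl mulr_ge0 ?invr_ge0 ?(ltW k0)// addr_ge0 ?sqr_ge0// mulr_ge0// ltW.
rewrite RintegralZl//; last by apply: integrable_addR => //; exact: integrable_scaleR.
rewrite RintegralD//; last exact: integrable_scaleR.
rewrite Rintegral_prob_cst RintegralZl//.
have h : k^-1 * \int[P]_w ((Z w - S n w) ^+ 2) <= k by rewrite ler_pdivrMl// -expr2.
apply: (@le_trans _ _ (`|l| * (k + k))); first by rewrite ler_wpM2l// lerD2l.
have -> : e = (`|l| + 1) * (k + k) by rewrite /k; field; rewrite gt_eqF//; lra.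
by rewrite ler_wpM2r ?addr_ge0 ?(ltW k0)// lerDl.
Qed.

(** The transforms of the step integrals converge to those of [Z], and their variances, the squared
    norms of the step functions, to the squared norm of [f]; the characteristic function then
    identifies the law. *)
Lemma wiener_gaussian (f : R -> R) (Z : {RV P >-> R}) : wiener_integral B f Z ->
  mu.-integrable setT (EFin \o (fun x => f x ^+ 2)) ->
  gaussian_rv Z 0 (\int[mu]_x (f x ^+ 2)).
Proof.
move=> [mf [s [sle limf limZ]]] if2.
have N_cvg : \int[mu]_x (step_fun (s n) x ^+ 2) @[n --> \oo] --> \int[mu]_x (f x ^+ 2).
  apply: L2_sqr_cvg => //; first by move=> n; exact: measurable_step_fun.
  by move=> n; have [] := step_char 0 (sle n).
have mS n : measurable_fun setT (step_int B (s n)).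
  rewrite /step_int; apply: measurable_sum => p; apply: measurable_funM => //.
  exact: measurable_funB.
have mcos : measurable_fun [set: R] (@cos R) by exact: measurable_cosT.
have msin : measurable_fun [set: R] (@sin R) by exact: measurable_sinT.
apply: gauss_char_law; first by apply: Rintegral_ge0 => x _; exact: sqr_ge0.
  move=> l; have L1 := L2_lip_cvg (l := l) mS mcos (@cos_max R) cos_lip limZ.
  have L2 : \int[P]_w cos (l * step_int B (s n) w) @[n --> \oo] --> expR (- (l ^+ 2 * \int[mu]_x (f x ^+ 2) / 2)).
    have E n : \int[P]_w cos (l * step_int B (s n) w) = expR (- (l ^+ 2 * \int[mu]_x (step_fun (s n) x ^+ 2) / 2)).
      by have [] := step_char l (sle n).
    under eq_fun do rewrite E.
    have EX : - (l ^+ 2 * \int[mu]_x (step_fun (s n) x ^+ 2) / 2) @[n --> \oo] --> - (l ^+ 2 * \int[mu]_x (f x ^+ 2) / 2).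
      by apply: cvgN; apply: cvgMl; apply: cvgMr.
    exact: (cvg_comp _ _ EX (@continuous_expR R _)).
  by rewrite -(cvg_lim _ L1)// -(cvg_lim _ L2).
move=> l; have L1 := L2_lip_cvg (l := l) mS msin (@sin_max R) sin_lip limZ.
rewrite -(cvg_lim _ L1)//.
have E n : \int[P]_w sin (l * step_int B (s n) w) = 0 by have [] := step_char l (sle n).
by under eq_fun do rewrite E; rewrite lim_cst.
Qed.

End wiener.

(** * Norm of the kernel *)

Section kernel.
Context {R : realType}.
Local Notation mu := (@lebesgue_measure R).
Local Notation p := (@pos_powR R).

Lemma pos_powR_ge0 (y b : R) : 0 <= p y b.
Proof. by rewrite /pos_powR; case: ifP => // _; exact: powR_ge0. Qed.

Lemma pos_powR_gt0E (y b : R) : 0 < y -> p y b = y `^ b.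
Proof. by rewrite /pos_powR => ->. Qed.

Lemma pos_powR_le0 (y b : R) : y <= 0 -> p y b = 0.
Proof. by rewrite /pos_powR ltNge => ->. Qed.

Lemma pos_powRM (c y b : R) : 0 < c -> p (c * y) b = c `^ b * p y b.
Proof.
move=> c0; rewrite /pos_powR pmulr_rgt0//; case: ifP => [y0|_]; last by rewrite mulr0.
by rewrite powRM// ltW.
Qed.

Lemma measurable_pos_powR (b : R) : measurable_fun setT (fun y : R => p y b).
Proof.
apply: measurable_fun_ifT; last exact: measurable_cst.
  exact: measurable_fun_ltr.
exact: measurable_powR.
Qed.

Let m2 := (measurableTypeR R * measurableTypeR R)%type.

Lemma tonelli (f : R -> R -> R) : measurable_fun setT (fun z : m2 => f z.1 z.2) ->
  (forall x y, 0 <= f x y) ->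
  (\int[mu]_x \int[mu]_y (f x y)%:E = \int[mu]_y \int[mu]_x (f x y)%:E)%E.
Proof.
move=> mf f0.
apply: (@fubini_tonelli _ _ (measurableTypeR R) (measurableTypeR R) R mu mu (fun z => (f z.1 z.2)%:E)).
  exact/measurable_EFinP.
by move=> z; rewrite lee_fin.
Qed.

(** The possible singularity at 0 is handled by monotone convergence along [c/(n+2), c]; n + 2 keeps
    the left end strictly below c. *)
Lemma powR_integral_pos (b c : R) : b < 1 -> 0 < c ->
  (\int[mu]_(w in `]0%R, c]) (w `^ (- b))%:E = (c `^ (1 - b) / (1 - b))%:E)%E.
Proof.
move=> b1 c0; have b1' : 0 < 1 - b by lra.
pose F (y : R) : R := y `^ (1 - b) / (1 - b).
pose I (n : nat) : set R := `[c / n.+2%:R, c]%classic.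
have cn n : 0 < c / n.+2%:R by rewrite divr_gt0.
have cnc n : c / n.+2%:R < c by rewrite ltr_pdivrMr// ltr_pMr// ltr1n.
have dF (y : R) : 0 < y -> is_derive y (1 : R) F (y `^ (- b)).
  move=> y0; have h := is_derive1_powR (1 - b) y0.
  have -> : y `^ (- b) = (1 - b)^-1 *: ((1 - b) * y `^ (1 - b - 1)).
    rewrite /GRing.scale/= mulKf ?gt_eqF//; congr (_ `^ _); ring.
  have -> : F = (1 - b)^-1 \*: (powR (R:=R))^~ (1 - b).
    by apply/funext => z; rewrite /F mulrC.
  exact: is_deriveZ.
have IE n : (\int[mu]_(w in I n) (w `^ (- b))%:E = (F c - F (c / n.+2%:R))%:E)%E.
  rewrite EFinB; apply: continuous_FTC2 => //.
  - apply: continuous_in_subspaceT => y; rewrite inE/= in_itv/= => /andP[h _].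
    have y0 : 0 < y by exact: lt_le_trans h.
    apply: differentiable_continuous; apply/derivable1_diffP.
    by have [] := is_derive1_powR (- b) y0.
  - split.
    + by move=> y; rewrite in_itv/= => /andP[h _]; have [] := dF y (lt_trans (cn n) h).
    + apply: cvg_at_right_filter; apply: differentiable_continuous; apply/derivable1_diffP.
      by have [] := dF _ (cn n).
    + apply: cvg_at_left_filter; apply: differentiable_continuous; apply/derivable1_diffP.
      by have [] := dF _ c0.
  - move=> y; rewrite in_itv/= => /andP[h _].
    by rewrite derive1E; have [_ ->] := dF y (lt_trans (cn n) h).
have UI : `]0, c]%classic = \bigcup_n I n.
  apply/seteqP; split=> y /=; rewrite ?in_itv/=.
    move=> /andP[y0 yc].
    have [N _ NP] : \forall n \near \oo, c / y <= n%:R by exact: nbhs_infty_ger.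
    exists N => //; rewrite /I/= in_itv/= yc andbT ler_pdivrMr// mulrC -ler_pdivrMr//.
    by apply: le_trans (NP N (leqnn _)) _; rewrite ler_nat ltnW.
  by move=> [n _]; rewrite /I/= in_itv/= => /andP[h ->]; rewrite (lt_le_trans (cn n) h).
have mono : {homo I : n m / (n <= m)%N >-> (n <= m)%O}.
  move=> n m nm; apply/subsetPset => y; rewrite /I/= !in_itv/= => /andP[h ->]; rewrite andbT.
  by apply: le_trans h; rewrite ler_pM2l// lef_pV2 ?posrE// ler_nat.
have lim : (\int[mu]_(w in I n) (w `^ (- b))%:E)%E @[n --> \oo] --> (\int[mu]_(w in \bigcup_n I n) (w `^ (- b))%:E)%E.
  apply: (@ge0_nondecreasing_set_cvg_integral _ (measurableTypeR R) R I (fun w => (w `^ (- b))%:E) mu mono).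
  - by move=> n; exact: measurable_itv.
  - by move=> n; apply: measurable_funTS; apply/measurable_EFinP; exact: measurable_powR.
  - by move=> n x _; rewrite lee_fin powR_ge0.
have lim2 : (\int[mu]_(w in I n) (w `^ (- b))%:E)%E @[n --> \oo] --> (c `^ (1 - b) / (1 - b))%:E.
  under eq_fun do rewrite IE.
  apply: cvg_EFin; first by apply: nearW.
  have -> : c `^ (1 - b) / (1 - b) = F c - 0 by rewrite subr0.
  apply: cvgB; first exact: cvg_cst.
  have -> : (fun n : nat => F (c / n.+2%:R)) = (fun n => c `^ (1 - b) / (1 - b) * (n.+2)%:R `^ (- (1 - b))).
    apply/funext => n; rewrite /F powRM ?invr_ge0 ?(ltW c0)//.
    by rewrite -(powR_inv1 (ler0n _ _)) -powRrM mulN1r; ring.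
  rewrite -[X in _ --> X](mulr0 (c `^ (1 - b) / (1 - b))); apply: cvgMr.
  have := powRN_cvg0 b1'; rewrite -(cvg_shiftS (fun n => n%:R `^ (- (1 - b)))).
  by rewrite -(cvg_shiftS (fun n => n.+1%:R `^ (- (1 - b)))).
rewrite UI -(cvg_lim (@ereal_hausdorff R) lim); exact: (cvg_lim (@ereal_hausdorff R) lim2).
Qed.

Lemma pos_powR_integral (b c : R) : b < 1 -> 0 <= c ->
  (\int[mu]_w (\1_`]0, c] w * p w (- b))%:E = (c `^ (1 - b) / (1 - b))%:E)%E.
Proof.
move=> b1; rewrite le_eqVlt => /predU1P[<-|c0].
  rewrite powR0 ?gt_eqF ?subr_gt0// mul0r integral0_eq// => w _.
  by rewrite set_itvoc0 indic0 mul0r.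
rewrite -powR_integral_pos// [RHS]integral_mkcond; apply: eq_integral => w _.
rewrite patchE indicE; case: ifPn => [|_]; last by rewrite mul0r.
by rewrite inE/= in_itv/= => /andP[w0 _]; rewrite mul1r pos_powR_gt0E.
Qed.

(** The Gamma integral in the extended reals and over the whole line, so that Tonelli's theorem
    applies before finiteness is known. *)
Definition gammaE (a : R) : \bar R := (\int[mu]_x (p x (a - 1) * expR (- x))%:E)%E.

Let mexp (c : R) : measurable_fun setT (fun x : R => expR (- (c * x))).
Proof.
apply: (measurableT_comp (continuous_measurable_fun (@continuous_expR R))).
by apply: measurable_funN; exact: measurable_funM.
Qed.

Let mgam (a c : R) : measurable_fun setT (fun x : R => p x (a - 1) * expR (- (c * x))).
Proof. by apply: measurable_funM => //; exact: measurable_pos_powR. Qed.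

Let gam_ge0 (a c x : R) : 0 <= p x (a - 1) * expR (- (c * x)).
Proof. by rewrite mulr_ge0 ?pos_powR_ge0 ?expR_ge0. Qed.

Lemma gammaE_ge0 a : (0 <= gammaE a)%E.
Proof. by apply: integral_ge0 => x _; rewrite lee_fin mulr_ge0 ?pos_powR_ge0 ?expR_ge0. Qed.

Lemma gammaE_scale (a c : R) : 0 < c ->
  (\int[mu]_y (p y (a - 1) * expR (- (c * y)))%:E = (c `^ (- a))%:E * gammaE a)%E.
Proof.
move=> c0; have cn0 : c != 0 by rewrite gt_eqF.
have mf : measurable_fun setT (fun x : R => (p x (a - 1) * expR (- x))%:E).
  by apply/measurable_EFinP; have := mgam a 1; under eq_fun do rewrite mul1r.
have f0 x : (0 <= (p x (a - 1) * expR (- x))%:E)%E.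
  by rewrite lee_fin mulr_ge0 ?pos_powR_ge0 ?expR_ge0.
have := ge0_integral_affine 0 cn0 mf f0.
under eq_integral do rewrite addr0 pos_powRM// -mulrA EFinM.
rewrite ge0_integralZl//; last 3 first.
- by apply/measurable_EFinP; exact: mgam.
- by move=> x _; rewrite lee_fin.
- by rewrite lee_fin powR_ge0.
move=> E; have -> : c `^ (- a) = c `^ (1 - a) * `|c|^-1.
  rewrite gtr0_norm// -(powR_inv1 (ltW c0)) -powRD; last by apply/implyP => _.
  by congr (_ `^ _); ring.
rewrite EFinM -muleA -/(gammaE a) -E muleA -EFinM -powRD; last by apply/implyP => _.
by rewrite (_ : 1 - a + (a - 1) = 0) ?powRr0 ?mul1e//; ring.
Qed.

(** The Beta integral B(1 - a, 2 a - 1) in the form int_0^oo s^(-a) (1 + s)^(-a) ds. *)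
Definition betaE (a : R) : \bar R := (\int[mu]_s (p s (- a) * p (1 + s) (- a))%:E)%E.

Lemma betaE_ge0 a : (0 <= betaE a)%E.
Proof. by apply: integral_ge0 => x _; rewrite lee_fin mulr_ge0 ?pos_powR_ge0. Qed.

Let mfst : measurable_fun setT (fun z : m2 => z.1). Proof. exact: measurable_fst. Qed.
Let msnd : measurable_fun setT (fun z : m2 => z.2). Proof. exact: measurable_snd. Qed.

(** Both sides equal the double integral of y^(a-1) s^(-a) exp(-(1+s) y): the substitution x = y s
    in the first Gamma integral produces it, and integrating in y first gives Gamma(a) (1+s)^(-a).
    The relation 2 a = D + 1 matches the powers of y. *)
Lemma beta_gamma (a D : R) : 2 * a = D + 1 ->
  (gammaE (1 - a) * gammaE D = betaE a * gammaE a)%E.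
Proof.
move=> aD.
have mg1 b : measurable_fun setT (fun x : R => (p x (b - 1) * expR (- x))%:E).
  by apply/measurable_EFinP; have := mgam b 1; under eq_fun do rewrite mul1r.
have g10 b x : (0 <= (p x (b - 1) * expR (- x))%:E)%E.
  by rewrite lee_fin mulr_ge0 ?pos_powR_ge0 ?expR_ge0.
transitivity (\int[mu]_y \int[mu]_s (p y (a - 1) * (p s (- a) * expR (- ((1 + s) * y))))%:E)%E.
  rewrite muleC {1}/gammaE -ge0_integralZr//; [|exact: mg1|exact: gammaE_ge0].
  apply: eq_integral => y _; have [y0|y0] := ltP 0 y; last first.
    rewrite !(pos_powR_le0 _ y0) mul0r mul0e integral0_eq// => s _.
    by rewrite mul0r.
  have := gammaE_scale (1 - a) y0.
  rewrite (_ : 1 - a - 1 = - a); last ring.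
  move=> E; have -> : gammaE (1 - a) = ((y `^ (1 - a))%:E * \int[mu]_s (p s (- a) * expR (- (y * s)))%:E)%E.
    rewrite E muleA -EFinM -powRD; last by apply/implyP => _; rewrite gt_eqF.
    by rewrite subrr powRr0 mul1e.
  rewrite muleA -EFinM -ge0_integralZl; last 4 first.
  - exact: measurableT.
  - apply/measurable_EFinP; apply: measurable_funM; [exact: measurable_pos_powR|exact: mexp].
  - by move=> s _; rewrite lee_fin mulr_ge0 ?pos_powR_ge0 ?expR_ge0.
  - by rewrite lee_fin !mulr_ge0 ?pos_powR_ge0 ?expR_ge0 ?powR_ge0.
  apply: eq_integral => s _; rewrite -EFinM; congr (_%:E).
  have main (z t q : R) : 0 < z ->
      z `^ (D - 1) * expR (- z) * z `^ (1 - a) * (q * expR (- (z * t))) = z `^ (a - 1) * (q * expR (- ((1 + t) * z))).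
    move=> z0; have -> : - ((1 + t) * z) = - z + - (z * t) by ring.
    rewrite expRD.
    have -> : z `^ (a - 1) = z `^ (D - 1) * z `^ (1 - a).
      rewrite -powRD; last by apply/implyP => _; rewrite gt_eqF.
      by congr (_ `^ _); lra.
    by ring.
  by rewrite !(pos_powR_gt0E _ y0) main.
rewrite tonelli; last 2 first.
- apply: measurable_funM; first exact: (measurableT_comp (measurable_pos_powR _) mfst).
  apply: measurable_funM; first exact: (measurableT_comp (measurable_pos_powR _) msnd).
  apply: (measurableT_comp (continuous_measurable_fun (@continuous_expR R))).
  apply: measurable_funN; apply: measurable_funM => //; exact: measurable_funD.
- by move=> x y; rewrite !mulr_ge0 ?pos_powR_ge0 ?expR_ge0.
rewrite /betaE -ge0_integralZr//; last 3 first.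
- apply/measurable_EFinP; apply: measurable_funM; first exact: measurable_pos_powR.
  by apply: (measurableT_comp (measurable_pos_powR _)); exact: measurable_funD.
- by move=> s _; rewrite lee_fin mulr_ge0 ?pos_powR_ge0.
- exact: gammaE_ge0.
apply: eq_integral => s _; have [s0|s0] := ltP 0 s; last first.
  rewrite (pos_powR_le0 _ s0) mul0r mul0e integral0_eq// => y _.
  by rewrite mul0r mulr0.
have s1 : 0 < 1 + s by rewrite addr_gt0.
under eq_integral do rewrite mulrCA EFinM.
rewrite ge0_integralZl; last 4 first.
- exact: measurableT.
- by apply/measurable_EFinP; exact: mgam.
- by move=> y _; rewrite lee_fin.
- by rewrite lee_fin pos_powR_ge0.
by rewrite gammaE_scale// muleA -EFinM (pos_powR_gt0E _ s1).
Qed.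

(** Above, the integrand is dominated by x^(a-1) on ]0, 1] and by exp(-x) beyond; below, it is at
    least exp(-1) on ]0, 1]. Finiteness and positivity permit division in the Beta identity. *)
Lemma gammaE_fin (a : R) : 0 < a < 1 -> exists2 g : R, 0 < g & gammaE a = g%:E.
Proof.
move=> /andP[a0 a1]; have b1 : 1 - a < 1 by lra.
have up : (gammaE a <= ((1 `^ (1 - (1 - a)) / (1 - (1 - a))) + 1)%:E)%E.
  rewrite EFinD -(pos_powR_integral b1 ler01) -(integral_exponential_pdf (@ltr01 R)).
  rewrite -ge0_integralD//; last 4 first.
  - by move=> x _; rewrite lee_fin mulr_ge0 ?pos_powR_ge0.
  - by apply/measurable_EFinP; apply: measurable_funM => //; exact: measurable_pos_powR.
  - by move=> x _; rewrite lee_fin exponential_pdf_ge0.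
  - by apply/measurable_EFinP; exact: measurable_exponential_pdf.
  apply: ge0_le_integral => //.
  - by move=> x _; rewrite lee_fin mulr_ge0 ?pos_powR_ge0 ?expR_ge0.
  - by apply/measurable_EFinP; have := mgam a 1; under eq_fun do rewrite mul1r.
  - apply: emeasurable_funD; apply/measurable_EFinP; last exact: measurable_exponential_pdf.
    by apply: measurable_funM => //; exact: measurable_pos_powR.
  move=> x _; rewrite -EFinD lee_fin opprB; have [x0|x0] := ltP 0 x; last first.
    by rewrite !(pos_powR_le0 _ x0) mul0r mulr0 add0r exponential_pdf_ge0.
  rewrite exponential_pdfE ?(ltW x0)// mul1r mulN1r indicE.
  have [x1|x1] := leP x 1.
    rewrite mem_set /=; last by rewrite in_itv/= x0.
    rewrite mul1r ler_wpDr ?expR_ge0// ler_piMr ?pos_powR_ge0//.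
    by rewrite -[leRHS]expR0 ler_expR oppr_le0 ltW.
  rewrite pos_powR_gt0E// ler_wpDl ?mulr_ge0 ?powR_ge0// ler_piMl ?expR_ge0//.
  by rewrite -[leRHS](powRr0 x) ler_powR// ?ltW//; lra.
have low : ((expR (- 1))%:E <= gammaE a)%E.
  have -> : expR (- 1) = expR (- 1) * (1 `^ (1 - 0) / (1 - 0)) :> R by rewrite powR1 subr0 divr1 mulr1.
  have z1 : (0 : R) < 1 by [].
  rewrite EFinM -(pos_powR_integral z1 ler01) -ge0_integralZl//; last 2 first.
  - by apply/measurable_EFinP; apply: measurable_funM => //; exact: measurable_pos_powR.
  - by move=> x _; rewrite lee_fin mulr_ge0 ?pos_powR_ge0.
  apply: ge0_le_integral => //.
  - by move=> x _; rewrite -EFinM lee_fin !mulr_ge0 ?pos_powR_ge0 ?expR_ge0.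
  - apply/measurable_EFinP; apply: measurable_funM => //; apply: measurable_funM => //.
    exact: measurable_pos_powR.
  - by apply/measurable_EFinP; have := mgam a 1; under eq_fun do rewrite mul1r.
  move=> x _; rewrite -EFinM lee_fin oppr0 indicE.
  case: (boolP (x \in _)) => [|_]; last by rewrite mul0r mulr0 mulr_ge0 ?pos_powR_ge0 ?expR_ge0.
  rewrite inE/= in_itv/= => /andP[x0 x1]; rewrite !pos_powR_gt0E// powRr0 !mulr1 -[leLHS]mul1r.
  apply: ler_pM => //.
    by rewrite -[leLHS](powRr0 x) ger_powR ?x0//; lra.
  by rewrite ler_expR lerN2.
have fin : gammaE a \is a fin_num.
  by rewrite ge0_fin_numE ?gammaE_ge0//; apply: le_lt_trans up _; rewrite ltry.
exists (fine (gammaE a)); last by rewrite fineK.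
rewrite -lte_fin fineK//; apply: lt_le_trans low; by rewrite lte_fin expR_gt0.
Qed.

Lemma gammaE_Gamma (a : R) : Gamma a = fine (gammaE a).
Proof.
rewrite /Gamma /Rintegral integral_mkcond; congr fine; apply: eq_integral => x _.
rewrite patchE /=; case: ifPn => [|].
  by rewrite inE/= in_itv/= andbT => x0; rewrite pos_powR_gt0E.
move=> /negP h; rewrite pos_powR_le0 ?mul0r// leNgt; apply/negP => x0; apply: h.
by rewrite inE/= in_itv/= x0.
Qed.

Lemma betaE_kconst (D : R) : 0 < D < 1 -> 0 < kconst D /\ betaE ((D + 1) / 2) = (kconst D)%:E.
Proof.
move=> /andP[D0 D1]; set a := (D + 1) / 2.
have aD : 2 * a = D + 1 by rewrite /a; field.
have ha : 0 < a < 1 by rewrite /a; apply/andP; split; lra.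
have ha' : 0 < 1 - a < 1 by rewrite /a; apply/andP; split; lra.
have hD : 0 < D < 1 by apply/andP.
have [g g0 gE] := gammaE_fin ha.
have [g' g'0 g'E] := gammaE_fin ha'.
have [h h0 hE] := gammaE_fin hD.
have kE : kconst D = g' * h / g.
  rewrite /kconst /Beta !gammaE_Gamma (_ : (1 - D) / 2 = 1 - a); last by rewrite /a; field.
  by rewrite (_ : 1 - a + D = a) ?gE ?g'E ?hE//; rewrite /a; field.
split; first by rewrite kE divr_gt0// mulr_gt0.
have := beta_gamma aD; rewrite gE g'E hE -EFinM => E.
have := betaE_ge0 a; move: E; case: (betaE a) => [r| |]//=.
  by rewrite -EFinM => -[E] _; rewrite kE E mulfK// gt_eqF.
by rewrite mulyr gtr0_sg// mul1e.
Qed.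

End kernel.

Section kernel_norm.
Context {R : realType}.
Local Notation mu := (@lebesgue_measure R).
Local Notation p := (@pos_powR R).
Variable D : R.
Hypothesis D01 : 0 < D < 1.

Let Db : 0 < D /\ D < 1. Proof. exact/andP. Qed.
Let a : R := (D + 1) / 2.
Let a1 : a < 1. Proof. by have [D0 D1] := Db; rewrite /a; lra. Qed.
Let K (y : R) : R := p y (- a).
Let one (u : R) : R := \1_`[0, 1] u.
Let f := Z1_kernel D 1.

Let m2 := (measurableTypeR R * measurableTypeR R)%type.
Let mfst : measurable_fun setT (fun z : m2 => z.1). Proof. exact: measurable_fst. Qed.
Let msnd : measurable_fun setT (fun z : m2 => z.2). Proof. exact: measurable_snd. Qed.
Let K0 y : 0 <= K y. Proof. exact: pos_powR_ge0. Qed.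
Let one0 u : 0 <= one u. Proof. by rewrite /one indicE. Qed.
Let mK : measurable_fun setT K. Proof. exact: measurable_pos_powR. Qed.
Let mone : measurable_fun setT one. Proof. exact: measurable_indic. Qed.

Let mKsub (x : R) : measurable_fun setT (fun u : R => K (u - x)).
Proof. by apply: (measurableT_comp mK); exact: measurable_funB. Qed.

Let mKbus (u : R) : measurable_fun setT (fun x : R => K (u - x)).
Proof. by apply: (measurableT_comp mK); exact: measurable_funB. Qed.

Let oneE u : one u = ((0 <= u) && (u <= 1))%:R.
Proof.
rewrite /one indicE; congr (_%:R); congr nat_of_bool.
by apply/idP/idP; rewrite inE/= in_itv/=.
Qed.

Lemma one_shift_integral (x b c : R) : b < 1 -> 0 <= c ->
  (forall w, 0 < w -> one (w + x) = (w <= c)%R%:R) ->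
  (\int[mu]_u (one u * p (u - x) (- b))%:E = (c `^ (1 - b) / (1 - b))%:E)%E.
Proof.
move=> b1 c0 oc.
have mf : measurable_fun setT (fun w : R => (one (w + x) * p w (- b))%:E).
  apply/measurable_EFinP; apply: measurable_funM; last exact: measurable_pos_powR.
  by apply: (measurableT_comp mone); exact: measurable_funD.
have f0 w : (0 <= (one (w + x) * p w (- b))%:E)%E by rewrite lee_fin mulr_ge0 ?pos_powR_ge0.
have n10 : (1 : R) != 0 by exact: oner_neq0.
have := ge0_integral_affine (- x) n10 mf f0; rewrite normr1 invr1 mul1e.
under eq_integral do rewrite mul1r subrK.
move=> ->; rewrite -(pos_powR_integral b1 c0); apply: eq_integral => w _; congr (_%:E).
have [w0|w0] := ltP 0 w; last by rewrite !(pos_powR_le0 _ w0) !mulr0.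
rewrite oc// indicE; congr (_%:R * _); congr nat_of_bool.
by apply/idP/idP; rewrite inE/= in_itv/= w0.
Qed.

Lemma one_flip_integral (x b c : R) : b < 1 -> 0 <= c ->
  (forall w, 0 < w -> one (x - w) = (w <= c)%R%:R) ->
  (\int[mu]_u (one u * p (x - u) (- b))%:E = (c `^ (1 - b) / (1 - b))%:E)%E.
Proof.
move=> b1 c0 oc.
have mf : measurable_fun setT (fun w : R => (one (x - w) * p w (- b))%:E).
  apply/measurable_EFinP; apply: measurable_funM; last exact: measurable_pos_powR.
  by apply: (measurableT_comp mone); exact: measurable_funB.
have f0 w : (0 <= (one (x - w) * p w (- b))%:E)%E by rewrite lee_fin mulr_ge0 ?pos_powR_ge0.
have n10 : (-1 : R) != 0 by rewrite oppr_eq0 oner_neq0.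
have := ge0_integral_affine x n10 mf f0; rewrite normrN1 invr1 mul1e.
under eq_integral do rewrite mulN1r opprD opprK addrCA subrr addr0 [in p _ _]addrC.
move=> ->; rewrite -(pos_powR_integral b1 c0); apply: eq_integral => w _; congr (_%:E).
have [w0|w0] := ltP 0 w; last by rewrite !(pos_powR_le0 _ w0) !mulr0.
rewrite oc// indicE; congr (_%:R * _); congr nat_of_bool.
by apply/idP/idP; rewrite inE/= in_itv/= w0.
Qed.

(** A real-valued integral defaults to 0 when infinite; the majorant int_0^|1-x| w^(-a) dw shows
    that this does not happen. *)
Lemma kernelE x : ((f x)%:E = \int[mu]_u (one u * K (u - x))%:E)%E.
Proof.
have E : (\int[mu]_(u in `[0%R, 1%R]) (K (u - x))%:E = \int[mu]_u (one u * K (u - x))%:E)%E.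
  rewrite integral_mkcond; apply: eq_integral => u _; rewrite patchE /one indicE.
  by case: ifPn => _; rewrite ?mul1r ?mul0r.
rewrite /f /Z1_kernel /Rintegral; under eq_integral do rewrite -/a -/(K _).
rewrite E fineK// ge0_fin_numE; last first.
  by apply: integral_ge0 => u _; rewrite lee_fin mulr_ge0.
have mf : measurable_fun setT (fun w : R => (one (w + x) * K w)%:E).
  apply/measurable_EFinP; apply: measurable_funM => //.
  by apply: (measurableT_comp mone); exact: measurable_funD.
have f0 w : (0 <= (one (w + x) * K w)%:E)%E by rewrite lee_fin mulr_ge0.
have n10 : (1 : R) != 0 by exact: oner_neq0.
have := ge0_integral_affine (- x) n10 mf f0; rewrite normr1 invr1 mul1e.
under eq_integral do rewrite mul1r subrK.
move=> ->; apply: (@le_lt_trans _ _ (`|1 - x| `^ (1 - a) / (1 - a))%:E); last by rewrite ltry.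
rewrite -(pos_powR_integral a1 (normr_ge0 _)); apply: ge0_le_integral => //.
  by apply/measurable_EFinP; apply: measurable_funM => //; exact: measurable_indic.
move=> w _; rewrite lee_fin oneE /K; have [w0|w0] := ltP 0 w; last by rewrite !(pos_powR_le0 _ w0) !mulr0.
rewrite ler_wpM2r ?pos_powR_ge0// indicE.
case: (boolP (w \in _)) => [|/negP h]; first by case: (_ && _).
case: (boolP (_ && _)) => // /andP[_ h1]; exfalso; apply: h.
rewrite inE/= in_itv/= w0/=; apply: le_trans (ler_norm _); lra.
Qed.

(** This is |h|^(-D) away from h = 0. *)
Let q (h : R) : R := p h (- D) + p (- h) (- D).

(** The inner product of two translates of the singular kernel. *)
Let G (u v : R) : \bar R := (\int[mu]_x (K (u - x) * K (v - x))%:E)%E.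

Let Gshift u v : G u v = (\int[mu]_y (K y * K (y + (v - u)))%:E)%E.
Proof.
have mf : measurable_fun setT (fun x : R => (K (u - x) * K (v - x))%:E).
  by apply/measurable_EFinP; exact: measurable_funM.
have f0 x : (0 <= (K (u - x) * K (v - x))%:E)%E by rewrite lee_fin mulr_ge0.
have n10 : (-1 : R) != 0 by rewrite oppr_eq0 oner_neq0.
rewrite /G; have := ge0_integral_affine u n10 mf f0; rewrite normrN1 invr1 mul1e => <-.
apply: eq_integral => y _; congr (K _ * K _)%:E; ring.
Qed.

(** The substitution y = h s scales out h^(1 - 2 a) = h^(-D) and leaves the Beta integral, the
    origin of k(D). *)
Let Ggt u v : u < v -> G u v = ((v - u) `^ (- D) * kconst D)%:E.
Proof.
rewrite -subr_gt0 Gshift => h0; set h := v - u in h0 *.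
have [_ bE] := betaE_kconst D01.
have hn0 : h != 0 by rewrite gt_eqF.
have mf : measurable_fun setT (fun y : R => (K y * K (y + h))%:E).
  apply/measurable_EFinP; apply: measurable_funM => //.
  by apply: (measurableT_comp mK); exact: measurable_funD.
have f0 y : (0 <= (K y * K (y + h))%:E)%E by rewrite lee_fin mulr_ge0.
have := ge0_integral_affine 0 hn0 mf f0.
have E s : K (h * s + 0) * K (h * s + 0 + h) = (h `^ (- a)) ^+ 2 * (p s (- a) * p (1 + s) (- a)).
  have -> : h * s + 0 + h = h * (1 + s) by ring.
  by rewrite addr0 /K !pos_powRM//; ring.
under eq_integral do rewrite E EFinM.
rewrite ge0_integralZl//; last 3 first.
- apply/measurable_EFinP; apply: measurable_funM; first exact: measurable_pos_powR.
  by apply: (measurableT_comp (measurable_pos_powR _)); exact: measurable_funD.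
- by move=> s _; rewrite lee_fin mulr_ge0 ?pos_powR_ge0.
- by rewrite lee_fin sqr_ge0.
rewrite -/(betaE a) bE gtr0_norm// -EFinM => E2.
have : (h%:E * ((h `^ (- a)) ^+ 2 * kconst D)%:E = h%:E * ((h^-1)%:E * \int[mu]_y (K y * K (y + h))%:E))%E.
  by congr (_ * _)%E.
rewrite muleA -!EFinM mulfV// mul1e => <-; congr EFin.
rewrite mulrA; congr (_ * _).
rewrite -{1}(powRr1 (ltW h0)) -powR_mulrn ?powR_ge0// -powRrM -powRD; last by rewrite hn0 implybT.
by congr (_ `^ _); rewrite /a; field.
Qed.

Let Gneq u v : u != v -> G u v = (q (v - u) * kconst D)%:E.
Proof.
rewrite neq_lt => /orP[uv|vu].
  rewrite Ggt// /q pos_powR_gt0E ?subr_gt0// (@pos_powR_le0 _ (- (v - u))) ?addr0//.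
  by rewrite oppr_le0 subr_ge0 ltW.
have -> : G u v = G v u by apply: eq_integral => x _; rewrite mulrC.
rewrite Ggt// /q opprB (@pos_powR_le0 _ (v - u)) ?add0r ?pos_powR_gt0E ?subr_gt0//.
by rewrite subr_le0 ltW.
Qed.

Let mq (u : R) : measurable_fun setT (fun v : R => q (v - u)).
Proof.
have mp := measurable_pos_powR (- D).
apply: measurable_funD; apply: (measurableT_comp mp); first exact: measurable_funB.
by apply: measurable_funN; exact: measurable_funB.
Qed.

Let q0 h : 0 <= q h. Proof. by rewrite addr_ge0 ?pos_powR_ge0. Qed.

(** By Tonelli this is, up to k(D), the integral of |v - u|^(-D) over v in [0, 1], which splits at v
    = u into two power integrals. *)
Let row u : (\int[mu]_x (one u * K (u - x) * f x)%:E =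
  (kconst D / (1 - D) * (one u * p (1 - u) (1 - D) + one u * p (u - 0) (1 - D)))%:E)%E.
Proof.
have [D0 D1] := Db; have [k0 _] := betaE_kconst D01.
transitivity (\int[mu]_x \int[mu]_v (one u * K (u - x) * (one v * K (v - x)))%:E)%E.
  apply: eq_integral => x _; rewrite EFinM kernelE -ge0_integralZl//.
  - by apply/measurable_EFinP; exact: (measurable_funM mone (mKsub x)).
  - by move=> v _; rewrite lee_fin mulr_ge0.
  - by rewrite lee_fin mulr_ge0.
rewrite (tonelli (f := fun x v => one u * K (u - x) * (one v * K (v - x)))); last 2 first.
- apply: measurable_funM; first apply: measurable_funM => //.
    by apply: (measurableT_comp mK); exact: measurable_funB.
  apply: measurable_funM; first exact: (measurableT_comp mone msnd).
  by apply: (measurableT_comp mK); exact: measurable_funB.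
- by move=> x v; rewrite !mulr_ge0.
transitivity (\int[mu]_v (one u * one v * (q (v - u) * kconst D))%:E)%E.
  have inner v : (\int[mu]_x (one u * K (u - x) * (one v * K (v - x)))%:E = (one u * one v)%:E * G u v)%E.
    rewrite -ge0_integralZl//.
    - by apply: eq_integral => x _; rewrite -EFinM; congr EFin; ring.
    - by apply/measurable_EFinP; exact: (measurable_funM (mKbus u) (mKbus v)).
    - by move=> x _; rewrite lee_fin mulr_ge0.
    - by rewrite lee_fin mulr_ge0.
  under eq_integral do rewrite inner.
  have mg : measurable_fun setT (fun v : R => (one u * one v * (q (v - u) * kconst D))%:E).
    by apply/measurable_EFinP; apply: measurable_funM; exact: measurable_funM.
  (* On the diagonal v = u the inner product is infinite, but a single point does not affect the
     integral over v. *)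
  have E v : v \in ([set: R] `\ u) -> ((one u * one v * (q (v - u) * kconst D))%:E = (one u * one v)%:E * G u v)%E.
    by rewrite inE => -[_ /= /eqP vu]; rewrite Gneq 1?eq_sym.
  have mgu : measurable_fun ([set: R] `\ u) (fun v : R => (one u * one v * (q (v - u) * kconst D))%:E).
    exact: measurable_funTS.
  have mD : measurable ([set: R] `\ u) by exact: measurableD.
  have mgu' : measurable_fun ([set: R] `\ u) (fun v => ((one u * one v)%:E * G u v)%E).
    by apply: eq_measurable_fun mgu => v /E.
  rewrite -(integral_setD1 mD mgu') -(integral_setD1 mD mgu).
  by apply/esym; apply: eq_integral.
rewrite oneE; have [u01|u01] := boolP ((0 <= u) && (u <= 1)); last first.
  by rewrite !mul0r addr0 mulr0 integral0_eq// => v _; rewrite !mul0r.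
have /andP[u0 u1] := u01.
rewrite !mul1r.
under eq_integral do rewrite mul1r mulrA mulrC EFinM.
rewrite ge0_integralZl//; last 3 first.
- by apply/measurable_EFinP; exact: (measurable_funM mone (mq u)).
- by move=> v _; rewrite lee_fin mulr_ge0.
- by rewrite lee_fin ltW.
under eq_integral do rewrite /q mulrDr EFinD opprB.
rewrite ge0_integralD//; last 4 first.
- by move=> v _; rewrite lee_fin mulr_ge0 ?pos_powR_ge0.
- apply/measurable_EFinP; apply: measurable_funM => //.
  by apply: (measurableT_comp (measurable_pos_powR _)); exact: measurable_funB.
- by move=> v _; rewrite lee_fin mulr_ge0 ?pos_powR_ge0.
- apply/measurable_EFinP; apply: measurable_funM => //.
  by apply: (measurableT_comp (measurable_pos_powR _)); exact: measurable_funB.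
have u1' : 0 <= 1 - u by rewrite subr_ge0.
rewrite (one_shift_integral D1 u1'); last first.
  by move=> w w0; rewrite oneE addr_ge0 ?(ltW w0)//= lerBrDr.
rewrite (one_flip_integral D1 u0); last first.
  move=> w w0; rewrite oneE subr_ge0 andbC (_ : u - w <= 1)//.
  by rewrite lerBlDr; apply: le_trans u1 _; rewrite lerDl ltW.
have pE (c : R) : 0 <= c -> p c (1 - D) = c `^ (1 - D).
  rewrite le_eqVlt => /predU1P[<-|c0]; last by rewrite pos_powR_gt0E.
  by rewrite pos_powR_le0// powR0// gt_eqF// subr_gt0.
by rewrite subr0 !pE// -EFinD -EFinM; congr EFin; field; rewrite gt_eqF// subr_gt0.
Qed.

(** One factor of f^2 is expanded as an integral over u and exchanged with x; the two powers in
    [row] each integrate to 1/(2 - D). *)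
Lemma kernel_norm : measurable_fun setT f ->
  mu.-integrable setT (EFin \o (fun x => f x ^+ 2)) /\
  \int[mu]_x (f x ^+ 2) = kconst D * (2 / ((1 - D) * (2 - D))).
Proof.
move=> mf; have [D0 D1] := Db; have [k0 _] := betaE_kconst D01.
have f0 x : 0 <= f x by rewrite -lee_fin kernelE; apply: integral_ge0 => u _; rewrite lee_fin mulr_ge0.
have main : (\int[mu]_x (f x ^+ 2)%:E = (kconst D * (2 / ((1 - D) * (2 - D))))%:E)%E.
  transitivity (\int[mu]_x \int[mu]_u (one u * K (u - x) * f x)%:E)%E.
    apply: eq_integral => x _; under eq_integral do rewrite EFinM.
    rewrite ge0_integralZr//.
    - by rewrite -kernelE -EFinM expr2.
    - by apply/measurable_EFinP; exact: (measurable_funM mone (mKsub x)).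
    - by move=> u _; rewrite lee_fin mulr_ge0.
    - by rewrite lee_fin.
  rewrite (tonelli (f := fun x u => one u * K (u - x) * f x)); last 2 first.
  - apply: measurable_funM; last exact: (measurableT_comp mf mfst).
    apply: measurable_funM; first exact: (measurableT_comp mone msnd).
    by apply: (measurableT_comp mK); exact: measurable_funB.
  - by move=> x u; rewrite !mulr_ge0.
  under eq_integral do rewrite row EFinM EFinD.
  have c0 : 0 <= kconst D / (1 - D) by rewrite divr_ge0 ?subr_ge0 ?ltW.
  have mp1 : measurable_fun setT (fun u : R => (one u * p (1 - u) (1 - D))%:E).
    apply/measurable_EFinP; apply: measurable_funM => //.
    by apply: (measurableT_comp (measurable_pos_powR _)); exact: measurable_funB.
  have mp2 : measurable_fun setT (fun u : R => (one u * p (u - 0) (1 - D))%:E).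
    apply/measurable_EFinP; apply: measurable_funM => //.
    by apply: (measurableT_comp (measurable_pos_powR _)); exact: measurable_funB.
  have p10 x : (0 <= (one x * p (1 - x) (1 - D))%:E)%E by rewrite lee_fin mulr_ge0 ?pos_powR_ge0.
  have p20 x : (0 <= (one x * p (x - 0) (1 - D))%:E)%E by rewrite lee_fin mulr_ge0 ?pos_powR_ge0.
  rewrite ge0_integralZl//; last 2 first.
  - exact: emeasurable_funD.
  - by move=> x _; rewrite adde_ge0.
  rewrite ge0_integralD//.
  (* The power integrals are reused with b = D - 1, whose opposite is the exponent 1 - D. *)
  have D1' : D - 1 < 1 by lra.
  have := one_shift_integral D1' ler01; rewrite opprB => /(_ 0) ->; last first.
    by move=> w w0; rewrite addr0 oneE (ltW w0).
  have := one_flip_integral D1' ler01; rewrite opprB => /(_ 1) ->; last first.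
    move=> w w0; rewrite oneE subr_ge0 andbC (_ : 1 - w <= 1)//.
    by rewrite lerBlDr lerDl ltW.
  rewrite powR1 -EFinD -EFinM; congr EFin; field.
  by apply/andP; split; rewrite gt_eqF//; lra.
split; last by rewrite /Rintegral main.
apply/integrableP; split; first by apply/measurable_EFinP; exact: measurable_funX.
under eq_integral do rewrite /= ger0_norm ?sqr_ge0//.
by rewrite main ltry.
Qed.

End kernel_norm.

(** * Matching the limit laws with the normalized Wiener integral *)

Lemma gaussian_rv_scale d (T : measurableType d) (R : realType) (P : probability T R)
    (X : {RV P >-> R}) (c v : R) : 0 <= c -> 0 <= v ->
  gaussian_rv X 0 v -> gaussian_rv (scale_mfun c X : {RV P >-> R}) 0 (c ^+ 2 * v).
Proof.
move=> c0 v0 /(gaussian_rvP _ _ v0) XE; apply/gaussian_rvP; first by rewrite mulr_ge0 ?sqr_ge0.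
move=> A mA; have -> : (scale_mfun c X : {RV P >-> R}) @^-1` A = X @^-1` ((fun x : R => x * c) @^-1` A) by [].
rewrite XE; last first.
  rewrite -[X in measurable X]setTI.
  have m : measurable_fun setT (fun x : R => x * c) by exact: measurable_funM.
  exact: m.
apply: congr1; apply/funext => x /=; congr A.
by rewrite sqrtrM ?sqr_ge0// sqrtr_sqr ger0_norm//; ring.
Qed.

Theorem proposition5 (R : realType)
  (d : measure_display) (T : measurableType d) (P : probability T R)
  (d' : measure_display) (T' : measurableType d') (Q : probability T' R)
  (theta D : R) (rho : nat -> R) (L : R -> R)
  (X Y : nat -> {RV P >-> R})
  (B : R -> {RV Q >-> R}) (Z : {RV Q >-> R})
  (hD : 0 < D < 1)
  (hXgauss : gaussian_process X)
  (hXstat : stationary X)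
  (hXmean : forall i, ('E_P[X i] = 0)%E)
  (hXcov : forall k, ('E_P[(X 0%N * X k)%R] = (rho k)%:E)%E)
  (hrho0 : rho 0%N = 1)
  (hrho : forall k, (1 <= k)%N -> rho k = k%:R `^ (- D) * L k%:R)
  (hLslow : slowly_varying L)
  (hLpos : \forall k \near \oo, 0 < L k%:R)
  (hY : forall i w, Y i w = theta + X i w)
  (hB : brownian_motion B)
  (hZ : wiener_integral B (Z1_kernel D 1) Z) :
  let a n := n%:R `^ (D / 2) * L n%:R `^ (- 2^-1) in
  let W : {RV Q >-> R} := scale_mfun (kconst D `^ (- 2^-1)) Z in
  let HL n : {RV P >-> R} := scale_mfun (a n) (hodges_lehmann theta X n - cst theta) in
  let M n : {RV P >-> R} := scale_mfun (a n) (sample_mean Y n - cst theta) in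
  [/\ cvg_in_distribution HL W,
      gaussian_rv W 0 (2 * (- D + 1)^-1 * (- D + 2)^-1) &
      cvg_in_distribution M W].
Proof.
move=> a W HL M.
have reg := slowly_varying_reg hrho hLslow.
have pos : \forall k \near \oo, 0 < rho k.
  near=> k; have k0 : (0 < k)%N by near: k; exists 1%N.
  by rewrite hrho// mulr_gt0 ?powR_gt0 ?ltr0n//; near: k.
(* Splitting the square root needs [L] positive, which holds only for large n, so the identity is an
   eventual one. *)
have aE : \forall n \near \oo, a n = (Num.sqrt (rho n))^-1.
  near=> n; have n0 : (0 < n)%N by near: n; exists 1%N.
  have Ln : 0 < L n%:R by near: n.
  rewrite /a hrho// -powR12_sqrt ?mulr_ge0 ?powR_ge0 ?(ltW Ln)//.
  rewrite powRM ?powR_ge0 ?(ltW Ln)// -powRrM invfM -!powRN; congr (_ `^ _ * _).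
  by rewrite mulNr opprK.
pose v : R := 2 / ((1 - D) * (2 - D)).
have v0 : 0 < v := lim_var_gt0 hD.
have [k0 _] := betaE_kconst hD.
have [fi fE] := kernel_norm hD hZ.1.
(* The square of k(D)^(-1/2) cancels the factor k(D) in the squared norm of the kernel. *)
have WG : gaussian_rv W 0 v.
  have ZG := wiener_gaussian hB hZ fi; rewrite fE in ZG.
  have := gaussian_rv_scale (powR_ge0 (kconst D) (- 2^-1)) (mulr_ge0 (ltW k0) (ltW v0)) ZG.
  suff -> : (kconst D `^ (- 2^-1)) ^+ 2 * (kconst D * v) = v by [].
  rewrite -powR_mulrn ?powR_ge0// -powRrM mulNr mulVf ?pnatr_eq0//.
  by rewrite powR_inv1 ?(ltW k0)// mulKf ?gt_eqF.
split.
- move=> x _; rewrite (gaussian_rv_cdf x v0 WG).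
  have E n : cdf (HL n) x = (pr P [set w | a n * generalized_inverse (U_process (fun i => X i w) n) 2^-1 <= x])%:E.
    have -> : [set w | a n * generalized_inverse (U_process (fun i => X i w) n) 2^-1 <= x] = HL n @^-1` `]-oo, x].
      by apply/seteqP; split => w /=; rewrite in_itv/= /hodges_lehmann/= addrAC subrr add0r mulrC.
    rewrite -prE//; exact: measurable_funPTI.
  under eq_cvg do rewrite E.
  by apply/cvg_EFin; [near=> n|exact: (hodges_lehmann_cvg hXgauss hXstat hXmean hXcov hrho0 hD reg pos aE)].
- have -> : 2 * (- D + 1)^-1 * (- D + 2)^-1 = v by rewrite /v invfM mulrA ![- D + _]addrC.
  exact: WG.
- move=> x _; rewrite (gaussian_rv_cdf x v0 WG).
  (* The shift by theta passes through the mean only for n > 0, since the mean of no variables is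
     0. *)
  have E : \forall n \near \oo, (pr P [set w | a n * sample_mean X n w <= x])%:E = cdf (M n) x.
    near=> n; have n0 : (0 < n)%N by near: n; exists 1%N.
    have mE w : M n w = a n * sample_mean X n w.
      rewrite /M/= mulrC; congr (_ * _); rewrite /sample_mean.
      under eq_bigr do rewrite hY.
      rewrite big_split/= sum_cst_ord mulrDr mulKf ?pnatr_eq0 -?lt0n//; ring.
    have -> : [set w | a n * sample_mean X n w <= x] = M n @^-1` `]-oo, x].
      by apply/seteqP; split => w /=; rewrite in_itv/= -mE.
    rewrite -prE//; exact: measurable_funPTI.
  suff h : (pr P [set w | a n * sample_mean X n w <= x])%:E @[n --> \oo] --> (gcdf (x / Num.sqrt v))%:E.
    by apply: cvg_trans h; exact: near_eq_cvg.
  have h := sample_mean_cvg hXgauss hXstat hXmean hXcov hD reg pos aE (y := x).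
  apply/cvg_EFin; first by near=> n.
  exact: h.
Unshelve. all: by end_near. Qed.
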